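(* Let $m\ge 2$ be a real number and let $z:\mathbb{R}^2\to\mathbb{R}$ be a nonnegative function, homogeneous of order $m$, with $z\in C^\infty(\mathbb{R}^2\setminus\{0\})$, so that in polar coordinates $z=r^mP(\theta)$ with $P\in C^\infty(S^1)$. Let $S=\{R(s,t)=(s,t,z(s,t)):(s,t)\in\mathbb{R}^2\}$. Assume $S$ has nonnegative Gaussian curvature and no asymptotic curves (so that $P(\theta)>0$ for all $\theta$), and that there is a finite set $\{\theta_1,\dots,\theta_\ell\}$ such that $$m^2P(\theta)^2+mP(\theta)P''(\theta)-(m-1)P'(\theta)^2>0\qquad\text{for all }\theta\notin\{\theta_1,\dots,\theta_\ell\}.$$ Let $b,c_1,c_2$ be the functions of $\theta$ and $b_1,b_2$ the numbers attached to $z$ defined in the context, and suppose that $c_1,c_2\in L^1([0,2\pi])$ and $$\left(b_2\mathbb{N}+b_1\mathbb{Z}\right)\cap\left(mb_1\mathbb{N}+\pi\mathbb{Z}\right)=\emptyset.$$ Then for every $k,l\in\mathbb{N}$ there exist $U^1,\dots,U^l\in C^k(\mathbb{R}^2,\mathbb{R}^3)$ such that the deformation of $S$ given by the position vector $$R(s,t)+2\epsilon U^1(s,t)+\cdots+2\epsilon^lU^l(s,t)$$ is a nontrivial infinitesimal bending of $S$ of order $l$.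
   Context: $\mathbb{N}=\{1,2,3,\dots\}$. Polar coordinates: $s=r\cos\theta$, $t=r\sin\theta$. Define (the expressions are independent of $r$ by homogeneity, and $'$ denotes $d/d\theta$) $$H(\theta)=\begin{pmatrix} h_{11} & h_{12} \\ h_{21} & h_{22} \end{pmatrix}=\frac{1}{(m^2-m)r^{m-2}P(\theta)}\begin{pmatrix} z_{tt} & -z_{st} \\ -z_{st} & z_{ss} \end{pmatrix},\qquad b(\theta)=\sqrt{\det H(\theta)},$$ $$c_1=\frac{-h_{21}}{b}\,\frac{h_{11}'}{h_{11}},\qquad c_2=\frac{-h_{21}}{b}\,\frac{h_{22}'}{h_{22}}\qquad(\theta\ne\theta_i),$$ $$b_1=\int_0^{2\pi}b(\theta)\,d\theta,\qquad b_2=-\frac14\int_0^{2\pi}\big(c_1(\theta)-c_2(\theta)\big)\,d\theta.$$ A deformation $R_\epsilon=R+2\sum_{j=1}^{q}\epsilon^jU^j$ is an infinitesimal bending of $S$ of order $q$ if $dR_\epsilon^2=dR^2+o(\epsilon^q)$ as $\epsilon\to0$; equivalently $dR\cdot dU^1=0$ and $dR\cdot dU^j=-\sum_{i=1}^{j-1}dU^i\cdot dU^{j-i}$ for $2\le j\le q$. Trivial bendings are those generated by rigid motions of $\mathbb{R}^3$; the trivial first order fields are $U^1=A\times R+B$ with constant $A,B\in\mathbb{R}^3$. The bending is nontrivial if $U^1$ is not of this form. *)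

(* Defs.v *)
From HB Require Import structures.
From mathcomp Require Import all_boot all_order all_algebra.
From mathcomp Require Import all_classical all_reals all_analysis.
Set Implicit Arguments.
Unset Strict Implicit.
Unset Printing Implicit Defensive.
Import Order.TTheory GRing.Theory Num.Theory.
Import numFieldNormedType.Exports.
Local Open Scope classical_set_scope.
Local Open Scope ring_scope.

Definition vec2 (R : pzRingType) (x y : R) : 'rV[R]_2 :=
  \row_(i < 2) [:: x; y]`_i.

Definition vec3 (R : pzRingType) (x y w : R) : 'rV[R]_3 :=
  \row_(i < 3) [:: x; y; w]`_i.

Definition cross (R : pzRingType) (u v : 'rV[R]_3) : 'rV[R]_3 :=
  vec3 (u 0 1 * v 0 2 - u 0 2 * v 0 1)
       (u 0 2 * v 0 0 - u 0 0 * v 0 2)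
       (u 0 0 * v 0 1 - u 0 1 * v 0 0).

Definition dotp (R : pzRingType) n (u v : 'rV[R]_n) : R :=
  \sum_(i < n) u 0 i * v 0 i.

Section Smoothness.
Variables (R : realType) (n : nat) (W : normedModType R).

Definition pder (i : 'I_n) (f : 'rV[R]_n -> W) : 'rV[R]_n -> W :=
  'D_(delta_mx 0 i) f.

(* Meant for an open set D. *)
Fixpoint Ck (k : nat) (D : set 'rV[R]_n) (f : 'rV[R]_n -> W) : Prop :=
  (forall x, D x -> {for x, continuous f}) /\
  (if k is k'.+1 then
     forall i : 'I_n,
       (forall x, D x -> derivable f x (delta_mx 0 i)) /\ Ck k' D (pder i f)
   else True).

Definition Cinfty (D : set 'rV[R]_n) (f : 'rV[R]_n -> W) : Prop :=
  forall k, Ck k D f.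

End Smoothness.

(* Coordinates of the plane: index 0 is s, index 1 is t. *)
Section Graph.
Variables (R : realType) (m : R) (z : 'rV[R]_2 -> R).
Implicit Types (p v : 'rV[R]_2) (x : R).

Definition homogeneous_of_order : Prop :=
  forall (a : R) p, 0 < a -> z (a *: p) = a `^ m * z p.

Definition graph p : 'rV[R]_3 := vec3 (p 0 0) (p 0 1) (z p).

Definition z_s : 'rV[R]_2 -> R := pder 0 z.
Definition z_t : 'rV[R]_2 -> R := pder 1 z.
Definition z_ss : 'rV[R]_2 -> R := pder 0 z_s.
Definition z_st : 'rV[R]_2 -> R := pder 1 z_s.
Definition z_tt : 'rV[R]_2 -> R := pder 1 z_t.

Definition gaussian_curvature p : R :=
  (z_ss p * z_tt p - z_st p ^+ 2) / (1 + z_s p ^+ 2 + z_t p ^+ 2) ^+ 2.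

Definition second_fundamental_form p v : R :=
  (z_ss p * v 0 0 ^+ 2 + 2 * z_st p * v 0 0 * v 0 1 + z_tt p * v 0 1 ^+ 2)
  / Num.sqrt (1 + z_s p ^+ 2 + z_t p ^+ 2).

(* A curve on S is given by its projection g to the parameter plane. It avoids
   the origin, where z need not be twice differentiable. *)
Definition asymptotic_curve (a b : R) (g : R -> 'rV[R]_2) : Prop :=
  [/\ a < b,
      forall x, x \in `]a, b[ -> g x != 0,
      forall x, x \in `]a, b[ -> derivable g x 1 /\ {for x, continuous (derive1 g)},
      forall x, x \in `]a, b[ -> derive1 g x != 0 &
      forall x, x \in `]a, b[ -> second_fundamental_form (g x) (derive1 g x) = 0].

Definition has_no_asymptotic_curve : Prop :=
  ~ exists a b g, asymptotic_curve a b g.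

Definition polar_dir x : 'rV[R]_2 := vec2 (cos x) (sin x).

(* The angular part of z: z = r^m P(theta). *)
Definition P x : R := z (polar_dir x).

(* The second derivatives of z are homogeneous of order m - 2, so the factor
   r^(m-2) cancels and H may be evaluated on the unit circle r = 1. *)
Definition H x : 'M[R]_2 :=
  ((m ^+ 2 - m) * P x)^-1 *:
  \matrix_(i < 2)
    [:: vec2 (z_tt (polar_dir x)) (- z_st (polar_dir x));
        vec2 (- z_st (polar_dir x)) (z_ss (polar_dir x))]`_i.

Definition b x : R := Num.sqrt (\det (H x)).

Definition h11 x : R := H x 0 0.
Definition h21 x : R := H x 1 0.
Definition h22 x : R := H x 1 1.

(* Where b vanishes, division by 0 gives the value 0; under the hypotheses of
   the theorem this happens only at finitely many angles. *)
Definition c1 x : R := - h21 x / b x * (derive1 h11 x / h11 x).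
Definition c2 x : R := - h21 x / b x * (derive1 h22 x / h22 x).

Definition b1 : R := \int[lebesgue_measure]_(x in `[0, 2 * pi]) b x.
Definition b2 : R :=
  - 4^-1 * \int[lebesgue_measure]_(x in `[0, 2 * pi]) (c1 x - c2 x).

End Graph.

(* The set x N + y Z with N = {1, 2, ...}. *)
Definition NZ_span (R : realType) (x y : R) : set R :=
  [set w | exists (n : nat) (j : int), (0 < n)%N /\ w = x * n%:R + y * j%:~R].

Section Bending.
Variable R : realType.
Implicit Types (X : 'rV[R]_2 -> 'rV[R]_3) (U : nat -> 'rV[R]_2 -> 'rV[R]_3).

(* dX . dX at the point p, as a quadratic form in the tangent vector v. *)
Definition first_fundamental_form X (p v : 'rV[R]_2) : R :=
  dotp ('d X p v) ('d X p v).

Definition deformation X (q : nat) U (eps : R) (p : 'rV[R]_2) : 'rV[R]_3 :=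
  X p + 2 *: \sum_(1 <= j < q.+1) eps ^+ j *: U j p.

Definition infinitesimal_bending X (q : nat) U : Prop :=
  forall p v : 'rV[R]_2,
    (fun eps : R => first_fundamental_form (deformation X q U eps) p v
                    - first_fundamental_form X p v)
    =o_ (0 : R) (fun eps : R => eps ^+ q).

Definition trivial_field X (V : 'rV[R]_2 -> 'rV[R]_3) : Prop :=
  exists A B : 'rV[R]_3, forall p, V p = cross A (X p) + B.

End Bending.

(* Main.v *)
Require Import Defs.
From HB Require Import structures.
From mathcomp Require Import all_boot all_order all_algebra.
From mathcomp Require Import all_classical all_reals all_analysis.
From mathcomp Require Import ring lra.
Set Implicit Arguments.
Unset Strict Implicit.
Unset Printing Implicit Defensive.
Import Order.TTheory GRing.Theory Num.Theory.
Import numFieldNormedType.Exports.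
Local Open Scope classical_set_scope.
Local Open Scope ring_scope.

(** Write z = r^m P(theta).  Where P vanishes so does P', and then the whole
    ray in that direction is an asymptotic curve; hence P > 0.  With
    E = P^(-1/m), the points e^y E(t) (cos t, sin t) sweep out the punctured
    plane and z = e^(m y) there, so the surface looks like a fixed profile
    scaled by e^y.

    A deformation is a bending of order l as soon as its fields satisfy
    dR . dU^j = - sum_(i < j) dU^i . dU^(j-i) for 1 <= j <= l: the difference
    of the two first fundamental forms is a polynomial in the parameter, and
    these identities kill its coefficients up to degree l
    (bending_expansion).  Each identity is a system of three equations for the
    components (u, v, w) of U^j in the variables (y, t) (bending_eqs).  Let a
    and c be the products of the horizontal part of U^j with the curve
    gamma = E (cos, sin) and with gamma'.  The first equation gives a_y, the
    second c_y - c, and the third is then a compatibility condition, which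
    turns out to be one scalar equation for the vertical component,

      w_tt - 2 (E'/E) w_t + q (w_yy + (m - 2) w_y) = right-hand side,

    where q = (m^2 P^2 + m P P'' - (m - 1) P'^2) / (m^2 (m - 1) P^2) is
    nonnegative, by continuity from the complement of the finite set of angles,
    and not identically zero.

    All functions are taken in the class cyl nu of finite sums of
    e^(k y) y^n F(t) with k >= nu and F smooth and periodic.  The class is
    closed under products and derivatives, d/dy is invertible on it when
    nu > 0, and its members are of class C^k on the plane, the origin included,
    when k < nu (on_plane_Ck).

    On a monomial e^(k y) y^n F(t) the scalar equation becomes a Hill equation
    B'' + (1 + L q) B = G with periodic data.  It may be resonant, that is, the
    homogeneous equation may have a periodic solution B1.  Then
    the integral of q B1^2 is positive, so a suitable multiple of q B1 removes
    the obstruction (hill_fredholm), and q B1 is, up to terms of lower degree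
    in y, what the operator makes of e^(k y) y^(n+1) B1.  So resonances cost
    powers of y = log r but never obstruct, and the scalar equation is solvable
    in cyl nu for every right-hand side (bend_op_solve).

    A first order field needs a nonzero solution of the homogeneous scalar
    equation of large homogeneity, i.e. a periodic eigenfunction of the Hill
    equation with L large (hill_periodic_eigen).  The Pruefer angle at 2 pi of
    the solution with data (0, 1) is continuous and unbounded in L; whenever it
    is n pi, the trace of the monodromy matrix is (-1)^n (rho + 1/rho).  Two
    consecutive n give traces >= 2 and <= -2, and in between the trace is 2,
    so that 1 is an eigenvalue of the monodromy.

    The recursion never loses regularity: if all earlier fields lie in cyl N,
    the quadratic right-hand sides lie in cyl (2 N), and solving the system
    costs at most m <= N (bend_solve, bend_seq).  Finally the first field is
    nontrivial because its vertical component is not zero and is o(r) at the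
    origin, while for A x R + B it is affine along the surface
    (field_nontrivial). *)

(** * Derivatives, primitives and smooth periodic functions of one variable *)

Section Calculus.
Variable R : realType.
Implicit Types (f g h df dg : R -> R) (x y a b : R).

(** A relation between two functions, rather than a statement about derive1:
the derivative of a compound expression is then found by unification. *)
Definition der f df := forall x, is_derive x 1 f (df x).

Lemma derE f df x : der f df -> derive1 f x = df x.
Proof. by move=> H; have := H x; rewrite derive1E; case=> _ ->. Qed.

Lemma derEf f df : der f df -> derive1 f = df.
Proof. by move=> H; apply/funext => x; exact: derE. Qed.

Lemma der_derive1 f : (forall x, derivable f x 1) -> der f (derive1 f).
Proof. by move=> H x; rewrite derive1E; exact: derivableP. Qed.

Lemma der_derivable f df x : der f df -> derivable f x 1.
Proof. by move=> H; have := H x; case. Qed.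

Lemma is_derive_cont f x (d : R) : is_derive x 1 f d -> {for x, continuous f}.
Proof. by case=> /derivable1_diffP/differentiable_continuous. Qed.

Lemma der_cont f df : der f df -> continuous f.
Proof. by move=> H x; exact: is_derive_cont (H x). Qed.

Lemma der_ext f df dg : der f df -> df =1 dg -> der f dg.
Proof. by move=> H E x; rewrite -E. Qed.

Lemma derD f g df dg : der f df -> der g dg ->
  der (fun x => f x + g x) (fun x => df x + dg x).
Proof. by move=> H1 H2 x; apply: is_deriveD. Qed.

Lemma derN f df : der f df -> der (fun x => - f x) (fun x => - df x).
Proof. by move=> H1 x; apply: is_deriveN. Qed.

Lemma derB f g df dg : der f df -> der g dg ->
  der (fun x => f x - g x) (fun x => df x - dg x).
Proof. by move=> H1 H2; apply: derD => //; exact: derN. Qed.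

Lemma derM f g df dg : der f df -> der g dg ->
  der (fun x => f x * g x) (fun x => df x * g x + f x * dg x).
Proof.
move=> H1 H2 x; have -> : df x * g x + f x * dg x = f x *: dg x + g x *: df x.
  by rewrite /GRing.scale /= addrC [df x * _]mulrC.
exact: is_deriveM.
Qed.

Lemma der_cst c : der (fun=> c) (fun=> 0).
Proof. by move=> x; exact: is_derive_cst. Qed.

Lemma der_id : der id (fun=> 1).
Proof. by move=> x; exact: is_derive_id. Qed.

Lemma derZ c f df : der f df -> der (fun x => c * f x) (fun x => c * df x).
Proof.
by move=> H; apply: der_ext (derM (der_cst c) H) _ => x; rewrite mul0r add0r.
Qed.

Lemma der_comp f g df dg : der f df -> der g dg ->
  der (fun x => f (g x)) (fun x => dg x * df (g x)).
Proof.
move=> H1 H2 x; have := @is_derive1_comp R f g x (df (g x)) (dg x) (H1 _) (H2 _).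
by rewrite mulrC.
Qed.

Lemma der_expR : der expR expR. Proof. by move=> x; exact: is_derive_expR. Qed.
Lemma der_expk c : der (fun x => expR (c * x)) (fun x => c * expR (c * x)).
Proof. by apply: der_ext (der_comp der_expR (derZ c der_id)) _ => x; rewrite mulr1. Qed.

Lemma der_pow n : der (fun x : R => x ^+ n) (fun x => n%:R * x ^+ n.-1).
Proof.
move=> x; have := @exp_derive1 R n x; rewrite derive1E => e.
by apply: DeriveDef; [exact: exprn_derivable|rewrite e /GRing.scale /=].
Qed.

Lemma der_sin : der (@sin R) cos. Proof. by move=> x; exact: is_derive_sin. Qed.
Lemma der_cos : der (@cos R) (fun x => - sin x).
Proof. by move=> x; exact: is_derive_cos. Qed.

Lemma derV f df : (forall x, f x != 0) -> der f df ->
  der (fun x => (f x)^-1) (fun x => - (df x / (f x ^+ 2))).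
Proof.
move=> f0 H x; have := @is_deriveV R f x (df x) 1 (f0 x) (H x).
by move=> H1; apply: (is_derive_eq H1); rewrite /GRing.scale /= mulNr mulrC.
Qed.

Lemma cont_within f a b : continuous f -> {within `[a, b], continuous f}.
Proof. by move=> cf; apply: continuous_subspaceT. Qed.

Lemma der_MVT f df a b : der f df -> a <= b ->
  exists2 c, a <= c <= b & f b - f a = df c * (b - a).
Proof.
move=> H ab; have := @MVT_segment R f df a b ab (fun x _ => H x)
  (cont_within (der_cont H)).
by move=> [c]; rewrite in_itv /= => ? ?; exists c.
Qed.

Lemma der_ge0_le f df a b : der f df -> a <= b ->
  (forall x, a <= x <= b -> 0 <= df x) -> f a <= f b.
Proof.
move=> H ab p; have [c cab e] := der_MVT H ab.
by rewrite -subr_ge0 e mulr_ge0 ?subr_ge0 // p.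
Qed.

Lemma der_gt0_lt f df a b : der f df -> a < b ->
  (forall x, a <= x <= b -> 0 < df x) -> f a < f b.
Proof.
move=> H ab p; have [c cab e] := der_MVT H (ltW ab).
by rewrite -subr_gt0 e mulr_gt0 ?subr_gt0 // p.
Qed.

Lemma der_le_le f g df dg a b : der f df -> der g dg -> a <= b -> f a <= g a ->
  (forall x, a <= x <= b -> df x <= dg x) -> f b <= g b.
Proof.
move=> Hf Hg ab fga p.
have := der_ge0_le (derB Hg Hf) ab; rewrite /= => /(_ _)/le_trans.
move=> H; have : g a - f a <= g b - f b.
  by apply: H; first by move=> x /p; rewrite subr_ge0.
move: fga; lra.
Qed.

Lemma der0_cst f a b : der f (fun=> 0) -> f a = f b.
Proof. by move=> H; apply: is_derive_0_is_cst. Qed.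

Lemma der_unique_prim f g df a x : der f df -> der g df -> f a = g a -> f x = g x.
Proof.
move=> Hf Hg e; have : f x - g x = f a - g a.
  by apply: (@der0_cst (fun x => f x - g x)); apply: der_ext (derB Hf Hg) _ => y; rewrite subrr.
by rewrite e subrr => /eqP; rewrite subr_eq0 => /eqP.
Qed.

(** The integral from a base point a is only known to be a primitive to the
right of a; prim_exists removes this restriction. *)
Lemma prim_right f a : continuous f ->
  exists F, forall x, a < x -> is_derive x 1 F (f x).
Proof.
move=> cf; exists (fun x => (\int[lebesgue_measure]_(t in [set` `[a, x]]) f t)%R) => x ax.
have xx1 : x < x + 1 by rewrite ltrDl.
have fint : lebesgue_measure.-integrable `[a, x + 1] (EFin \o f).
  apply: continuous_compact_integrable; first exact: segment_compact.
  exact: cont_within.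
have [d e] := @continuous_FTC1_closed R f a x (x + 1) xx1 fint ax (cf x).
exact: (DeriveDef d (etrans (esym (derive1E _ _)) e)).
Qed.

(** The primitives on the half-lines x > -(n + 1), normalised at 0, agree where
they overlap, and together they give a primitive on the whole line. *)
Lemma prim_exists f : continuous f -> exists F, F 0 = 0 /\ der F f.
Proof.
move=> cf.
have /choice [F HF] : forall n : nat, exists F, F 0 = 0 /\ forall x, - n.+1%:R < x -> is_derive x 1 F (f x).
  move=> n; have [F HF] := prim_right (- n.+1%:R) cf.
  exists (fun x => F x - F 0); split; first by rewrite subrr.
  move=> x nx; have := HF x nx => HH.
  by rewrite -[f x]subr0; apply: is_deriveB.
have E n k x : - n.+1%:R < x -> - k.+1%:R < x -> F n x = F k x.
  move=> nx kx.
  pose a := Num.min 0 x; pose b := Num.max 0 x.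
  have ab : a <= b by rewrite /a /b ge_min le_max lexx.
  have an : forall i, - i.+1%:R < x -> - i.+1%:R < a.
    by move=> i ix; rewrite /a lt_min ix oppr_lt0 ltr0Sn.
  have D y : y \in `[a, b]%R -> is_derive y 1 (fun x => F n x - F k x) 0.
    rewrite in_itv /= => /andP[ay _].
    rewrite -(subrr (f y)); apply: is_deriveB; apply: (HF _).2; apply: lt_le_trans ay; exact: an.
  have C : {within `[a, b], continuous (fun x => F n x - F k x)}.
    by apply: derivable_within_continuous => y /D [].
  have [c _] := @MVT_segment R _ (fun=> 0) a b ab
     (fun y yab => D y (subset_itv_oo_cc yab)) C.
  rewrite mul0r => /eqP; rewrite subr_eq0 => /eqP e.
  have e0 : F n 0 - F k 0 = 0 by rewrite !(HF _).1 subrr.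
  have : F n x - F k x = 0.
    by move: e; rewrite /a /b; case: (leP 0 x) => _; rewrite e0.
  by move/eqP; rewrite subr_eq0 => /eqP.
pose G x := F (Num.truncn `|x|) x.
have bd x : - (Num.truncn `|x|).+1%:R < x.
  rewrite ltrNl; apply: le_lt_trans (ler_norm _) _; rewrite normrN.
  exact: truncnS_gt.
exists G; split; first by rewrite /G (HF _).1.
move=> x.
have := (HF (Num.truncn `|x|).+1).2 x; move=> /(_ _) H.
have {}H : is_derive x 1 (F (Num.truncn `|x|).+1) (f x).
  by apply: H; apply: le_lt_trans (bd x); rewrite lerN2 ler_nat.
apply: (near_eq_is_derive _ H).
have : \forall y \near x, - (Num.truncn `|x|).+2%:R < y.
  have xx : - (Num.truncn `|x|).+2%:R < x by apply: le_lt_trans (bd x); rewrite lerN2 ler_nat.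
  exact: lt_nbhsr.
by apply: filterS => y yx; apply: E => //; exact: bd.
Qed.

(** The primitive vanishing at 0. *)
Definition prim f : R -> R := xget (fun=> 0) [set F | F 0 = 0 /\ der F f].

Lemma primP f : continuous f -> prim f 0 = 0 /\ der (prim f) f.
Proof.
move=> cf; rewrite /prim; case: xgetP => // H.
by have [F HF] := prim_exists cf; case: (H F).
Qed.

Lemma prim0 f : continuous f -> prim f 0 = 0. Proof. by case/primP. Qed.
Lemma der_prim f : continuous f -> der (prim f) f. Proof. by case/primP. Qed.

(** Functions with n continuous derivatives. *)
Fixpoint Cn n f := if n is n'.+1 then (forall x, derivable f x 1) /\ Cn n' (derive1 f)
  else continuous f.
Definition smooth f := forall n, Cn n f.

Lemma CnS n f df : der f df -> Cn n df -> Cn n.+1 f.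
Proof. by move=> H h; split; [move=> x; exact: der_derivable H|rewrite (derEf H)]. Qed.

Lemma CnW n f : Cn n.+1 f -> Cn n f.
Proof.
elim: n f => [f [H _] x|n IH f [H1 H2]].
  exact: der_cont (der_derive1 H) x.
by split => //; exact: IH.
Qed.

Lemma Cn_der n f : Cn n.+1 f -> der f (derive1 f).
Proof. by move=> [H _]; exact: der_derive1. Qed.

Lemma Cn_cst n c : Cn n (fun=> c).
Proof. by elim: n c => [c|n IH c]; [exact: cst_continuous| apply: CnS (der_cst c) (IH _)]. Qed.

Lemma CnD n f g : Cn n f -> Cn n g -> Cn n (fun x => f x + g x).
Proof.
elim: n f g => [f g cf cg x|n IH f g Hf Hg]; first by apply: cvgD; [exact: cf|exact: cg].
by apply: CnS (derD (Cn_der Hf) (Cn_der Hg)) _; apply: IH; [case: Hf|case: Hg].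
Qed.

Lemma CnM n f g : Cn n f -> Cn n g -> Cn n (fun x => f x * g x).
Proof.
elim: n f g => [f g cf cg x|n IH f g Hf Hg]; first by apply: cvgM; [exact: cf|exact: cg].
apply: CnS (derM (Cn_der Hf) (Cn_der Hg)) _.
by apply: CnD; apply: IH; [case: Hf|exact: CnW Hg|exact: CnW Hf|case: Hg].
Qed.

Lemma CnV n f : (forall x, f x != 0) -> Cn n f -> Cn n (fun x => (f x)^-1).
Proof.
move=> f0; elim: n => [cf x|n IH Hf]; first by apply: cvgV => //; exact: cf.
apply: CnS (derV f0 (Cn_der Hf)) _.
have -> : (fun x => - (derive1 f x / f x ^+ 2)) = (fun x => (-1) * (derive1 f x * ((f x)^-1 * (f x)^-1))).
  by apply/funext => x; rewrite mulN1r expr2 invfM.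
have IH' := IH (CnW Hf).
by apply: CnM; [exact: Cn_cst|apply: CnM; [case: Hf|exact: CnM]].
Qed.

Lemma Cn_comp n f g : Cn n f -> Cn n g -> Cn n (fun x => f (g x)).
Proof.
elim: n f g => [f g cf cg x|n IH f g Hf Hg].
  by apply: continuous_comp; [exact: cg|exact: cf].
apply: CnS (der_comp (Cn_der Hf) (Cn_der Hg)) _.
by apply: CnM; [case: Hg|apply: IH; [case: Hf|exact: CnW Hg]].
Qed.

Lemma smooth_der f df : der f df -> smooth df -> smooth f.
Proof. by move=> H s n; apply: CnW; apply: CnS H (s n). Qed.

Lemma smooth_derive1 f : smooth f -> smooth (derive1 f).
Proof. by move=> s n; have [] := s n.+1. Qed.

Lemma smooth_is_der f : smooth f -> der f (derive1 f).
Proof. by move=> s; exact: (@Cn_der 0) (s 1%N). Qed.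

Lemma smooth_cont f : smooth f -> continuous f.
Proof. by move=> s; exact: (s 0%N). Qed.

Lemma smooth_cst c : smooth (fun=> c). Proof. by move=> n; exact: Cn_cst. Qed.
Lemma smoothD f g : smooth f -> smooth g -> smooth (fun x => f x + g x).
Proof. by move=> s t n; exact: CnD. Qed.
Lemma smoothM f g : smooth f -> smooth g -> smooth (fun x => f x * g x).
Proof. by move=> s t n; exact: CnM. Qed.
Lemma smoothN f : smooth f -> smooth (fun x => - f x).
Proof.
move=> s; have -> : (fun x => - f x) = (fun x => (-1) * f x) by apply/funext => x; rewrite mulN1r.
by apply: smoothM => //; exact: smooth_cst.
Qed.
Lemma smoothV f : (forall x, f x != 0) -> smooth f -> smooth (fun x => (f x)^-1).
Proof. by move=> f0 s n; exact: CnV. Qed.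
Lemma smooth_comp f g : smooth f -> smooth g -> smooth (fun x => f (g x)).
Proof. by move=> s t n; exact: Cn_comp. Qed.
Lemma smooth_expR : smooth expR.
Proof.
by elim=> [|n IH]; [exact: continuous_expR|apply: CnS der_expR IH].
Qed.
Lemma Cn_sincos n : Cn n (@sin R) /\ Cn n (@cos R).
Proof.
elim: n => [|n [IH1 IH2]]; first by split; [exact: continuous_sin|exact: continuous_cos].
split; first exact: CnS der_sin IH2.
apply: CnS der_cos _; rewrite (_ : (fun x => - sin x) = fun x => (-1) * sin x).
  by apply: CnM => //; exact: Cn_cst.
by apply/funext => x; rewrite mulN1r.
Qed.
Lemma smooth_sin : smooth (@sin R). Proof. by move=> n; exact: (Cn_sincos n).1. Qed.
Lemma smooth_cos : smooth (@cos R). Proof. by move=> n; exact: (Cn_sincos n).2. Qed.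

Definition per f := forall x, f (x + 2 * pi) = f x.

Lemma per_sin : per (@sin R).
Proof. by move=> t; rewrite mulr_natl sinD2pi. Qed.
Lemma per_cos : per (@cos R).
Proof. by move=> t; rewrite mulr_natl cosD2pi. Qed.

Lemma per_derive1 f : (forall x, derivable f x 1) -> per f -> per (derive1 f).
Proof.
move=> df p x; have H := der_derive1 df.
have := der_comp H (derD der_id (der_cst (2 * pi))) x.
rewrite [X in is_derive _ _ X _](_ : _ = f); last by apply/funext => y; rewrite p.
by case=> _; rewrite -derive1E addr0 mul1r.
Qed.

(** Periodicity under every integral multiple of 2 pi, which the inverse of the
polar parametrisation requires. *)
Lemma per_int f (k : int) x : per f -> f (x + 2 * pi * k%:~R) = f x.
Proof.
move=> p.
have P (n : nat) y : f (y + 2 * pi * n%:R) = f y.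
  have S (i : nat) : i.+1%:R = i%:R + 1 :> R by rewrite -natr1.
  elim: n => [|n IH]; first by rewrite mulr0 addr0.
  by rewrite (S n) mulrDr addrA [2 * pi * 1]mulr1 p.
case: (intP k) => [|n|n]; rewrite ?mulr0 ?addr0 //; first exact: P.
rewrite -(P n.+1 (x + 2 * pi * (- n.+1%:Z)%:~R)) -addrA -mulrDr; congr (f _).
by rewrite mulrNz -pmulrn addNr mulr0 addr0.
Qed.

Lemma per_reduce x : exists (k : int) y, 0 <= y < 2 * pi /\ x = y + 2 * pi * k%:~R.
Proof.
have p0 : 0 < 2 * pi :> R by rewrite mulr_gt0 // pi_gt0.
pose k := Num.floor (x / (2 * pi)); exists k, (x - 2 * pi * k%:~R).
split; last by rewrite subrK.
have := Num.Theory.floor_itv (x / (2 * pi)); rewrite -/k => /andP[h1 h2].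
move: h1 h2; rewrite ler_pdivlMr // ltr_pdivrMr // => h1 h2; apply/andP; split.
  by rewrite subr_ge0 mulrC.
by rewrite ltrBlDr -[X in _ < X + _]mulr1 -mulrDr mulrC addrC -intrD1.
Qed.

Lemma per_bounded f : continuous f -> per f -> exists2 M, 0 < M & forall x, `|f x| <= M.
Proof.
move=> cf p.
have p0 : 0 <= 2 * pi :> R by rewrite mulr_ge0 // pi_ge0.
have cn : {within `[0, 2 * pi], continuous (fun x => `|f x|)}.
  by apply: cont_within => x; apply: continuous_comp; [exact: cf|exact: norm_continuous].
have [c _ Hc] := EVT_max p0 cn.
exists (`|f c| + 1) => [|x]; first by rewrite ltr_wpDl.
have [k [y [/andP[y0 y1] ->]]] := per_reduce x; rewrite per_int //.
by apply: (le_trans (Hc y _)); rewrite ?in_itv /= ?y0 ?(ltW y1) // lerDl.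
Qed.

End Calculus.

(** * The linear equation y'' = - Q y *)

Section ODE.
Variable R : realType.
Implicit Types (f g y d Q : R -> R) (t a c K : R).

Lemma cont_opp : continuous (fun t : R => - t).
Proof. by move=> t; apply: continuousN; exact: cvg_id. Qed.

(** The inductive step in the estimate of Picard iterates: integration turns
t^n/n! into t^(n+1)/(n+1)!. *)
Lemma prim_bound f C n : continuous f -> (forall t, `|f t| <= C * `|t| ^+ n / n`!%:R) ->
  forall t, `|prim f t| <= C * `|t| ^+ n.+1 / n.+1`!%:R.
Proof.
have P : forall f, continuous f -> (forall t, `|f t| <= C * `|t| ^+ n / n`!%:R) ->
   forall t, 0 <= t -> `|prim f t| <= C * `|t| ^+ n.+1 / n.+1`!%:R.
  move=> {}f cf Hf t t0.
  have fn0 : n.+1`!%:R != 0 :> R by rewrite pnatr_eq0 -lt0n fact_gt0.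
  have fn1 : n`!%:R != 0 :> R by rewrite pnatr_eq0 -lt0n fact_gt0.
  have G : der (fun t => C * t ^+ n.+1 / n.+1`!%:R) (fun t => C * t ^+ n / n`!%:R).
    move=> x; have H := der_pow n.+1 x.
    have -> : C * x ^+ n / n`!%:R = (C / n.+1`!%:R) * (n.+1%:R * x ^+ n).
      have n10 : n.+1%:R != 0 :> R by rewrite pnatr_eq0.
      rewrite factS natrM; move: n10 fn1; move: (n.+1%:R : R) (n`!%:R : R) => A B A0 B0.
      by field; rewrite A0 B0.
    rewrite (_ : (fun _ => _) = (fun t => (C / n.+1`!%:R) * t ^+ n.+1)); last first.
      by apply/funext => s; rewrite mulrAC.
    exact: is_deriveZ.
  have [p0 dp] := primP cf.
  have GN := derN G; have dpN := derN dp.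
  rewrite [`|t|]ger0_norm // ler_norml; apply/andP; split.
    apply: (der_le_le GN dp t0); first by rewrite p0 expr0n /= mulr0 mul0r oppr0.
    move=> x /andP[x0 _]; have := Hf x; rewrite (ger0_norm x0) ler_norml => /andP[+ _].
    by [].
  apply: (der_le_le dp G t0); first by rewrite p0 expr0n /= mulr0 mul0r.
  by move=> x /andP[x0 _]; have := Hf x; rewrite (ger0_norm x0) ler_norml => /andP[_].
move=> cf Hf t; case: (leP 0 t) => t0; first exact: P.
have cg : continuous (fun s => f (- s)).
  by move=> s; apply: continuous_comp; [exact: cont_opp|exact: cf].
have := P (fun s => f (- s)) cg (fun s => _) (- t).
rewrite normrN oppr_ge0 => /(_ _ (ltW t0)) H.
have -> : prim f t = - prim (fun s => f (- s)) (- t).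
  have [p0 dp] := primP cf; have [q0 dq] := primP cg.
  have D : der (fun s => - prim (fun s => f (- s)) (- s)) f.
    apply: der_ext (derN (der_comp dq (derN (@der_id R)))) _ => s /=.
    by rewrite opprK mulN1r opprK.
  by apply: (@der_unique_prim R _ _ f 0 t dp D); rewrite oppr0 p0 q0 oppr0.
by rewrite normrN; apply: H => s; have := Hf (- s); rewrite normrN.
Qed.

(** Uniform convergence on every interval [-r, r], with an explicit error
sequence. *)
Definition loc_unif (f_ : nat -> R -> R) f := forall r : R, exists2 e : nat -> R,
  e n @[n --> \oo] --> (0 : R) & forall n t, `|t| <= r -> `|f_ n t - f t| <= e n.

Lemma loc_unif_cont (f_ : nat -> R -> R) f : (forall n, continuous (f_ n)) -> loc_unif f_ f -> continuous f.
Proof.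
move=> cf H x; apply/cvgrPdist_lt => eps eps0.
have [e e0 He] := H (`|x| + 1).
have eps3 : 0 < eps / 3 by rewrite divr_gt0.
move/cvgrPdist_lt/(_ _ eps3) : e0 => [N _ /(_ N (leqnn N))].
rewrite sub0r normrN => eN.
have hx : `|f_ N x - f x| < eps / 3.
  by apply: le_lt_trans (He _ _ _) (le_lt_trans (ler_norm _) eN); rewrite lerDl.
near=> t.
have ht : `|f_ N t - f t| < eps / 3.
  apply: le_lt_trans (He _ _ _) (le_lt_trans (ler_norm _) eN).
  have : `|x - t| <= 1 by near: t; apply: cvgr_dist_le; [exact: cvg_id|].
  move=> h; have -> : t = x - (x - t) by lra.
  by apply: le_trans (ler_normB _ _) _; rewrite lerD2l.
have hc : `|f_ N x - f_ N t| < eps / 3.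
  by near: t; move/cvgrPdist_lt : (cf N x) => /(_ _ eps3).
have -> : f x - f t = - (f_ N x - f x) + (f_ N x - f_ N t) + (f_ N t - f t) by lra.
apply: le_lt_trans (ler_normD _ _) _.
have := ler_normD (- (f_ N x - f x)) (f_ N x - f_ N t); rewrite normrN.
lra.
Unshelve. all: by end_near.
Qed.

(** Termwise differentiation: each F_ n differs from its value at 0 by the
primitive of f_ n, and both sides converge. *)
Lemma loc_unif_der (F_ f_ : nat -> R -> R) (F f : R -> R) : (forall n, der (F_ n) (f_ n)) -> (forall n, continuous (f_ n)) ->
  loc_unif f_ f -> (forall t, F_ n t @[n --> \oo] --> F t) -> der F f.
Proof.
move=> dF cf_ H cF.
have cf := loc_unif_cont cf_ H.
have [p0 dp] := primP cf.
have E t : F t = F 0 + prim f t.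
  have [e e0 He] := H `|t|.
  have B n : `|(F_ n t - prim f t) - F_ n 0| <= e n * `|t|.
    pose g s := F_ n s - prim f s.
    have dg : der g (fun s => f_ n s - f s) := derB (dF n) dp.
    have -> : F_ n t - prim f t - F_ n 0 = g t - g 0 by rewrite /g p0; lra.
    case: (leP 0 t) => t0.
      have [x /andP[x0 xt] ->] := der_MVT dg t0.
      rewrite subr0 normrM ler_wpM2r //; apply: He.
      by rewrite !ger0_norm // (le_trans x0).
    have [x /andP[x0 xt] e1] := der_MVT dg (ltW t0).
    rewrite -normrN opprB e1 sub0r normrM normrN ler_wpM2r //; apply: He.
    by rewrite !ler0_norm ?lerN2 // ltW.
  have L : (F_ n t - prim f t - F_ n 0) @[n --> \oo] --> F t - prim f t - F 0.
    by apply: cvgB => //; apply: cvgB => //; exact: cvg_cst.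
  have Z : (F_ n t - prim f t - F_ n 0) @[n --> \oo] --> (0 : R).
    apply/cvgr0Pnorm_le => eps eps0.
    have : e n * `|t| @[n --> \oo] --> 0 * `|t| by apply: cvgMl.
    rewrite mul0r => /cvgr0Pnorm_le/(_ _ eps0); apply: filterS => n /= h.
    exact: le_trans (B n) (le_trans (ler_norm _) _).
  have e1 : F t - prim f t - F 0 = 0 :> R by exact: (cvg_unique _ L Z).
  lra.
have -> : F = (fun t => F 0 + prim f t) by apply/funext => t; exact: E.
by apply: der_ext (derD (der_cst _) dp) _ => t; rewrite add0r.
Qed.

(** The equation y'' = - Q y as a first order system with d = y'. *)
Definition sol Q y d := der y d /\ der d (fun t => - Q t * y t).

(** The n-th increments, not the n-th iterates, of the Picard scheme for the
system y' = d, d' = - Q y with initial data (a, c). *)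
Fixpoint picard Q a c n : (R -> R) * (R -> R) := if n is n'.+1 then
   (prim (picard Q a c n').2, prim (fun t => - Q t * (picard Q a c n').1 t))
  else ((fun=> a), (fun=> c)).

Section Picard.
Variables (Q : R -> R) (K a c : R).
Hypotheses (cQ : continuous Q) (K1 : 1 <= K) (bQ : forall t, `|Q t| <= K).
Let u n := (picard Q a c n).1.
Let v n := (picard Q a c n).2.
Let C := `|a| + `|c|.

Lemma picard_cont n : continuous (u n) /\ continuous (v n).
Proof.
elim: n => [|n [cu cv]]; first by split; exact: cst_continuous.
have cq : continuous (fun t => - Q t * u n t).
  by move=> t; apply: cvgM; [apply: cvgN; exact: cQ|exact: cu].
by split; [exact: der_cont (der_prim cv)|exact: der_cont (der_prim cq)].
Qed.

Lemma picard_contQ n : continuous (fun t => - Q t * u n t).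
Proof. by move=> t; apply: cvgM; [apply: cvgN; exact: cQ|exact: (picard_cont n).1]. Qed.

(** The factor K^n t^n/n! makes the increments summable on the whole line, so
the solution is global. *)
Lemma picard_bound n t : `|u n t| <= C * K ^+ n * `|t| ^+ n / n`!%:R /\
   `|v n t| <= C * K ^+ n * `|t| ^+ n / n`!%:R.
Proof.
elim: n t => [|n IH] t.
  by rewrite !expr0 !mulr1 fact0 divr1 /u /v /C /= lerDl lerDr.
have K0 : 0 <= K by apply: le_trans K1.
split; apply: prim_bound.
- exact: (picard_cont n).2.
- move=> s; apply: le_trans (IH s).2 _; rewrite -!mulrA ler_wpM2l ?addr_ge0 //.
  rewrite ler_wpM2r ?mulr_ge0 // ?exprn_ge0 ?invr_ge0 //.
  by rewrite exprS ler_peMl // exprn_ge0.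
- exact: picard_contQ.
- move=> s; rewrite normrM normrN.
  apply: (@le_trans _ _ (K * (C * K ^+ n * `|s| ^+ n / n`!%:R))).
    by apply: ler_pM => //; exact: (IH s).1.
  by rewrite exprS !mulrA [C * K]mulrC.
Qed.

Lemma picard_cvg (w : nat -> R -> R) : (forall n t, `|w n t| <= C * K ^+ n * `|t| ^+ n / n`!%:R) ->
  exists W, loc_unif (fun n t => \sum_(i < n) w i t) W.
Proof.
move=> bw.
have K0 : 0 <= K by apply: le_trans K1.
have C0 : 0 <= C by rewrite addr_ge0.
have bw' r n t : `|t| <= r -> `|w n t| <= C * exp_coeff (K * r) n.
  move=> tr; apply: le_trans (bw n t) _; rewrite /exp_coeff /= exprMn -!mulrA.
  rewrite ler_wpM2l // ler_wpM2l ?exprn_ge0 // ler_wpM2r ?invr_ge0 //.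
  by rewrite lerXn2r // nnegrE // (le_trans _ tr).
have cv r : series (exp_coeff (K * r)) @ \oo --> expR (K * r).
  by have := @is_cvg_series_exp_coeff R (K * r).
have cw t : cvg (series (fun n => w n t) @ \oo).
  apply: normed_cvg; apply: (@series_le_cvg _ _ (fun n => C * exp_coeff (K * `|t|) n)).
  - by move=> n /=.
  - move=> n; rewrite mulr_ge0 // /exp_coeff /= mulr_ge0 // ?invr_ge0 // exprn_ge0 // mulr_ge0 //.
  - by move=> n /=; apply: bw'.
  - exact: is_cvg_seriesZ (is_cvg_series_exp_coeff _).
exists (fun t => limn (series (fun n => w n t))) => r.
exists (fun n => C * (expR (K * r) - series (exp_coeff (K * r)) n)).
  rewrite -(mulr0 C) -(subrr (expR (K * r))).
  by apply: cvgMr; apply: cvgB; [exact: cvg_cst|exact: cv].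
move=> n t tr.
have L1 : (series (fun n => w n t) n - series (fun n => w n t) m) @[m --> \oo] -->
    series (fun n => w n t) n - limn (series (fun n => w n t)).
  by apply: cvgB; [exact: cvg_cst|exact: cw].
have L2 : C * (series (exp_coeff (K * r)) m - series (exp_coeff (K * r)) n) @[m --> \oo] -->
   C * (expR (K * r) - series (exp_coeff (K * r)) n).
  by apply: cvgMr; apply: cvgB; [exact: cv|exact: cvg_cst].
have E : \sum_(i < n) w i t = series (fun n => w n t) n by rewrite /series /= big_mkord.
rewrite E -(cvg_lim (@norm_hausdorff _ _) (cvg_norm L1)) -(cvg_lim (@norm_hausdorff _ _) L2).
apply: ler_lim; [exact: cvgP (cvg_norm L1)|exact: cvgP L2|].
exists n => // m /= nm.
rewrite distrC !sub_series_geq // mulr_sumr.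
apply: le_trans (ler_norm_sum _ _ _) _.
by apply: ler_sum => i _; exact: bw'.
Qed.

(** The system is linear with a bounded coefficient, so the Picard series
converges locally uniformly together with its termwise derivative. *)
Lemma ode_exists : exists y d, [/\ y 0 = a, d 0 = c & sol Q y d].
Proof.
have [Y HY] := picard_cvg (fun n t => (picard_bound n t).1).
have [D HD] := picard_cvg (fun n t => (picard_bound n t).2).
have pt (w : nat -> R -> R) (W : R -> R) : loc_unif (fun n t => \sum_(i < n) w i t) W ->
    forall t, (\sum_(i < n) w i t) @[n --> \oo] --> W t.
  move=> H t; have [e e0 He] := H `|t|.
  apply/cvgrPdist_le => eps eps0.
  move/cvgr0Pnorm_le : e0 => /(_ _ eps0); apply: filterS => n h.
  by rewrite distrC; apply: le_trans (He n t _) (le_trans (ler_norm _) h).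
have csum (w : nat -> R -> R) n : (forall i, continuous (w i)) -> continuous (fun t => \sum_(i < n) w i t).
  move=> cw; elim: n => [|n IH] t.
    by rewrite (_ : (fun t => _) = fun=> 0); [exact: cvg_cst|apply/funext => s; rewrite big_ord0].
  rewrite (_ : (fun t => _) = fun t => \sum_(i < n) w i t + w n t); last first.
    by apply/funext => s; rewrite big_ord_recr.
  by apply: cvgD; [exact: IH|exact: cw].
have dsum (w dw : nat -> R -> R) n : (forall i, der (w i) (dw i)) -> der (fun t => \sum_(i < n) w i t) (fun t => \sum_(i < n) dw i t).
  move=> cw; elim: n => [|n IH].
    rewrite (_ : (fun t => _) = fun=> 0); last by apply/funext => s; rewrite big_ord0.
    by apply: der_ext (der_cst _) _ => s; rewrite big_ord0.
  rewrite (_ : (fun t => _) = fun t => \sum_(i < n) w i t + w n t); last first.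
    by apply/funext => s; rewrite big_ord_recr.
  by apply: der_ext (derD IH (cw n)) _ => s; rewrite big_ord_recr.
have sh (w : nat -> R -> R) (x : R) (W : R) (s : R) : (\sum_(i < n) w i s) @[n --> \oo] --> W ->
    (\sum_(i < n.+1) w i s) @[n --> \oo] --> W.
  by move=> h; rewrite (cvg_shiftS (fun n => \sum_(i < n) w i s)).
have dY : der Y D.
  apply: (@loc_unif_der (fun n t => \sum_(i < n.+1) u i t) (fun n t => \sum_(i < n) v i t)) => //.
  - move=> n; rewrite (_ : (fun t => _) = (fun t => a + \sum_(i < n) u i.+1 t)); last first.
      by apply/funext => t; rewrite big_ord_recl.
    apply: der_ext (derD (der_cst a) (dsum (fun i => u i.+1) v n _)) _.
      by move=> i; exact: der_prim (picard_cont i).2.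
    by move=> t; rewrite add0r.
  - by move=> n; apply: csum => i; exact: (picard_cont i).2.
  - by move=> t; apply: (sh _ 0); exact: pt.
have cY := der_cont dY.
have dD : der D (fun t => - Q t * Y t).
  apply: (@loc_unif_der (fun n t => \sum_(i < n.+1) v i t) (fun n t => \sum_(i < n) (- Q t * u i t))) => //.
  - move=> n; rewrite (_ : (fun t => _) = (fun t => c + \sum_(i < n) v i.+1 t)); last first.
      by apply/funext => t; rewrite big_ord_recl.
    apply: der_ext (derD (der_cst c) (dsum (fun i => v i.+1) (fun i t => - Q t * u i t) n _)) _.
      by move=> i; exact: der_prim (@picard_contQ i).
    by move=> t; rewrite add0r.
  - by move=> n; apply: (csum (fun i t => - Q t * u i t)) => i; exact: picard_contQ.
  - move=> r; have [e e0 He] := HY r; exists (fun n => K * e n).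
      by rewrite -(mulr0 K); apply: cvgMr.
    move=> n t tr; rewrite -mulr_sumr -mulrBr normrM normrN.
    by apply: ler_pM => //; exact: He.
  - by move=> t; apply: (sh _ 0); exact: pt.
exists Y, D; split => //.
- apply: (cvg_unique _ (sh u 0 _ _ (pt _ _ HY 0))); first exact: norm_hausdorff.
  rewrite (_ : (fun n => _) = fun=> a) /=; first exact: cvg_cst.
  apply/funext => n; rewrite big_ord_recl /= big1 ?addr0 // => i _.
  by rewrite /u /= prim0 //; exact: (picard_cont _).2.
- apply: (cvg_unique _ (sh v 0 _ _ (pt _ _ HD 0))); first exact: norm_hausdorff.
  rewrite (_ : (fun n => _) = fun=> c) /=; first exact: cvg_cst.
  apply/funext => n; rewrite big_ord_recl /= big1 ?addr0 // => i _.
  by rewrite /v /= prim0 //; exact: picard_contQ.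
Qed.

End Picard.

Lemma gronwall E dE K c T : der E dE -> 0 <= K -> 0 <= c ->
  (forall t, 0 <= t <= T -> dE t <= K * E t + c) ->
  forall t, 0 <= t <= T -> E t <= (E 0 + c * t) * expR (K * t).
Proof.
move=> dE' K0 c0 H t /andP[t0 tT].
have D := derB (derM dE' (der_expk (- K))) (derZ c (@der_id R)).
have := der_le_le D (@der_cst R (E 0)) t0.
rewrite /= !mulr0 expR0 mulr1 subr0 lexx => /(_ isT) h.
have {h} : E t * expR (- K * t) - c * t <= E 0.
  apply: h => s /andP[s0 st].
  have := H s; rewrite s0 (le_trans st tT) => /(_ isT) h.
  have e0 := expR_gt0 (- K * s).
  have e1 : expR (- K * s) <= 1 by rewrite expR_le1 mulNr oppr_le0 mulr_ge0.
  have : (dE s - K * E s) * expR (- K * s) <= c * expR (- K * s) by rewrite ler_pM2r //; lra.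
  have : c * expR (- K * s) <= c * 1 by rewrite ler_wpM2l.
  lra.
rewrite lerBlDr => h.
have e0 := expR_gt0 (K * t).
have : E t * expR (- K * t) * expR (K * t) <= (E 0 + c * t) * expR (K * t) by rewrite ler_pM2r.
by rewrite mulNr -mulrA [expR (- _) * _]mulrC expRxMexpNx_1 mulr1.
Qed.

(** Uniqueness: the energy y^2 + d^2 satisfies |E'| <= (1 + K) E, so it stays
zero in both directions of time once it vanishes. *)
Lemma sol_zero Q K y d t0 : (forall t, `|Q t| <= K) -> sol Q y d -> y t0 = 0 -> d t0 = 0 ->
  forall t, y t = 0 /\ d t = 0.
Proof.
move=> bQ [dy dd] y0 d0 t.
pose E t := y t * y t + d t * d t.
pose dE t := (d t * y t + y t * d t) + ((- Q t * y t) * d t + d t * (- Q t * y t)).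
have DE : der E dE := derD (derM dy dy) (derM dd dd).
have K0 : 0 <= K := le_trans (normr_ge0 _) (bQ 0).
have B s : `|dE s| <= (1 + K) * E s.
  have -> : dE s = (1 - Q s) * (2 * (y s * d s)) by rewrite /dE; ring.
  rewrite normrM ler_pM //.
    by apply: le_trans (ler_normB _ _) _; rewrite normr1 lerD2l.
  rewrite /E ler_norml; apply/andP; split; [have := sqr_ge0 (y s + d s)|have := sqr_ge0 (y s - d s)]; rewrite expr2; lra.
have E0 : E t0 = 0 by rewrite /E y0 d0 !mulr0 addr0.
have : E t <= 0.
  case: (leP t0 t) => tt.
    have := der_le_le (derM DE (der_expk (- (1 + K)))) (@der_cst R 0) tt.
    rewrite E0 mul0r lexx => /(_ isT) H.
    have : E t * expR (- (1 + K) * t) <= 0.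
      apply: H => s _; have := B s; rewrite ler_norml => /andP[_ h].
      have e0 := expR_gt0 (- (1 + K) * s).
      have -> : dE s * expR (- (1 + K) * s) + E s * (- (1 + K) * expR (- (1 + K) * s)) =
        (dE s - (1 + K) * E s) * expR (- (1 + K) * s) by ring.
      by rewrite pmulr_lle0 // subr_le0.
    by rewrite pmulr_lle0 // expR_gt0.
  have := der_le_le (@der_cst R 0) (derM DE (der_expk (1 + K))) (ltW tt).
  have := der_ge0_le (derM DE (der_expk (1 + K))) (ltW tt).
  rewrite E0 mul0r => H _.
  have : E t * expR ((1 + K) * t) <= 0.
    apply: H => s _; have := B s; rewrite ler_norml => /andP[h _].
    have e0 := expR_gt0 ((1 + K) * s).
    have -> : dE s * expR ((1 + K) * s) + E s * ((1 + K) * expR ((1 + K) * s)) =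
        (dE s + (1 + K) * E s) * expR ((1 + K) * s) by ring.
    by rewrite pmulr_lge0 //; lra.
  by rewrite pmulr_lle0 // expR_gt0.
rewrite /E => h.
have yy : 0 <= y t * y t by rewrite -expr2 sqr_ge0.
have dd0 : 0 <= d t * d t by rewrite -expr2 sqr_ge0.
by split; apply/eqP; rewrite -[_ == 0]orbb -mulf_eq0; apply/eqP; lra.
Qed.

Lemma sol_comb Q y1 d1 y2 d2 (a c : R) : sol Q y1 d1 -> sol Q y2 d2 ->
  sol Q (fun t => a * y1 t + c * y2 t) (fun t => a * d1 t + c * d2 t).
Proof.
move=> [A1 B1] [A2 B2]; split; first by apply: derD; exact: derZ.
by apply: der_ext (derD (derZ a B1) (derZ c B2)) _ => t; ring.
Qed.

(** The first order system has trace zero. *)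
Lemma wronskian Q y1 d1 y2 d2 t s : sol Q y1 d1 -> sol Q y2 d2 ->
  y1 t * d2 t - d1 t * y2 t = y1 s * d2 s - d1 s * y2 s.
Proof.
move=> [A1 B1] [A2 B2].
apply: (@der0_cst R (fun t => y1 t * d2 t - d1 t * y2 t)).
by apply: der_ext (derB (derM A1 B2) (derM B1 A2)) _ => x; ring.
Qed.

End ODE.

(** * Periodic eigenvalues of the Hill equation *)

Section Hill.
Variable R : realType.
Implicit Types (f g : R -> R) (t L : R).

(** Continuity in the parameter L is obtained below from Lipschitz estimates,
which Gronwall's inequality gives directly. *)
Lemma lipschitz_at_cont f L0 C : (forall L, `|L - L0| <= 1 -> `|f L - f L0| <= C * `|L - L0|) ->
  {for L0, continuous f}.
Proof.
move=> H; apply/cvgrPdist_le => eps eps0.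
have C0 : 0 < `|C| + 1 by rewrite ltr_wpDl.
near=> L; rewrite distrC.
have h1 : `|L - L0| <= 1 by rewrite distrC; near: L; apply: cvgr_dist_le; [exact: cvg_id|].
have h2 : `|L - L0| <= eps / (`|C| + 1).
  by rewrite distrC; near: L; apply: cvgr_dist_le; [exact: cvg_id|exact: divr_gt0].
apply: le_trans (H L h1) _.
move: h2; rewrite ler_pdivlMr // mulrC => h2; apply: le_trans h2.
by rewrite ler_wpM2r // (le_trans (ler_norm _)) // lerDl.
Unshelve. all: by end_near.
Qed.

Lemma ivt_either f (a b v : R) : continuous f -> a <= b ->
  (f a <= v) && (v <= f b) || (f b <= v) && (v <= f a) -> exists2 c, a <= c <= b & f c = v.
Proof.
move=> cf ab h.
have hv : Num.min (f a) (f b) <= v <= Num.max (f a) (f b).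
  by rewrite ge_min le_max; move/orP: h => [/andP[-> ->]|/andP[-> ->]]; rewrite ?orbT.
by have [c] := IVT ab (cont_within cf) hv; rewrite in_itv /= => ? ?; exists c.
Qed.

Lemma norm_le_of_sqr (x h C : R) : 0 <= C -> x ^+ 2 <= h ^+ 2 * C -> `|x| <= (C + 1) * `|h|.
Proof.
move=> C0 H; rewrite -(@ler_pXn2r _ 2) // ?nnegrE ?mulr_ge0 // ?addr_ge0 //.
rewrite -normrX ger0_norm ?sqr_ge0 // exprMn -normrX (ger0_norm (sqr_ge0 h)).
apply: (le_trans H); rewrite mulrC ler_wpM2r ?sqr_ge0 //; nra.
Qed.

Variables (q : R -> R) (M : R).
Hypotheses (cq : continuous q) (q0 : forall t, 0 <= q t) (M0 : 0 < M) (qM : forall t, q t <= M).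

(** The coefficient of the Hill equation y'' + (1 + L q) y = 0. *)
Definition hillQ L t := 1 + L * q t.
Let T : R := 2 * pi.
Let T0 : 0 < T. Proof. by rewrite mulr_gt0 // pi_gt0. Qed.

Lemma hillQ_cont L : continuous (hillQ L).
Proof.
by move=> t; apply: cvgD; [exact: cvg_cst|apply: cvgM; [exact: cvg_cst|exact: cq]].
Qed.

Lemma hillQ_bound L t : `|hillQ L t| <= 1 + `|L| * M.
Proof.
apply: le_trans (ler_normD _ _) _; rewrite normr1 lerD2l normrM ler_wpM2l //.
by rewrite ger0_norm.
Qed.

Lemma hillQ_bound_ge1 L : 1 <= 1 + `|L| * M. Proof. by rewrite lerDl mulr_ge0 // ltW. Qed.

Lemma hill_exists L a c : exists y d, [/\ y 0 = a, d 0 = c & sol (hillQ L) y d].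
Proof. exact: ode_exists (@hillQ_cont L) (hillQ_bound_ge1 L) (@hillQ_bound L). Qed.

Section Param.
Variables (y d : R -> R -> R) (a c : R).
Hypothesis H : forall L, [/\ y L 0 = a, d L 0 = c & sol (hillQ L) (y L) (d L)].

(** Gronwall for the difference of the solutions for L and L0: its source term
is (L - L0) q y, of size |L - L0|. *)
Lemma sol_param_lip L0 : exists2 C, 0 <= C & forall L, `|L - L0| <= 1 ->
  (y L T - y L0 T) ^+ 2 + (d L T - d L0 T) ^+ 2 <= (L - L0) ^+ 2 * C.
Proof.
have [_ _ [y0 d0]] := H L0.
have cn : {within `[0, T], continuous (fun t => `|q t * y L0 t|)}.
  apply: cont_within => x; apply: (@continuous_comp _ _ _ (fun t => q t * y L0 t) Num.norm); last exact: norm_continuous.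
  by apply: cvgM; [exact: cq|exact: der_cont y0 x].
have [x0 _ HN] := EVT_max (ltW T0) cn.
set N := `|q x0 * y L0 x0| in HN.
(* 2 + (|L0| + 1) M bounds the coefficients for |L - L0| <= 1; one more for the
   source term, by Young's inequality. *)
pose K := 3 + (`|L0| + 1) * M.
exists (N ^+ 2 * T * expR (K * T)); first by apply: mulr_ge0; [apply: mulr_ge0; [exact: sqr_ge0|exact: ltW]|exact: expR_ge0].
move=> L hL; have [a1 c1 [y1 d1]] := H L; have [a2 c2 _] := H L0.
pose u t := y L t - y L0 t; pose v t := d L t - d L0 t.
have du : der u v := derB y1 y0.
have dv : der v (fun t => - hillQ L t * y L t - - hillQ L0 t * y L0 t) := derB d1 d0.
pose E t := u t * u t + v t * v t.
have dE := derD (derM du du) (derM dv dv).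
have K0 : 0 <= K by rewrite addr_ge0 // mulr_ge0 ?addr_ge0 // ltW.
have hc : 0 <= (L - L0) ^+ 2 * N ^+ 2 by rewrite mulr_ge0 // sqr_ge0.
have := @gronwall R _ _ K ((L - L0) ^+ 2 * N ^+ 2) T dE K0 hc _ T.
rewrite (ltW T0) lexx => /(_ _ isT).
rewrite /u /v a1 c1 a2 c2 !subrr !mulr0 !addr0 add0r => G.
rewrite !expr2; apply: le_trans (G _) _; last by rewrite !expr2 !mulrA.
move=> t tT; rewrite -/(u t) -/(v t).
have hN : `|q t * y L0 t| <= N by apply: HN; rewrite in_itv.
have bQ : `|hillQ L t| <= 1 + (`|L0| + 1) * M.
  apply: le_trans (hillQ_bound L t) _; rewrite lerD2l ler_wpM2r // ?(ltW M0) //.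
  have -> : L = L0 + (L - L0) by lra.
  by apply: le_trans (ler_normD _ _) _; rewrite lerD2l.
have Eq : - hillQ L t * y L t - - hillQ L0 t * y L0 t = - (hillQ L t * u t) - (L - L0) * (q t * y L0 t).
  by rewrite /u /hillQ; ring.
rewrite Eq.
set Y := q t * y L0 t in hN *.
have h1 : (1 - hillQ L t) * (2 * (u t * v t)) <= (2 + (`|L0| + 1) * M) * (u t * u t + v t * v t).
  apply: le_trans (ler_norm _) _; rewrite normrM ler_pM //.
    by apply: le_trans (ler_normB _ _) _; rewrite normr1; lra.
  rewrite ler_norml; apply/andP; split; [have := sqr_ge0 (u t + v t)|have := sqr_ge0 (u t - v t)]; rewrite expr2; lra.
have h2 : - (2 * ((L - L0) * Y * v t)) <= (L - L0) ^+ 2 * N ^+ 2 + v t * v t.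
  have : Y ^+ 2 <= N ^+ 2 by rewrite -[Y ^+ 2]ger0_norm ?sqr_ge0 // normrX lerXn2r // nnegrE // (le_trans _ hN).
  move=> /(ler_wpM2l (sqr_ge0 (L - L0))) h.
  have := sqr_ge0 ((L - L0) * Y + v t).
  have -> : ((L - L0) * Y + v t) ^+ 2 =
    (L - L0) ^+ 2 * Y ^+ 2 + 2 * ((L - L0) * Y * v t) + v t * v t by ring.
  lra.
rewrite /K; have : 0 <= u t * u t by rewrite -expr2 sqr_ge0.
lra.
Qed.

Lemma sol_param_cont : continuous (fun L => y L T) /\ continuous (fun L => d L T).
Proof.
split=> L0; have [C C0 HC] := sol_param_lip L0; apply: (@lipschitz_at_cont _ L0 (C + 1)) => L hL;
  apply: norm_le_of_sqr => //; apply: le_trans (HC L hL);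
  [rewrite lerDl|rewrite lerDr]; exact: sqr_ge0.
Qed.

End Param.

Section Prufer.
Variables (L : R) (y d : R -> R).
Hypotheses (L0 : 0 <= L) (y0 : y 0 = 0) (d0 : d 0 = 1) (S : sol (hillQ L) y d).

Let E t := y t * y t + d t * d t.
(** Defined by integrating the known formula for the derivative of the polar
angle of (d, y), which avoids choosing a branch of the argument. *)
Definition prufer_angle := prim (fun t => (d t * d t + hillQ L t * (y t * y t)) / (y t * y t + d t * d t)).

Lemma prufer_sq_gt0 t : 0 < E t.
Proof.
have h1 : 0 <= y t * y t by rewrite -expr2 sqr_ge0.
have h2 : 0 <= d t * d t by rewrite -expr2 sqr_ge0.
rewrite lt_neqAle addr_ge0 // andbT; apply/negP => /eqP e.
have yt : y t = 0 by apply/eqP; rewrite -[_ == 0]orbb -mulf_eq0; apply/eqP; move: e; rewrite /E; lra.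
have dt : d t = 0 by apply/eqP; rewrite -[_ == 0]orbb -mulf_eq0; apply/eqP; move: e; rewrite /E; lra.
by have [_] := sol_zero (@hillQ_bound L) S yt dt 0; rewrite d0 => /eqP; rewrite oner_eq0.
Qed.

Lemma prufer_speed_cont : continuous (fun t => (d t * d t + hillQ L t * (y t * y t)) / E t).
Proof.
move=> t; apply: cvgM; last first.
  apply: cvgV; first by rewrite gt_eqF // prufer_sq_gt0.
  by apply: cvgD; apply: cvgM; (exact: (der_cont S.1) || exact: (der_cont S.2)).
apply: cvgD; first by apply: cvgM; exact: (der_cont S.2).
apply: cvgM; first exact: hillQ_cont.
by apply: cvgM; exact: (der_cont S.1).
Qed.

Lemma prufer_angle_der : der prufer_angle (fun t => (d t * d t + hillQ L t * (y t * y t)) / E t).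
Proof. exact: der_prim prufer_speed_cont. Qed.

Let s t := Num.sqrt (E t).

Lemma prufer_radius_gt0 t : 0 < s t. Proof. by rewrite sqrtr_gt0 prufer_sq_gt0. Qed.
Lemma prufer_radius_sq t : s t * s t = E t. Proof. by rewrite -expr2 sqr_sqrtr // ltW // prufer_sq_gt0. Qed.

(** With s = sqrt(y^2 + d^2), the unit vector (d/s, y/s) and
(cos angle, sin angle) rotate with the same speed, so their scalar product and
their cross product are constant. *)
Lemma prufer_coords : [/\ prufer_angle 0 = 0, forall t, y t = s t * sin (prufer_angle t) & forall t, d t = s t * cos (prufer_angle t)].
Proof.
have a0 : prufer_angle 0 = 0 := prim0 prufer_speed_cont.
have [dy dd] := S.
pose e t := (d t * y t + y t * d t) + ((- hillQ L t * y t) * d t + d t * (- hillQ L t * y t)).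
have dE : der E e := derD (derM dy dy) (derM dd dd).
have ds : der s (fun t => e t / (2 * s t)).
  move=> t; have := @is_derive1_comp R Num.sqrt E t _ (e t) (is_derive1_sqrt (prufer_sq_gt0 t)) (dE t).
  by move=> h; apply: (is_derive_eq h); rewrite mulrC.
have sN t : s t != 0 by rewrite gt_eqF // prufer_radius_gt0.
have dV := derV sN ds.
have da := prufer_angle_der.
pose fp t := (d t * d t + hillQ L t * (y t * y t)) / E t.
have dA := derM dy dV; have dC := derM dd dV.
have dA' : der (fun t => y t / s t) (fun t => fp t * (d t / s t)).
  apply: der_ext dA _ => t; rewrite /fp -prufer_radius_sq /e; have := sN t; have := prufer_radius_sq t; rewrite /E.
  move: (s t) (y t) (d t) (hillQ L t) => x1 x2 x3 x4 h x10.
  have : x3 * x3 = x1 * x1 - x2 * x2 by lra.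
  move=> hh.
  apply: (mulIf (x10)); apply: (mulIf x10); apply: (mulIf x10).
  rewrite (_ : (x3 * x1^-1 + _) * x1 * x1 * x1 = x3 * (x1 * x1) + x2 * - ((1 - x4) * (x2 * x3))); last first.
    by field.
  rewrite (_ : _ * x1 * x1 * x1 = (x3 * x3 + x4 * (x2 * x2)) * x3); last by field.
  by rewrite h; ring.
have dC' : der (fun t => d t / s t) (fun t => - fp t * (y t / s t)).
  apply: der_ext dC _ => t; rewrite /fp -prufer_radius_sq /e; have := sN t; have := prufer_radius_sq t; rewrite /E.
  move: (s t) (y t) (d t) (hillQ L t) => x1 x2 x3 x4 h x10.
  apply: (mulIf (x10)); apply: (mulIf x10); apply: (mulIf x10).
  rewrite (_ : (_ * x1^-1 + _) * x1 * x1 * x1 = - x4 * x2 * (x1 * x1) + x3 * - ((1 - x4) * (x2 * x3))); last first.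
    by field.
  rewrite (_ : _ * x1 * x1 * x1 = - (x3 * x3 + x4 * (x2 * x2)) * x2); last by field.
  by rewrite h; ring.
have dsi := der_comp (@der_sin R) da; have dco := der_comp (@der_cos R) da.
have s0 : s 0 = 1 by rewrite /s /E y0 d0 mulr0 add0r mulr1 sqrtr1.
have I1 t : y t / s t * cos (prufer_angle t) - d t / s t * sin (prufer_angle t) = 0.
  have -> : 0 = y 0 / s 0 * cos (prufer_angle 0) - d 0 / s 0 * sin (prufer_angle 0) by rewrite a0 sin0 y0 !mul0r mulr0 subrr.
  apply: (@der0_cst R (fun t => y t / s t * cos (prufer_angle t) - d t / s t * sin (prufer_angle t))).
  by apply: der_ext (derB (derM dA' dco) (derM dC' dsi)) _ => x; rewrite -/(fp x); ring.
have I2 t : y t / s t * sin (prufer_angle t) + d t / s t * cos (prufer_angle t) = 1.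
  have -> : 1 = y 0 / s 0 * sin (prufer_angle 0) + d 0 / s 0 * cos (prufer_angle 0).
    by rewrite a0 cos0 y0 d0 s0 !mul0r add0r mulr1 divr1.
  apply: (@der0_cst R (fun t => y t / s t * sin (prufer_angle t) + d t / s t * cos (prufer_angle t))).
  by apply: der_ext (derD (derM dA' dsi) (derM dC' dco)) _ => x; rewrite -/(fp x); ring.
split => // t.
  have -> : y t = s t * (y t / s t) by rewrite mulrC divfK.
  congr (_ * _); have cs := cos2Dsin2 (prufer_angle t); have i1 := I1 t; have i2 := I2 t.
  have -> : y t / s t = (y t / s t * cos (prufer_angle t) - d t / s t * sin (prufer_angle t)) * cos (prufer_angle t) +
    (y t / s t * sin (prufer_angle t) + d t / s t * cos (prufer_angle t)) * sin (prufer_angle t).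
    rewrite -[LHS]mulr1 -cs; ring.
  by rewrite i1 i2; ring.
have -> : d t = s t * (d t / s t) by rewrite mulrC divfK.
congr (_ * _); have cs := cos2Dsin2 (prufer_angle t); have i1 := I1 t; have i2 := I2 t.
have -> : d t / s t = - (y t / s t * cos (prufer_angle t) - d t / s t * sin (prufer_angle t)) * sin (prufer_angle t) +
    (y t / s t * sin (prufer_angle t) + d t / s t * cos (prufer_angle t)) * cos (prufer_angle t).
    rewrite -[LHS]mulr1 -cs; ring.
by rewrite i1 i2; ring.
Qed.

(** In terms of the angle alone the equation is decoupled from the radius; this
is what gives the monotonicity and the continuity in L below. *)
Lemma prufer_ode : der prufer_angle (fun t => cos (prufer_angle t) ^+ 2 + hillQ L t * sin (prufer_angle t) ^+ 2).
Proof.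
apply: der_ext prufer_angle_der _ => t; have [_ -> ->] := prufer_coords.
have -> : s t * cos (prufer_angle t) * (s t * cos (prufer_angle t))
    + hillQ L t * (s t * sin (prufer_angle t) * (s t * sin (prufer_angle t))) =
  (s t * s t) * (cos (prufer_angle t) ^+ 2 + hillQ L t * sin (prufer_angle t) ^+ 2) by ring.
by rewrite prufer_radius_sq mulrC mulKf // gt_eqF // prufer_sq_gt0.
Qed.

(** Small L gives a small angle: at L = 0 the angle at time t is at most t, and
a prescribed large angle forces L to be large. *)
Lemma angle_le t : 0 <= t -> prufer_angle t <= (1 + L * M) * t.
Proof.
move=> t0; have [a0 _ _] := prufer_coords.
apply: (der_le_le prufer_ode (derZ (1 + L * M) (@der_id R)) t0); first by rewrite a0 mulr0.
move=> x _; rewrite mulr1 cos2sin2 /hillQ.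
have h1 : 0 <= sin (prufer_angle x) ^+ 2 by rewrite sqr_ge0.
have h2 : sin (prufer_angle x) ^+ 2 <= 1 by rewrite -subr_ge0 -cos2sin2 sqr_ge0.
have : L * q x * sin (prufer_angle x) ^+ 2 <= L * M * 1 by rewrite ler_pM // ?mulr_ge0 // ler_wpM2l.
lra.
Qed.

Lemma angle_der_ge1 t : 1 <= cos (prufer_angle t) ^+ 2 + hillQ L t * sin (prufer_angle t) ^+ 2.
Proof.
rewrite cos2sin2 /hillQ; have : 0 <= L * q t * sin (prufer_angle t) ^+ 2 by apply: mulr_ge0; [exact: mulr_ge0|exact: sqr_ge0].
lra.
Qed.

Lemma angle_incr t1 t2 : t1 < t2 -> prufer_angle t1 < prufer_angle t2.
Proof.
move=> t12; apply: (der_gt0_lt prufer_ode t12) => x _.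
by apply: lt_le_trans (angle_der_ge1 x).
Qed.

(** Sturm comparison with y'' = - k^2 y.  If y had no zero,
atan (d / (k y)) would be defined throughout and decrease at rate at least k,
hence by at least pi, which is more than the range of atan allows. *)
Lemma zero_window (k t1 t2 : R) : 0 < k -> (forall t, t1 <= t <= t2 -> k ^+ 2 <= hillQ L t) ->
  t1 <= t2 -> pi <= k * (t2 - t1) -> exists2 t, t1 <= t <= t2 & y t = 0.
Proof.
move=> k0 hQ t12 hk; apply: contrapT => Hno.
have yN t : t1 <= t <= t2 -> y t != 0.
  by move=> ht; apply/negP => /eqP e; apply: Hno; exists t.
have [dy dd] := S.
pose h t := atan (d t / (k * y t)).
have dh t : t1 <= t <= t2 -> is_derive t 1 h
   ((- hillQ L t * y t * (k * y t) - d t * (k * d t)) / ((k * y t) ^+ 2 + d t ^+ 2)).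
  move=> ht; have yt := yN t ht.
  have ky : k * y t != 0 by rewrite mulf_neq0 // gt_eqF.
  have D1 : is_derive t 1 (fun t => (k * y t)^-1) (- (k * y t) ^- 2 *: (k * d t)).
    by apply: is_deriveV => //; exact: (derZ k dy).
  have D2 : is_derive t 1 (fun t => d t / (k * y t)) (d t *: (- (k * y t) ^- 2 *: (k * d t)) + (k * y t)^-1 *: (- hillQ L t * y t)).
    exact: is_deriveM.
  have := @is_derive1_comp R atan (fun t => d t / (k * y t)) t _ _ (is_derive1_atan (d t / (k * y t))) D2.
  move=> D3; apply: (is_derive_eq D3); rewrite /GRing.scale /=.
  have p1 : 0 < (k * y t) ^+ 2 by rewrite exprn_even_gt0.
  have p2 : 0 <= d t ^+ 2 by rewrite sqr_ge0.
  have n1 : (k * y t) ^+ 2 + d t ^+ 2 != 0 by rewrite gt_eqF // ltr_pwDl.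
  by field; rewrite n1 yt (gt_eqF k0).
have ch : {within `[t1, t2], continuous h}.
  apply: derivable_within_continuous => t; rewrite in_itv /= => ht.
  by have [] := dh t ht.
have [c hc] := @MVT_segment R h _ t1 t2 t12 (fun x hx => dh x (subset_itv_oo_cc hx)) ch.
have {hc} hc' : t1 <= c <= t2 by move: hc; rewrite in_itv.
move=> e; have b1 := atan_gtNpi2 (d t2 / (k * y t2)); have b2 := atan_ltpi2 (d t1 / (k * y t1)).
have yc := yN c hc'.
have p1 : 0 < (k * y c) ^+ 2 by rewrite exprn_even_gt0 //= mulf_neq0 // gt_eqF.
have p2 : 0 <= d c ^+ 2 by rewrite sqr_ge0.
have : (- hillQ L c * y c * (k * y c) - d c * (k * d c)) / ((k * y c) ^+ 2 + d c ^+ 2) <= - k.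
  rewrite ler_pdivrMr ?ltr_pwDl // -subr_ge0.
  have -> : - k * ((k * y c) ^+ 2 + d c ^+ 2) - (- hillQ L c * y c * (k * y c) - d c * (k * d c)) =
    k * (y c ^+ 2 * (hillQ L c - k ^+ 2)) by ring.
  by apply: mulr_ge0; [exact: ltW|apply: mulr_ge0; [exact: sqr_ge0|rewrite subr_ge0 hQ]].
have t21 : 0 <= t2 - t1 by rewrite subr_ge0.
move=> /(ler_wpM2r t21) hle.
have : h t2 - h t1 <= - pi by rewrite e; apply: le_trans hle _; rewrite mulNr lerN2.
rewrite /h; lra.
Qed.

Lemma sin_kpi (n : nat) : sin (pi *+ n) = 0 :> R.
Proof. by have := alternatingn (@sinDpi R) n 0; rewrite add0r sin0 mulr0. Qed.
Lemma cos_kpi (n : nat) : cos (pi *+ n) = (-1) ^+ n :> R.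
Proof. by have := alternatingn (@cosDpi R) n 0; rewrite add0r cos0 mulr1. Qed.

(** At a zero of y the angle is a multiple of pi. *)
Lemma angle_zero_ge (n : nat) t : y t = 0 -> pi *+ n < prufer_angle t -> pi *+ n.+1 <= prufer_angle t.
Proof.
have [_ -> _] := prufer_coords => /eqP; rewrite mulf_eq0 gt_eqF ?prufer_radius_gt0 //= => /eqP sa h.
rewrite leNgt; apply/negP => h2.
have : 0 < sin (prufer_angle t - pi *+ n).
  by apply: sin_gt0_pi; rewrite subr_gt0 h /= ltrBlDl addrC -mulrS.
by rewrite sinB sa sin_kpi mul0r mulr0 subrr ltxx.
Qed.

(** Every second window of length pi / k contributes a zero of y strictly after
the previous one, and each new zero adds pi to the angle; hence n.*2 windows
for an angle of n pi. *)
Lemma angle_large (k t1 t2 : R) (n : nat) : 0 < k -> 0 <= t1 ->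
  (forall t, t1 <= t <= t2 -> k ^+ 2 <= hillQ L t) ->
  pi *+ n.*2 <= k * (t2 - t1) -> pi *+ n <= prufer_angle t2.
Proof.
move=> k0 t10 hQ.
have [a0 _ _] := prufer_coords.
have pk : 0 < pi / k by rewrite divr_gt0 // pi_gt0.
have kpk : k * (pi / k) = pi by rewrite mulrC divfK // gt_eqF.
pose st (j : nat) := t1 + (pi / k) *+ j.
have H (j : nat) : st j.*2 <= t2 -> pi *+ j <= prufer_angle (st j.*2).
  elim: j => [|j IH] hj.
    rewrite mulr0n /st addr0; case: (ltgtP 0 t1) t10 => // [h|<-] _; last by rewrite a0.
    by rewrite -a0; apply: ltW; exact: angle_incr.
  have e1 : st j.*2.+1 = st j.*2 + pi / k by rewrite /st mulrSr addrA.
  have e2 : st j.*2.+2 = st j.*2.+1 + pi / k by rewrite /st mulrSr addrA.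
  have h1 : t1 <= st j.*2 by rewrite /st lerDl mulrn_wge0 // ltW.
  rewrite doubleS in hj *.
  have IH' : pi *+ j <= prufer_angle (st j.*2) by apply: IH; apply: le_trans hj; rewrite e2 e1; lra.
  have [] := @zero_window k (st j.*2.+1) (st j.*2.+2) k0.
  - move=> t /andP[ta tb]; apply: hQ; apply/andP; split; last exact: le_trans hj.
    by apply: le_trans ta; rewrite e1; lra.
  - by rewrite e2; lra.
  - by rewrite e2 addrC addKr kpk.
  - move=> t /andP[ta tb] yt.
    have lt : pi *+ j.+1 <= prufer_angle t.
      by apply: angle_zero_ge => //; apply: le_lt_trans IH' _; apply: angle_incr; apply: lt_le_trans ta; rewrite e1; lra.
    apply: le_trans lt _; case: (ltgtP t (st j.*2.+2)) tb => // [tb|->] _ //.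
    by apply: ltW; exact: angle_incr.
move=> hk.
have hn : st n.*2 <= t2.
  have : (pi / k) *+ n.*2 <= t2 - t1 by rewrite -mulrnAl ler_pdivrMr // mulrC.
  rewrite /st; lra.
apply: le_trans (H n hn) _.
by case: (ltgtP (st n.*2) t2) hn => // [tb|->] _ //; apply: ltW; exact: angle_incr.
Qed.

End Prufer.

Lemma sin2_lip (a b : R) : `|sin a ^+ 2 - sin b ^+ 2| <= 2 * `|a - b|.
Proof.
wlog : a b / b <= a.
  by move=> W; case: (leP b a) => h; [exact: W|rewrite distrC [`|a - b|]distrC; apply: W; exact: ltW].
move=> ba; have ds := derM (@der_sin R) (@der_sin R).
have [c _] := der_MVT ds ba; rewrite /= -!expr2 => ->.
rewrite normrM ler_wpM2r // [sin c * cos c]mulrC -mulr2n -[_ *+ 2]mulr_natl normrM ger0_norm // -[leRHS]mulr1 ler_wpM2l //.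
by rewrite normrM -[leRHS]mulr1 ler_pM // ?cos_max ?sin_max.
Qed.

(** The decoupled equation for the angle has a right-hand side which is
Lipschitz in the angle and in L. *)
Lemma angle_param_cont (y d : R -> R -> R) :
  (forall L, [/\ y L 0 = 0, d L 0 = 1 & sol (hillQ L) (y L) (d L)]) ->
  continuous (fun L => prufer_angle L (y L) (d L) T).
Proof.
move=> H L0.
pose K := 4 * ((`|L0| + 1) * M) + 1.
have K0 : 0 <= K by rewrite addr_ge0 // mulr_ge0 // mulr_ge0 ?addr_ge0 // ltW.
apply: (@lipschitz_at_cont _ L0 (M ^+ 2 * T * expR (K * T) + 1)) => L hL.
apply: norm_le_of_sqr; first by apply: mulr_ge0; [apply: mulr_ge0; [exact: sqr_ge0|exact: ltW]|exact: expR_ge0].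
have [y0 d0 s0] := H L; have [y1 d1 s1] := H L0.
pose u := prufer_angle L (y L) (d L); pose v := prufer_angle L0 (y L0) (d L0).
have du : der u _ := prufer_ode y0 d0 s0.
have dv : der v _ := prufer_ode y1 d1 s1.
have [u0 _ _] := prufer_coords y0 d0 s0.
have [v0 _ _] := prufer_coords y1 d1 s1.
have duv := derB du dv.
have dE := derM duv duv.
have hc : 0 <= (L - L0) ^+ 2 * M ^+ 2 by rewrite mulr_ge0 // sqr_ge0.
have := @gronwall R _ _ K ((L - L0) ^+ 2 * M ^+ 2) T dE K0 hc _ T.
rewrite (ltW T0) lexx => /(_ _ isT).
have u00 : u 0 = 0 by []; have v00 : v 0 = 0 by [].
rewrite u00 v00 subrr mulr0 add0r => G.
rewrite expr2; apply: le_trans (G _) _; last by rewrite !mulrA.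
move=> t tT; rewrite -/u -/v !cos2sin2 /hillQ.
set a := sin (u t) ^+ 2; set b := sin (v t) ^+ 2; set e := u t - v t.
have h1 : `|a - b| <= 2 * `|e| by exact: sin2_lip.
have b0 : 0 <= b by rewrite sqr_ge0.
have b1 : b <= 1 by rewrite /b -subr_ge0 -cos2sin2 sqr_ge0.
have hL2 : `|L| <= `|L0| + 1.
  have -> : L = L0 + (L - L0) by lra.
  by apply: le_trans (ler_normD _ _) _; rewrite lerD2l.
have qt0 := q0 t; have qt := qM t.
rewrite (_ : _ + _ = e * (L * q t * (a - b)) * 2 + 2 * ((L - L0) * (q t * b) * e)); last by ring.
have i1 : e * (L * q t * (a - b)) <= 2 * ((`|L0| + 1) * M) * (e * e).
  apply: le_trans (ler_norm _) _; rewrite !normrM.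
  have -> : 2 * ((`|L0| + 1) * M) * (e * e) = `|e| * ((`|L0| + 1) * M * (2 * `|e|)).
    have -> : e * e = `|e| * `|e| by rewrite -normrM ger0_norm // -expr2 sqr_ge0.
    by ring.
  rewrite ler_wpM2l // ler_pM // ?mulr_ge0 // ler_pM // ger0_norm //.
have i2 : 2 * ((L - L0) * (q t * b) * e) <= (L - L0) ^+ 2 * M ^+ 2 + e * e.
  have : (q t * b) ^+ 2 <= M ^+ 2.
    have qb0 : 0 <= q t * b := mulr_ge0 qt0 b0.
    have qbM : q t * b <= M by rewrite -[M]mulr1 ler_pM.
    by rewrite lerXn2r // nnegrE // ltW.
  move=> /(ler_wpM2l (sqr_ge0 (L - L0))) h.
  have := sqr_ge0 ((L - L0) * (q t * b) - e).
  have -> : ((L - L0) * (q t * b) - e) ^+ 2 = (L - L0) ^+ 2 * (q t * b) ^+ 2 - 2 * ((L - L0) * (q t * b) * e) + e * e by ring.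
  lra.
rewrite /K; lra.
Qed.

Hypothesis qpos : exists2 t, 0 < t < T & 0 < q t.

Lemma q_window : exists t1 t2 e, [/\ 0 <= t1, t1 < t2, t2 <= T, 0 < e & forall t, t1 <= t <= t2 -> e <= q t].
Proof.
have [t /andP[t0 tT] qt] := qpos.
have e0 : 0 < q t / 2 by rewrite divr_gt0.
have /cvgrPdist_lt/(_ _ e0)/nbhs_ballP := @cq t; move=> [r /= r0 Hr].
pose r' := Num.min (r / 2) (T - t).
have r'0 : 0 < r' by rewrite lt_min divr_gt0 //= subr_gt0.
exists t, (t + r'), (q t / 2); split => //; rewrite ?(ltW t0) ?ltrDl //.
  by rewrite -lerBrDl ge_min lexx orbT.
move=> s /andP[s1 s2]; have : `|q t - q s| < q t / 2.
  apply: Hr; rewrite /ball /= ler0_norm ?opprB ?subr_le0 //.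
  apply: (@le_lt_trans _ _ r'); first by lra.
  by apply: (@le_lt_trans _ _ (r / 2)); [rewrite ge_min lexx|lra].
by rewrite ltr_norml => /andP[_]; lra.
Qed.

(** Taking L = k^2 / e makes Q >= k^2 on a window where q >= e. *)
Lemma angle_unbounded (y d : R -> R -> R) (n : nat) :
  (forall L, [/\ y L 0 = 0, d L 0 = 1 & sol (hillQ L) (y L) (d L)]) ->
  exists2 L, 0 <= L & pi *+ n <= prufer_angle L (y L) (d L) T.
Proof.
move=> H; have [t1 [t2 [e [t10 t12 t2T e0 He]]]] := q_window.
pose k := (pi *+ n.*2 / (t2 - t1)) + 1.
have t21 : 0 < t2 - t1 by rewrite subr_gt0.
have k0 : 0 < k by rewrite ltr_wpDl // divr_ge0 ?(ltW t21) // mulrn_wge0 // pi_ge0.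
have L0 : 0 <= k ^+ 2 / e by rewrite divr_ge0 ?sqr_ge0 // ltW.
exists (k ^+ 2 / e) => //.
have [y0 d0 s0] := H (k ^+ 2 / e).
apply: (@le_trans _ _ (prufer_angle (k ^+ 2 / e) (y (k ^+ 2 / e)) (d (k ^+ 2 / e)) t2)).
  apply: (angle_large L0 y0 d0 s0 k0 t10).
    move=> t ht; rewrite /hillQ -[leLHS]add0r lerD //.
    rewrite -mulrAC ler_pdivlMr // ler_wpM2l ?sqr_ge0 //; exact: He.
  by rewrite /k mulrDl divfK ?gt_eqF // mul1r lerDl ltW.
case: (ltgtP t2 T) t2T => // [h|->] _ //.
by apply: ltW; apply: angle_incr.
Qed.

(** The eigenvalue is found through the trace of the monodromy matrix rather
than by a variational principle: equality of the trace with 2 and determinant 1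
mean that 1 is an eigenvalue. *)
Lemma hill_periodic_eigen (B : R) : exists L y d, [/\ B < L, 0 <= L, sol (hillQ L) y d, y T = y 0 /\ d T = d 0 &
  (y 0 != 0) || (d 0 != 0)].
Proof.
have /choice [y2 /choice [d2 H2]] : forall L, exists y, exists d, [/\ y 0 = 0, d 0 = 1 & sol (hillQ L) y d].
  by move=> L; exact: hill_exists.
have /choice [y1 /choice [d1 H1]] : forall L, exists y, exists d, [/\ y 0 = 1, d 0 = 0 & sol (hillQ L) y d].
  by move=> L; exact: hill_exists.
pose Phi L := prufer_angle L (y2 L) (d2 L) T.
have cPhi : continuous Phi := angle_param_cont H2.
have hit (n : nat) : (2 <= n)%N -> exists2 L, 0 <= L & Phi L = pi *+ n.
  move=> n2; have [L1 L10 h1] := angle_unbounded n H2.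
  have h0 : Phi 0 <= pi *+ n.
    have [y0 d0 s0] := H2 0; apply: le_trans (angle_le (lexx 0) y0 d0 s0 (ltW T0)) _.
    by rewrite mul0r addr0 mul1r /T mulr_natl ler_wpMn2l // pi_ge0.
  have [||L /andP[L0 _] e] := @ivt_either Phi 0 L1 (pi *+ n) cPhi => //; first by rewrite h0 h1.
  by exists L.
have W L : y1 L T * d2 L T - d1 L T * y2 L T = 1.
  have [a1 c1 s1] := H1 L; have [a2 c2 s2] := H2 L.
  by rewrite (wronskian T 0 s1 s2) a1 c1 a2 c2 mulr1 mul0r subr0.
have tr (n : nat) L : Phi L = pi *+ n -> exists2 s, 2 <= s & y1 L T + d2 L T = (-1) ^+ n * s.
  move=> e; have [a2 c2 s2] := H2 L; have [p0 p1 p2] := prufer_coords a2 c2 s2.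
  have := p1 T; rewrite -/(Phi L) e sin_kpi mulr0 => yT.
  have := p2 T; rewrite -/(Phi L) e cos_kpi.
  have := prufer_radius_gt0 c2 s2 T; set r := Num.sqrt _ => r0 dT.
  have := W L; rewrite yT mulr0 subr0 dT => w.
  have sg : (-1) ^+ n * (-1) ^+ n = 1 :> R by rewrite -exprMn mulrNN mulr1 expr1n.
  exists (r + r^-1).
    rewrite -subr_ge0 (_ : _ - 2 = (r - 1) ^+ 2 / r); first by rewrite divr_ge0 ?sqr_ge0 // ltW.
    by field; rewrite gt_eqF.
  rewrite mulrDr [_ * r]mulrC addrC; congr (_ + _).
  apply: (@mulIf _ r); first by rewrite gt_eqF.
  rewrite divfK ?gt_eqF //.
  move: sg w; move: ((-1) ^+ n) => g sg w; rewrite -[LHS]mulr1 -sg.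
  by transitivity ((y1 L T * (r * g)) * g); [ring|rewrite w mul1r].
(* An angle n pi with n this large is only reached for L > |B|. *)
pose n := (Num.truncn (2 * (1 + `|B| * M))).+1.
have nB : 2 * (1 + `|B| * M) < n%:R by exact: truncnS_gt.
have large (k : nat) L : (n <= k)%N -> 0 <= L -> Phi L = pi *+ k -> `|B| < L.
  move=> nk L0 e; rewrite ltNge; apply/negP => LB.
  have [a2 c2 s2] := H2 L; have := angle_le L0 a2 c2 s2 (ltW T0).
  rewrite -/(Phi L) e /T => h.
  have : pi *+ k <= (1 + `|B| * M) * (2 * pi).
    apply: le_trans h _; rewrite ler_wpM2r ?mulr_ge0 ?pi_ge0 // lerD2l ler_wpM2r //; exact: ltW.
  rewrite -[pi *+ k]mulr_natl mulrA ler_pM2r ?pi_gt0 //.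
  have : n%:R <= k%:R :> R by rewrite ler_nat.
  lra.
have n2 : (2 <= n)%N.
  rewrite -(ler_nat R); apply: ltW; apply: le_lt_trans nB.
  have : 0 <= `|B| * M by rewrite mulr_ge0 // ltW.
  lra.
have nn : (n <= n.*2)%N by rewrite -addnn leq_addr.
have nn1 : (n <= n.*2.+1)%N by rewrite ltnW.
have [La La0 Pa] := hit n.*2 (leq_trans n2 nn).
have [Lb Lb0 Pb] := hit n.*2.+1 (leq_trans n2 nn1).
have [sa sa2 ta] := tr _ _ Pa; have [sb sb2 tb] := tr _ _ Pb.
have sg : (-1) ^+ n.*2 = 1 :> R by rewrite -signr_odd odd_double.
rewrite exprS sg mulr1 in tb; rewrite sg mul1r in ta.
have [cy1 cd1] := sol_param_cont H1; have [cy2 cd2] := sol_param_cont H2.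
pose t L := y1 L T + d2 L T.
have ct : continuous t by move=> L; apply: cvgD; [exact: cy1|exact: cd2].
have [L [L0 LB tL]] : exists L, [/\ 0 <= L, `|B| < L & t L = 2].
  have BLa := large _ _ nn La0 Pa; have BLb := large _ _ nn1 Lb0 Pb.
  have ta' : t La = sa by [].
  have tb' : t Lb = - sb by rewrite /t tb mulN1r.
  case: (leP La Lb) => h.
    have [||L /andP[l1 l2] e] := @ivt_either t La Lb 2 ct => //.
      by rewrite ta' tb' sa2 andbT; apply/orP; right; lra.
    exists L; split => //.
      exact: le_trans l1.
    exact: lt_le_trans l1.
  have [||L /andP[l1 l2] e] := @ivt_either t Lb La 2 ct; first exact: ltW.
    by rewrite ta' tb' sa2 andbT; apply/orP; left; lra.
  exists L; split => //.
    exact: le_trans l1.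
  exact: lt_le_trans l1.
have BL : B < L by apply: le_lt_trans (ler_norm _) LB.
have [a1 c1 s1] := H1 L; have [a2 c2 s2] := H2 L.
have w := W L; rewrite /t in tL.
have ker : exists a c : R, [/\ (a != 0) || (c != 0), a * y1 L T + c * y2 L T = a & a * d1 L T + c * d2 L T = c].
  move: w tL; move: (y1 L T) (y2 L T) (d1 L T) (d2 L T) => A B' C D w tL.
  have [B0|B0] := eqVneq B' 0; last first.
    exists B', (1 - A); split; first by rewrite B0.
      by ring.
    have -> : D = 2 - A by lra.
    have : A * (2 - A) - C * B' = 1 by have <- : D = 2 - A by lra.
    lra.
  have [C0|C0] := eqVneq C 0; last first.
    exists (1 - D), C; split; first by rewrite C0 orbT.
      have -> : A = 2 - D by lra.
      have : (2 - D) * D - C * B' = 1 by have <- : A = 2 - D by lra.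
      lra.
    by ring.
  exists 1, 0; rewrite oner_eq0 /= B0 C0; split => //; last by ring.
  have : (A - 1) ^+ 2 = 0.
    have -> : (A - 1) ^+ 2 = A * (A - 2) + 1 by ring.
    have -> : A - 2 = - D by lra.
    move: w; rewrite C0 mul0r subr0 => w; lra.
  by move/eqP; rewrite sqrf_eq0 subr_eq0 => /eqP ->; rewrite mulr1 mulr0 addr0.
have [a [c [ac e1 e2]]] := ker.
exists L, (fun t => a * y1 L t + c * y2 L t), (fun t => a * d1 L t + c * d2 L t); split => //.
- exact: sol_comb.
- by rewrite a1 a2 c1 c2 !mulr1 !mulr0 addr0 add0r.
- by rewrite a1 a2 c1 c2 !mulr1 !mulr0 addr0 add0r.
Qed.

End Hill.

(** * Periodic solutions of the inhomogeneous Hill equation *)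

Section Fredholm.
Variable R : realType.
Implicit Types (f g y d G : R -> R) (t L : R).

(** Periodicity of the particular solution given by variation of constants is
a 2 x 2 linear system with matrix M - 1, where M = (A, B; C, D) is the
monodromy, of determinant 1.  When M - 1 is singular, the positive definite
form (G11, G12, G22), the integrals of q y_i y_j, lets a fixed vector (a, c)
of M correct the right-hand side. *)
Lemma periodic_data_solvable (A B C D g1 g2 G11 G12 G22 : R) : A * D - C * B = 1 ->
  (forall a c, (a != 0) || (c != 0) -> 0 < a * a * G11 + 2 * (a * c * G12) + c * c * G22) ->
  exists a c x z, [/\ A * a + B * c = a, C * a + D * c = c,
    A * x + B * z = x + (g2 - (a * G12 + c * G22)) & C * x + D * z = z - (g1 - (a * G11 + c * G12))].
Proof.
move=> det pos.
have [de|de] := eqVneq (2 - A - D) 0; last first.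
  exists 0, 0, (((D - 1) * g2 + B * g1) / (2 - A - D)), ((- C * g2 - (A - 1) * g1) / (2 - A - D)).
  split; try by ring.
    have h : A * D = 1 + C * B by lra.
    apply/eqP; rewrite -subr_eq0; apply/eqP.
    apply: (mulIf de).
    transitivity ((A * D - C * B - 1) * g2); last by rewrite det subrr !mul0r.
    by field.
  apply/eqP; rewrite -subr_eq0; apply/eqP.
  apply: (mulIf de).
  transitivity (- (A * D - C * B - 1) * g1); last by rewrite det subrr oppr0 !mul0r.
  by field.
have DE : D = 2 - A by lra.
subst D.
have [B0|B0] := eqVneq B 0; last first.
  have P := pos B (1 - A) (introT orP (or_introl B0)).
  set F := (X in 0 < X) in P.
  pose s := ((1 - A) * g2 + B * g1) / F.
  have Fn : F != 0 by rewrite gt_eqF.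
  have sF : s * F = (1 - A) * g2 + B * g1 by rewrite /s divfK.
  exists (s * B), (s * (1 - A)), 0, ((g2 - (s * B * G12 + s * (1 - A) * G22)) / B).
  split.
  - by ring.
  - have h : A * (2 - A) = 1 + C * B by lra.
    transitivity (s * (C * B + (2 - A) * (1 - A))); first by ring.
    have -> : C * B = A * (2 - A) - 1 by lra.
    by ring.
  - by field.
  - apply/eqP; rewrite -subr_eq0; apply/eqP; apply: (mulIf B0).
    transitivity ((1 - A) * g2 + B * g1 - s * F); last by rewrite sF subrr mul0r.
    by rewrite /F; field.
subst B.
have A1 : A = 1.
  have : (A - 1) ^+ 2 = 0 by transitivity (- (A * (2 - A) - C * 0) + 1); [ring|lra].
  by move/eqP; rewrite sqrf_eq0 subr_eq0 => /eqP.
subst A.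
have [C0|C0] := eqVneq C 0; last first.
  have := pos 0 1 (introT orP (or_intror (oner_neq0 _))); rewrite !mul0r mulr0 !add0r !mul1r => P'.
  have Gn : G22 != 0 by rewrite gt_eqF.
  exists 0, (g2 / G22), (- (g1 - (g2 / G22) * G12) / C), 0; split; try by ring.
    by field; rewrite ?Gn ?C0.
  by field; rewrite ?Gn ?C0.
subst C.
have P1 := pos 1 0 (introT orP (or_introl (oner_neq0 _))).
have G1 : 0 < G11 by lra.
have G1N : - G11 != 0 by rewrite oppr_eq0 gt_eqF.
have P2 := pos G12 (- G11) (introT orP (or_intror G1N)).
have Dn : 0 < G11 * G22 - G12 ^+ 2.
  rewrite -(pmulr_rgt0 _ G1).
  have <- : G12 * G12 * G11 + 2 * (G12 * - G11 * G12) + - G11 * - G11 * G22 = G11 * (G11 * G22 - G12 ^+ 2) by ring.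
  exact: P2.
have Dn' : G11 * G22 - G12 ^+ 2 != 0 by rewrite gt_eqF.
exists ((g1 * G22 - g2 * G12) / (G11 * G22 - G12 ^+ 2)), ((g2 * G11 - g1 * G12) / (G11 * G22 - G12 ^+ 2)), 0, 0.
by split; field.
Qed.

Lemma primD f g (a c : R) t : continuous f -> continuous g ->
  prim (fun t => a * f t + c * g t) t = a * prim f t + c * prim g t.
Proof.
move=> cf cg; have [f0 df] := primP cf; have [g0 dg] := primP cg.
have D := derD (derZ a df) (derZ c dg).
have ch : continuous (fun t => a * f t + c * g t).
  by move=> x; apply: cvgD; apply: cvgM; [exact: cvg_cst|exact: cf|exact: cvg_cst|exact: cg].
have [h0 dh] := primP ch.
by apply: (@der_unique_prim R _ _ _ 0 t dh D); rewrite h0 f0 g0 !mulr0 addr0.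
Qed.

Variables (q : R -> R).
Hypotheses (sq : smooth q) (pq : per q) (q0 : forall t, 0 <= q t).
Let T : R := 2 * pi.
Hypothesis qpos : exists2 t, 0 < t < T & 0 < q t.

Let T0 : 0 < T. Proof. by rewrite mulr_gt0 // pi_gt0. Qed.

Lemma weight_bounded : exists2 M, 0 < M & forall t, q t <= M.
Proof.
have [M M0 HM] := per_bounded (smooth_cont sq) pq.
by exists M => // t; apply: le_trans (ler_norm _) (HM t).
Qed.

Lemma hillQ_bounded L : exists2 K, 0 < K & forall t, `|hillQ q L t| <= K.
Proof.
have [M M0 qM] := weight_bounded; exists (1 + `|L| * M); last by move=> t; apply: hillQ_bound.
by rewrite ltr_pwDl // mulr_ge0 // ltW.
Qed.

Lemma hillQ_smooth L : smooth (hillQ q L).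
Proof. by apply: smoothD; [exact: smooth_cst|apply: smoothM => //; exact: smooth_cst]. Qed.

Lemma hillQ_per L : per (hillQ q L). Proof. by move=> t; rewrite /hillQ pq. Qed.

Definition inh_sol G L y d := der y d /\ der d (fun t => G t - hillQ q L t * y t).

Lemma sol_inh_sol L y d : sol (hillQ q L) y d -> inh_sol (fun=> 0) L y d.
Proof. by move=> [A B]; split => //; apply: der_ext B _ => t; rewrite sub0r mulNr. Qed.

Lemma inh_sol_smooth G L y d : smooth G -> inh_sol G L y d -> smooth y /\ smooth d.
Proof.
move=> sG [dy dd].
suff H n : Cn n y /\ Cn n d by split=> n; have [] := H n.
elim: n => [|n [IH1 IH2]]; first by split; [exact: der_cont dy|exact: der_cont dd].
split; first exact: CnS dy IH2.
apply: CnS dd _; apply: CnD; first exact: sG.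
rewrite (_ : (fun t => _) = fun t => (- 1) * (hillQ q L t * y t)); last by apply/funext => t; rewrite mulN1r.
by apply: CnM; [exact: Cn_cst|apply: CnM => //; exact: hillQ_smooth].
Qed.

(** The difference of a solution and its translate solves the homogeneous
equation and has zero data at 0. *)
Lemma inh_sol_per G L y d : per G -> inh_sol G L y d -> y T = y 0 -> d T = d 0 -> per y.
Proof.
move=> pG [dy dd] yT dT.
have sh : der (fun t => t + T) (fun=> 1) by apply: der_ext (derD (@der_id R) (der_cst T)) _ => t; rewrite addr0.
have dy' := der_comp dy sh; have dd' := der_comp dd sh.
have S : sol (hillQ q L) (fun t => y (t + T) - y t) (fun t => d (t + T) - d t).
  split; first by apply: der_ext (derB dy' dy) _ => t; rewrite mul1r.
  apply: der_ext (derB dd' dd) _ => t; rewrite mul1r /T pG hillQ_per; ring.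
have [K K0 bQ] := hillQ_bounded L.
move=> t; have [] := sol_zero bQ S (t0 := 0) _ _ t; rewrite ?add0r ?yT ?dT ?subrr //.
by move/eqP; rewrite subr_eq0 => /eqP.
Qed.

Lemma inh_sol_derive G L y d : inh_sol G L y d -> forall t,
  derive1 (derive1 y) t + hillQ q L t * y t = G t.
Proof. by move=> [dy dd] t; rewrite (derEf dy) (derEf dd) subrK. Qed.

(** If the integral of q w^2 were zero, w would vanish on an interval where
q > 0, and then identically. *)
Lemma weight_pos L w d : sol (hillQ q L) w d -> (w 0 != 0) || (d 0 != 0) ->
  0 < prim (fun t => q t * (w t * w t)) T.
Proof.
move=> S nz; have [dw dd] := S.
have cw := der_cont dw.
have cF : continuous (fun t => q t * (w t * w t)).
  by move=> t; apply: cvgM; [exact: smooth_cont sq t|apply: cvgM; exact: cw].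
have [F0 dF] := primP cF; set F := prim _ in F0 dF *.
have pw t : 0 <= q t * (w t * w t) by apply: mulr_ge0 => //; rewrite -expr2 sqr_ge0.
have mF a c : a <= c -> F a <= F c by move=> ac; apply: (der_ge0_le dF ac) => x _.
have FT : 0 <= F T by rewrite -F0; apply: mF; exact: ltW.
rewrite lt_neqAle FT andbT; apply/negP => /eqP FT0.
have Fz t : 0 <= t <= T -> F t = 0.
  by move=> /andP[a c]; apply/eqP; rewrite eq_le {1}FT0 mF //= -F0 mF.
have [t1 [t2 [e [t10 t12 t2T e0 He]]]] := q_window (smooth_cont sq) qpos.
have near0 (f : R -> R) df x : der f df -> t1 < x < t2 -> (forall t, t1 < t < t2 -> f t = 0) -> df x = 0.
  move=> D xt fz.
  have H : is_derive x 1 f 0.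
    apply: (near_eq_is_derive _ (is_derive_cst (0 : R) x 1)).
    have : \forall z \near x, t1 < z < t2.
      move/andP: xt => [h1 h2]; near=> z; apply/andP; split; near: z; [exact: lt_nbhsr|exact: lt_nbhsl].
    by apply: filterS => z /fz ->.
  by have [_ <-] := D x; have [_ ->] := H.
have wz t : t1 < t < t2 -> w t = 0.
  move=> tt; have : q t * (w t * w t) = 0.
    apply: (near0 F _ t dF tt) => s /andP[s1 s2]; apply: Fz; apply/andP; split.
      by apply: ltW; apply: le_lt_trans s1.
    by apply: ltW; apply: lt_le_trans t2T.
  have qt : 0 < q t by apply: lt_le_trans e0 (He t _); move/andP: tt => [/ltW -> /ltW ->].
  by move/eqP; rewrite mulf_eq0 gt_eqF //= mulf_eq0 orbb => /eqP.
have mid : t1 < (t1 + t2) / 2 < t2 by apply/andP; split; lra.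
have w0 := wz _ mid; have d0 := near0 w d _ dw mid wz.
have [K K0 bQ] := hillQ_bounded L.
have [a c] := sol_zero bQ S w0 d0 0.
by move: nz; rewrite a c eqxx.
Unshelve. all: by end_near.
Qed.

(** B1 is the periodic solution of the homogeneous equation which makes
G - q B1 orthogonal to all periodic solutions; it is zero when there are none.
Unlike an alternative with solvability conditions, this form applies to every
G. *)
Lemma hill_fredholm L G : smooth G -> per G -> exists B B1,
  [/\ smooth B, per B, smooth B1, per B1 & (forall t, derive1 (derive1 B1) t + hillQ q L t * B1 t = 0) /\
   (forall t, derive1 (derive1 B) t + hillQ q L t * B t + q t * B1 t = G t)].
Proof.
move=> sG pG; have [M M0 qM] := weight_bounded.
have cq := smooth_cont sq; have cG := smooth_cont sG.
have [y1 [d1 [a1 c1 s1]]] := hill_exists cq q0 M0 qM L 1 0.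
have [y2 [d2 [a2 c2 s2]]] := hill_exists cq q0 M0 qM L 0 1.
have cy1 := der_cont s1.1; have cy2 := der_cont s2.1.
have W t : y1 t * d2 t - d1 t * y2 t = 1 by rewrite (wronskian t 0 s1 s2) a1 c1 a2 c2 mulr1 mul0r subr0.
have cM f g : continuous f -> continuous g -> continuous (fun t => f t * g t).
  by move=> cf cg t; apply: cvgM; [exact: cf|exact: cg].
pose Gij u v := prim (fun t => q t * (u t * v t)) T.
have cq2 (u v : R -> R) : continuous u -> continuous v -> continuous (fun t => q t * (u t * v t)).
  by move=> cu cv; apply: (cM q (fun t => u t * v t)) => //; exact: cM.
have pos a c : (a != 0) || (c != 0) -> 0 < a * a * Gij y1 y1 + 2 * (a * c * Gij y1 y2) + c * c * Gij y2 y2.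
  move=> ac; have S := sol_comb a c s1 s2.
  have := weight_pos S; rewrite a1 c1 a2 c2 !mulr1 !mulr0 addr0 add0r => /(_ ac).
  rewrite (_ : prim _ T = a * a * Gij y1 y1 + 2 * (a * c * Gij y1 y2) + c * c * Gij y2 y2) //.
  rewrite (_ : (fun t => _) = (fun t => (a * a) * (q t * (y1 t * y1 t)) +
    1 * (2 * (a * c) * (q t * (y1 t * y2 t)) + (c * c) * (q t * (y2 t * y2 t))))); last first.
    by apply/funext => t; ring.
  rewrite primD; [|exact: cq2|]; last first.
    move=> t; apply: cvgD; apply: cvgM; (exact: cvg_cst || exact: cq2).
  rewrite primD; [|exact: cq2|exact: cq2].
  by rewrite /Gij; ring.
have [a [c [x [z [e1 e2 e3 e4]]]]] := periodic_data_solvable (prim (fun t => y1 t * G t) T) (prim (fun t => y2 t * G t) T) (W T) pos.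
pose B1 t := a * y1 t + c * y2 t; pose D1 t := a * d1 t + c * d2 t.
have S1 : sol (hillQ q L) B1 D1 := sol_comb a c s1 s2.
have cB1 : continuous B1 := der_cont S1.1.
have I1 := sol_inh_sol S1.
have sB1 : smooth B1 by have [] := inh_sol_smooth (@smooth_cst R 0) I1.
have pB1 : per B1.
  apply: (inh_sol_per _ I1); rewrite /B1 /D1 ?a1 ?c1 ?a2 ?c2 ?mulr1 ?mulr0 ?addr0 ?add0r; [by []| |].
    by rewrite -[RHS]e1; ring.
  by rewrite -[RHS]e2; ring.
pose G' t := G t - q t * B1 t.
have sG' : smooth G' by apply: smoothD => //; apply: smoothN; exact: smoothM.
have pG' : per G' by move=> t; rewrite /G' pG pq pB1.
have cG' := smooth_cont sG'.
have k1 : continuous (fun t => y1 t * G' t) by exact: cM.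
have k2 : continuous (fun t => y2 t * G' t) by exact: cM.
have [p10 dp1] := primP k1; have [p20 dp2] := primP k2.
set p1 := prim _ in p10 dp1; set p2 := prim _ in p20 dp2.
have p1T : p1 T = prim (fun t => y1 t * G t) T - (a * Gij y1 y1 + c * Gij y1 y2).
  rewrite /p1 (_ : (fun t => _) = (fun t => 1 * (y1 t * G t) + -1 * (a * (q t * (y1 t * y1 t)) + c * (q t * (y1 t * y2 t))))).
    rewrite primD; [|exact: cM|]; last first.
      by move=> t; apply: cvgD; apply: cvgM; (exact: cvg_cst || exact: cq2).
    rewrite primD; [|exact: cq2|exact: cq2].
    by rewrite /Gij; ring.
  by apply/funext => t; rewrite /G' /B1; ring.
have p2T : p2 T = prim (fun t => y2 t * G t) T - (a * Gij y1 y2 + c * Gij y2 y2).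
  rewrite /p2 (_ : (fun t => _) = (fun t => 1 * (y2 t * G t) + -1 * (a * (q t * (y1 t * y2 t)) + c * (q t * (y2 t * y2 t))))).
    rewrite primD; [|exact: cM|]; last first.
      by move=> t; apply: cvgD; apply: cvgM; (exact: cvg_cst || exact: cq2).
    rewrite primD; [|exact: cq2|exact: cq2].
    by rewrite /Gij; ring.
  by apply/funext => t; rewrite /G' /B1; ring.
rewrite -p1T in e4; rewrite -p2T in e3.
(* Variation of constants, with the initial data shifted by the values of the
   integrals at T, in which form the periodicity conditions are e3 and e4. *)
pose al := x + p2 T; pose be := z - p1 T.
pose B t := y2 t * p1 t - y1 t * p2 t + (al * y1 t + be * y2 t).
pose D t := d2 t * p1 t - d1 t * p2 t + (al * d1 t + be * d2 t).
have I : inh_sol G' L B D.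
  have [x1 x2] := s1; have [z1 z2] := s2.
  split.
    apply: der_ext (derD (derB (derM z1 dp1) (derM x1 dp2)) (derD (derZ al x1) (derZ be z1))) _ => t.
    by rewrite /D; ring.
  apply: der_ext (derD (derB (derM z2 dp1) (derM x2 dp2)) (derD (derZ al x2) (derZ be z2))) _ => t.
  rewrite /B -[in RHS](mul1r (G' t)) -(W t); ring.
exists B, B1; split => //.
- by have [] := inh_sol_smooth sG' I.
- apply: (inh_sol_per pG' I); rewrite /B /D p10 p20 ?a1 ?a2 ?c1 ?c2.
    transitivity (y1 T * x + y2 T * z); first by rewrite /al /be; ring.
    by rewrite e3 /al; ring.
  transitivity (d1 T * x + d2 T * z); first by rewrite /al /be; ring.
  by rewrite e4 /be; ring.
- split; first exact: inh_sol_derive I1.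
  by move=> t; rewrite (inh_sol_derive I) /G' subrK.
Qed.

(** The bound b is arbitrary, so the homogeneity of the first order field can
be as large as desired. *)
Lemma hill_eigen (b : R) : exists L y, [/\ b < L, smooth y, per y, exists t, y t != 0 &
  forall t, derive1 (derive1 y) t + hillQ q L t * y t = 0].
Proof.
have [M M0 qM] := weight_bounded.
have [L [y [d [bL L0 S [yT dT] nz]]]] := hill_periodic_eigen (smooth_cont sq) q0 M0 qM qpos b.
have I := sol_inh_sol S.
exists L, y; split => //.
- by have [] := inh_sol_smooth (@smooth_cst R 0) I.
- by apply: (inh_sol_per _ I).
- apply: contrapT => H.
  have yz t : y t = 0 by apply/eqP; apply: contrapT => /negP h; apply: H; exists t.
  have d0 : d 0 = 0 by rewrite -(derE 0 S.1) (_ : y = fun=> 0) ?derive1_cst //; apply/funext.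
  by move: nz; rewrite yz d0 eqxx.
- exact: inh_sol_derive I.
Qed.

End Fredholm.

(** * Sums of e^(k y) y^n F(t) *)

Section Cyl.
Variable R : realType.
Implicit Types (F G c : R -> R) (f g h : R -> R -> R) (y t k nu mu : R) (n p : nat).

Lemma fun2_ext f g : (forall y t, f y t = g y t) -> f = g.
Proof. by move=> H; apply/funext => y; apply/funext => t. Qed.

Definition mono k n F : R -> R -> R := fun y t => expR (k * y) * y ^+ n * F t.

(** The exponent bound nu controls the decay at y -> -oo, that is at the origin
of the plane; the powers of y are the logarithms produced by resonances. *)
Inductive cyl nu : (R -> R -> R) -> Prop :=
| cyl_mono k n F of nu <= k & smooth F & per F : cyl nu (mono k n F)
| cyl_add f g of cyl nu f & cyl nu g : cyl nu (fun y t => f y t + g y t).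

(** The partial derivatives are sealed behind sval, which keeps unification
from unfolding them inside iterated derivatives. *)
Lemma Dy_spec : {D : (R -> R -> R) -> R -> R -> R | forall f y t, D f y t = derive1 (fun x => f x t) y}.
Proof. by exists (fun f y t => derive1 (fun x => f x t) y). Qed.
Lemma Dt_spec : {D : (R -> R -> R) -> R -> R -> R | forall f y t, D f y t = derive1 (f y) t}.
Proof. by exists (fun f y t => derive1 (f y) t). Qed.
Definition Dy := sval Dy_spec.
Definition Dt := sval Dt_spec.
Lemma DyE f y t : Dy f y t = derive1 (fun x => f x t) y. Proof. exact: (svalP Dy_spec). Qed.
Lemma DtE f y t : Dt f y t = derive1 (f y) t. Proof. exact: (svalP Dt_spec). Qed.
Definition hasDy f df := forall t, der (fun y => f y t) (fun y => df y t).
Definition hasDt f df := forall y, der (f y) (df y).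

Lemma hasDyE f df : hasDy f df -> Dy f = df.
Proof. by move=> H; apply: fun2_ext => y t; rewrite DyE (derE y (H t)). Qed.
Lemma hasDtE f df : hasDt f df -> Dt f = df.
Proof. by move=> H; apply: fun2_ext => y t; rewrite DtE (derE t (H y)). Qed.
Lemma hasDyD f g df dg : hasDy f df -> hasDy g dg ->
  hasDy (fun y t => f y t + g y t) (fun y t => df y t + dg y t).
Proof. by move=> A B t; apply: derD; [exact: A|exact: B]. Qed.
Lemma hasDtD f g df dg : hasDt f df -> hasDt g dg ->
  hasDt (fun y t => f y t + g y t) (fun y t => df y t + dg y t).
Proof. by move=> A B y; apply: derD; [exact: A|exact: B]. Qed.
Lemma hasDyB f g df dg : hasDy f df -> hasDy g dg ->
  hasDy (fun y t => f y t - g y t) (fun y t => df y t - dg y t).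
Proof. by move=> A B t; apply: derB; [exact: A|exact: B]. Qed.
Lemma hasDtB f g df dg : hasDt f df -> hasDt g dg ->
  hasDt (fun y t => f y t - g y t) (fun y t => df y t - dg y t).
Proof. by move=> A B y; apply: derB; [exact: A|exact: B]. Qed.
Lemma hasDyM f g df dg : hasDy f df -> hasDy g dg ->
  hasDy (fun y t => f y t * g y t) (fun y t => df y t * g y t + f y t * dg y t).
Proof. by move=> A B t; apply: derM; [exact: A|exact: B]. Qed.
Lemma hasDyZ c f df : hasDy f df -> hasDy (fun y t => c t * f y t) (fun y t => c t * df y t).
Proof. by move=> A t; apply: derZ; exact: A. Qed.
Lemma hasDtZ c dc f df : der c dc -> hasDt f df ->
  hasDt (fun y t => c t * f y t) (fun y t => dc t * f y t + c t * df y t).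
Proof. by move=> C A y; apply: derM => //; exact: A. Qed.
Lemma hasDy_ext f df dg : hasDy f df -> (forall y t, df y t = dg y t) -> hasDy f dg.
Proof. by move=> H /fun2_ext <-. Qed.
Lemma hasDy_exp k : hasDy (fun y _ => expR (k * y)) (fun y _ => k * expR (k * y)).
Proof. by move=> t; exact: der_expk. Qed.

Lemma mono_hasDy k n F : hasDy (mono k n F)
  (fun y t => mono k n (fun t => k * F t) y t + mono k n.-1 (fun t => n%:R * F t) y t).
Proof.
move=> t; have D := derM (derM (der_expk k) (der_pow n)) (der_cst (F t)).
by apply: der_ext D _ => y; rewrite /mono; ring.
Qed.

Lemma mono_hasDt k n F : (forall x, derivable F x 1) ->
  hasDt (mono k n F) (mono k n (derive1 F)).
Proof. by move=> dF y; apply: derZ; exact: der_derive1. Qed.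

Lemma cyl_ext nu f g : (forall y t, f y t = g y t) -> cyl nu g -> cyl nu f.
Proof. by move=> /fun2_ext ->. Qed.

Lemma cylW nu mu f : mu <= nu -> cyl nu f -> cyl mu f.
Proof.
move=> h; elim=> [k n F nk sF pF|f1 f2 _ IH1 _ IH2]; last exact: cyl_add.
by apply: cyl_mono => //; apply: le_trans nk.
Qed.

Lemma smooth_der1 F : smooth F -> forall x, derivable F x 1.
Proof. by move=> s; exact: (s 1%N).1. Qed.

Lemma perM F G : per F -> per G -> per (fun t => F t * G t).
Proof. by move=> a b t; rewrite a b. Qed.
Lemma per_cst k : per (fun=> k). Proof. by []. Qed.

Lemma cyl_hasDy nu f : cyl nu f -> hasDy f (Dy f) /\ cyl nu (Dy f).
Proof.
elim=> [k n F nk sF pF|f1 f2 _ [H1 C1] _ [H2 C2]].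
  have H := mono_hasDy k n F; rewrite (hasDyE H); split=> //.
  by apply: cyl_add; apply: cyl_mono => //; (apply: smoothM => //; exact: smooth_cst) || exact: perM.
have H := hasDyD H1 H2; rewrite (hasDyE H); split=> //; exact: cyl_add.
Qed.

Lemma cyl_hasDt nu f : cyl nu f -> hasDt f (Dt f) /\ cyl nu (Dt f).
Proof.
elim=> [k n F nk sF pF|f1 f2 _ [H1 C1] _ [H2 C2]].
  have H := @mono_hasDt k n F (smooth_der1 sF); rewrite (hasDtE H); split=> //.
  by apply: cyl_mono => //; [exact: smooth_derive1|apply: per_derive1 => //; exact: smooth_der1].
have H := hasDtD H1 H2; rewrite (hasDtE H); split=> //; exact: cyl_add.
Qed.

Lemma cylDy nu f : cyl nu f -> cyl nu (Dy f). Proof. by case/cyl_hasDy. Qed.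
Lemma cylDt nu f : cyl nu f -> cyl nu (Dt f). Proof. by case/cyl_hasDt. Qed.
Lemma cyl_dy nu f : cyl nu f -> hasDy f (Dy f). Proof. by case/cyl_hasDy. Qed.
Lemma cyl_dt nu f : cyl nu f -> hasDt f (Dt f). Proof. by case/cyl_hasDt. Qed.

(** Checked on monomials, where both sides are explicit. *)
Lemma cyl_DyDt nu f : cyl nu f -> Dy (Dt f) = Dt (Dy f).
Proof.
elim=> [k n F nk sF pF|f1 f2 c1 H1 c2 H2].
  rewrite (hasDtE (@mono_hasDt k n F (smooth_der1 sF))) (hasDyE (mono_hasDy k n F)) (hasDyE (mono_hasDy k n _)).
  have dF := smooth_is_der sF.
  have dk (x : R) : derive1 (fun t => x * F t) = (fun t => x * derive1 F t) := derEf (derZ x dF).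
  have H (x : R) : forall t, derivable (fun t => x * F t) t 1 by move=> t; exact: der_derivable (derZ x dF).
  by rewrite (hasDtE (hasDtD (@mono_hasDt k n _ (H k)) (@mono_hasDt k n.-1 _ (H n%:R)))) !dk.
rewrite (hasDtE (hasDtD (cyl_dt c1) (cyl_dt c2))) (hasDyE (hasDyD (cyl_dy c1) (cyl_dy c2))).
rewrite (hasDyE (hasDyD (cyl_dy (cylDt c1)) (cyl_dy (cylDt c2)))).
by rewrite (hasDtE (hasDtD (cyl_dt (cylDy c1)) (cyl_dt (cylDy c2)))) H1 H2.
Qed.

Lemma cylM nu mu f g : cyl nu f -> cyl mu g -> cyl (nu + mu) (fun y t => f y t * g y t).
Proof.
elim=> [k n F nk sF pF|f1 f2 _ H1 _ H2] cg; last first.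
  by apply: cyl_ext (cyl_add (H1 cg) (H2 cg)) => y t; rewrite mulrDl.
elim: cg => [k' n' G nk' sG pG|g1 g2 _ H1 _ H2]; last first.
  by apply: cyl_ext (cyl_add H1 H2) => y t; rewrite mulrDr.
have H : cyl (nu + mu) (mono (k + k') (n + n') (fun t => F t * G t)).
  by apply: cyl_mono; [exact: lerD|exact: smoothM|exact: perM].
by apply: cyl_ext H => y t; rewrite /mono mulrDl expRD exprD; ring.
Qed.

Lemma cyl_exp k : cyl k (fun y _ => expR (k * y)).
Proof.
have H : cyl k (mono k 0 (fun=> 1)) by apply: cyl_mono => //; exact: smooth_cst.
by apply: cyl_ext H => y t; rewrite /mono expr0 !mulr1.
Qed.

Lemma cyl_fun c : smooth c -> per c -> cyl 0 (fun _ t => c t).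
Proof.
move=> sc pc; have H : cyl 0 (mono 0 0 c) by exact: cyl_mono.
by apply: cyl_ext H => y t; rewrite /mono expr0 mul0r expR0 !mul1r.
Qed.

Lemma cylZ nu c f : smooth c -> per c -> cyl nu f -> cyl nu (fun y t => c t * f y t).
Proof. by move=> sc pc cf; have := cylM (cyl_fun sc pc) cf; rewrite add0r. Qed.

Lemma cylC nu k f : cyl nu f -> cyl nu (fun y t => k * f y t).
Proof. by apply: (@cylZ nu (fun=> k)); [exact: smooth_cst|exact: per_cst]. Qed.

Lemma cylN nu f : cyl nu f -> cyl nu (fun y t => - f y t).
Proof. by move=> cf; apply: cyl_ext (cylC (-1) cf) => y t; rewrite mulN1r. Qed.

Lemma cylB nu f g : cyl nu f -> cyl nu g -> cyl nu (fun y t => f y t - g y t).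
Proof. by move=> cf cg; apply: cyl_add => //; exact: cylN. Qed.

Lemma cyl0 nu : cyl nu (fun _ _ => 0).
Proof.
have H : cyl nu (mono nu 0 (fun=> 0)) by apply: cyl_mono => //; exact: smooth_cst.
by apply: cyl_ext H => y t; rewrite /mono mulr0.
Qed.

Lemma cylE nu mu k f : mu = k + nu -> cyl nu f -> cyl mu (fun y t => expR (k * y) * f y t).
Proof. by move=> -> cf; exact: cylM (cyl_exp k) cf. Qed.

Lemma cyl_per nu f y t : cyl nu f -> f y (t + 2 * pi) = f y t.
Proof.
elim=> [k n F nk sF pF|f1 f2 _ H1 _ H2]; last by rewrite H1 H2.
by rewrite /mono pF.
Qed.

Lemma cyl_perf nu f y : cyl nu f -> per (f y).
Proof. by move=> cf t; exact: cyl_per cf. Qed.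

(** A power of y is absorbed by an arbitrarily small loss in the exponent. *)
Lemma exp_pow_bound n (e : R) : 0 < e -> exists2 C, 0 <= C & forall y, y <= 0 -> `|y| ^+ n * expR (e * y) <= C.
Proof.
move=> e0.
have H (x : R) : 0 <= x -> x ^+ n <= (n`!%:R + 1) * expR x.
  case: n => [|n] x0.
    by rewrite expr0 fact0; have : 1 <= expR x; [rewrite -expR0 ler_expR|lra].
  have f0 : 0 < n.+1`!%:R :> R by rewrite ltr0n fact_gt0.
  have := expR_ge1Dxn n x0; have e1 := expR_gt0 x => h.
  have : x ^+ n.+1 / n.+1`!%:R <= expR x by lra.
  rewrite ler_pdivrMr // => h2; apply: le_trans h2 _; rewrite mulrC ler_pM2r //; lra.
have C0 : 0 <= (n`!%:R + 1) / e ^+ n.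
  by rewrite divr_ge0 ?addr_ge0 // exprn_ge0 // ltW.
exists ((n`!%:R + 1) / e ^+ n) => // y y0.
have en : 0 < e ^+ n by rewrite exprn_gt0.
rewrite ler_pdivlMr // mulrAC -exprMn.
have ey : 0 <= `|y| * e by rewrite mulr_ge0 // ltW.
have := H _ ey; have -> : e * y = - (`|y| * e) by rewrite ler0_norm //; ring.
have e1 := expR_gt0 (- (`|y| * e)).
move=> /(ler_wpM2r (ltW e1)); rewrite -mulrA expRxMexpNx_1 mulr1.
by [].
Qed.

Lemma cyl_decay nu mu f : mu < nu -> cyl nu f -> exists2 C, 0 <= C &
  forall y t, y <= 0 -> `|f y t| <= C * expR (mu * y).
Proof.
move=> h; elim=> [k n F nk sF pF|f1 f2 _ [C1 C10 H1] _ [C2 C20 H2]]; last first.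
  exists (C1 + C2) => [|y t y0]; first exact: addr_ge0.
  by apply: le_trans (ler_normD _ _) _; rewrite mulrDl lerD // ?H1 ?H2.
have [M M0 HM] := per_bounded (smooth_cont sF) pF.
have km : 0 < k - mu by rewrite subr_gt0 (lt_le_trans h).
have [C C0 HC] := exp_pow_bound n km.
exists (C * M) => [|y t y0]; first by rewrite mulr_ge0 // ltW.
rewrite /mono !normrM normrX (ger0_norm (expR_ge0 _)).
have -> : k * y = mu * y + (k - mu) * y by ring.
rewrite expRD -!mulrA [expR (mu * y) * _]mulrC mulrA [leRHS]mulrA ler_pM2r ?expR_gt0 //.
rewrite ler_pM ?mulr_ge0 ?expR_ge0 ?exprn_ge0 //.
by rewrite mulrC; exact: HC.
Qed.

(** A function independent of y that tends to 0 as y -> -oo is zero.  This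
replaces integration constants: identities in the class may be checked after
differentiation in y. *)
Lemma cyl_inj0 nu f : 0 < nu -> cyl nu f -> (forall y t, Dy f y t = 0) -> forall y t, f y t = 0.
Proof.
move=> nu0 cf H y t.
have nu2 : nu / 2 < nu by lra.
have [C C0 HC] := cyl_decay nu2 cf.
have K x : f x t = f y t.
  by apply: (@der0_cst R (fun x => f x t)); apply: der_ext (cyl_dy cf t) _ => z; exact: H.
apply/eqP; rewrite -normr_le0; apply/ler_addgt0Pr => e e0; rewrite add0r.
(* At this x the decay estimate is at most e, since e^(-s) <= 1 / (1 + s). *)
pose x := Num.min 0 (- (C / e) / (nu / 2)).
have x0 : x <= 0 by rewrite ge_min lexx.
rewrite -(K x); apply: le_trans (HC x t x0) _.
have nu2' : 0 < nu / 2 by rewrite divr_gt0.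
have hx : nu / 2 * x <= - (C / e).
  rewrite -ler_pdivlMl // mulrC; by rewrite ge_min lexx orbT.
have Ce : 0 <= C / e by rewrite divr_ge0 // ltW.
have : expR (nu / 2 * x) <= (1 + C / e)^-1.
  apply: (@le_trans _ _ (expR (- (C / e)))); first by rewrite ler_expR.
  by rewrite expRN lef_pV2 ?posrE ?expR_gt0 ?expR_ge1Dx // ltr_pwDl.
move=> /(ler_wpM2l C0) h; apply: le_trans h _.
rewrite ler_pdivrMr ?ltr_pwDl // mulrDr mulr1 [e * _]mulrC divfK ?gt_eqF //.
by rewrite lerDr ltW.
Qed.

(** Repeated integration by parts on e^(k y) y^n, possible because k > 0. *)
Lemma cyl_prim nu f : 0 < nu -> cyl nu f -> exists2 g, cyl nu g & Dy g = f.
Proof.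
move=> nu0; elim=> [k n F nk sF pF|f1 f2 _ [g1 c1 H1] _ [g2 c2 H2]]; last first.
  exists (fun y t => g1 y t + g2 y t); first exact: cyl_add.
  by rewrite (hasDyE (hasDyD (cyl_dy c1) (cyl_dy c2))) H1 H2.
have k0 : k != 0 by rewrite gt_eqF // (lt_le_trans nu0).
elim: n F sF pF => [|n IH] F sF pF.
  exists (mono k 0 (fun t => k^-1 * F t)).
    by apply: cyl_mono => //; [apply: smoothM => //; exact: smooth_cst|exact: perM].
  rewrite (hasDyE (mono_hasDy _ _ _)); apply: fun2_ext => y t; rewrite /mono.
  by rewrite mulVKf // mul0r mulr0 addr0.
have [||g cg Hg] := IH (fun t => - (n.+1%:R / k) * F t).
- by apply: smoothM => //; exact: smooth_cst.
- by move=> t; rewrite pF.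
have cm : cyl nu (mono k n.+1 (fun t => k^-1 * F t)).
  by apply: cyl_mono => //; [apply: smoothM => //; exact: smooth_cst|exact: perM].
exists (fun y t => mono k n.+1 (fun t => k^-1 * F t) y t + g y t); first exact: cyl_add.
rewrite (hasDyE (hasDyD (mono_hasDy _ _ _) (cyl_dy cg))) Hg; apply: fun2_ext => y t.
by rewrite /mono /=; field.
Qed.

(** The chain rule along a curve; again only monomials have to be examined. *)
Lemma cyl_chain nu f (Y T : R -> R) (s dY dT : R) : cyl nu f -> is_derive s 1 Y dY -> is_derive s 1 T dT ->
  is_derive s 1 (fun x => f (Y x) (T x)) (Dy f (Y s) (T s) * dY + Dt f (Y s) (T s) * dT).
Proof.
elim=> [k n F nk sF pF|f1 f2 c1 H1 c2 H2] hY hT; last first.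
  have := is_deriveD (H1 hY hT) (H2 hY hT) => D; apply: (is_derive_eq D).
  rewrite (hasDtE (hasDtD (cyl_dt c1) (cyl_dt c2))) (hasDyE (hasDyD (cyl_dy c1) (cyl_dy c2))); ring.
have D1 := @is_derive1_comp R _ Y s _ _ (derM (der_expk k) (der_pow n) (Y s)) hY.
have D2 := @is_derive1_comp R F T s _ _ (smooth_is_der sF (T s)) hT.
have D := is_deriveM D1 D2; apply: (is_derive_eq D).
rewrite (hasDtE (@mono_hasDt k n F (smooth_der1 sF))) (hasDyE (mono_hasDy k n F)).
by rewrite /GRing.scale /= /mono; ring.
Qed.

Lemma cyl_cvg nu f (X : Type) (FF : set_system X) (Y T : X -> R) (y0 t0 : R) : Filter FF -> cyl nu f ->
  Y x @[x --> FF] --> y0 -> T x @[x --> FF] --> t0 -> f (Y x) (T x) @[x --> FF] --> f y0 t0.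
Proof.
move=> fil; elim=> [k n F nk sF pF|f1 f2 c1 H1 c2 H2] hY hT; last first.
  by apply: cvgD; [exact: H1|exact: H2].
apply: cvgM.
  have c := der_cont (derM (der_expk k) (der_pow n)).
  exact: (cvg_comp _ _ hY (c y0)).
have c : continuous F := smooth_cont sF.
exact: (cvg_comp _ _ hT (c t0)).
Qed.

End Cyl.

(** * The bending equations in the variables (y, t) *)

Section Bend.
Variable R : realType.
Variables (m : R) (E q : R -> R).
Hypotheses (m2 : 2 <= m) (sE : smooth E) (pE : per E) (E0 : forall t, 0 < E t).
Hypotheses (sq : smooth q) (pq : per q) (q0 : forall t, 0 <= q t).
Hypothesis qpos : exists2 t, 0 < t < 2 * pi & 0 < q t.
Hypothesis HE : forall t, derive1 (derive1 E) t =
  (1 - (m - 1) * q t + 2 * (derive1 E t / E t) ^+ 2) * E t.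

Let En t : E t != 0. Proof. by rewrite gt_eqF. Qed.
Let dE := derive1 E.
Let HdE : der E dE. Proof. exact: smooth_is_der. Qed.
Let sdE : smooth dE. Proof. exact: smooth_derive1. Qed.
Let pdE : per dE. Proof. by apply: per_derive1 => //; exact: smooth_der1. Qed.
Let HddE : der dE (fun t => (1 - (m - 1) * q t + 2 * (dE t / E t) ^+ 2) * E t).
Proof. by apply: der_ext (smooth_is_der sdE) _ => t; exact: HE. Qed.

(** The coefficients of gamma'' = frame1 gamma + frame2 gamma' for the curve
gamma = E (cos, sin). *)
Definition frame1 t := - (m - 1) * q t.
Definition frame2 t := 2 * (dE t / E t).

Lemma frame1_smooth : smooth frame1. Proof. by apply: smoothM => //; exact: smooth_cst. Qed.
Lemma frame1_per : per frame1. Proof. by move=> t; rewrite /frame1 pq. Qed.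
Lemma frame2_smooth : smooth frame2.
Proof. by apply: smoothM; [exact: smooth_cst|apply: smoothM => //; exact: smoothV]. Qed.
Lemma frame2_per : per frame2. Proof. by move=> t; rewrite /frame2 pdE pE. Qed.

(** The operator acting on the vertical component of a bending field. *)
Definition bend_op (w : R -> R -> R) : R -> R -> R := fun y t =>
  Dt (Dt w) y t - frame2 t * Dt w y t + q t * (Dy (Dy w) y t + (m - 2) * Dy w y t).

Lemma bend_op_add nu f g y t : cyl nu f -> cyl nu g ->
  bend_op (fun y t => f y t + g y t) y t = bend_op f y t + bend_op g y t.
Proof.
move=> cf cg; rewrite /bend_op.
rewrite (hasDtE (hasDtD (cyl_dt cf) (cyl_dt cg))) (hasDyE (hasDyD (cyl_dy cf) (cyl_dy cg))).
rewrite (hasDtE (hasDtD (cyl_dt (cylDt cf)) (cyl_dt (cylDt cg)))).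
rewrite (hasDyE (hasDyD (cyl_dy (cylDy cf)) (cyl_dy (cylDy cg)))).
by ring.
Qed.

Definition bend_op_mono (l : R) (A : R -> R) t := derive1 (derive1 A) t - frame2 t * derive1 A t
  + q t * (l * (l + m - 2)) * A t.

(** Differentiating y^p produces the two lower order terms; the one with
p q A (2 l + m - 2) is the term that resolves resonances. *)
Lemma bend_op_monoE l p A y t : smooth A -> bend_op (mono l p A) y t =
  mono l p (bend_op_mono l A) y t + mono l p.-1 (fun t => p%:R * (2 * l + m - 2) * (q t * A t)) y t
  + mono l p.-2 (fun t => p%:R * p.-1%:R * (q t * A t)) y t.
Proof.
move=> sA; have sA' := smooth_derive1 sA.
rewrite /bend_op (hasDtE (@mono_hasDt R l p A (smooth_der1 sA))).
rewrite (hasDtE (@mono_hasDt R l p _ (smooth_der1 sA'))).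
rewrite (hasDyE (mono_hasDy l p A)).
rewrite (hasDyE (hasDyD (mono_hasDy l p _) (mono_hasDy l p.-1 _))).
by rewrite /mono /bend_op_mono; ring.
Qed.

(** The substitution A = E B removes the first order term of bend_op_mono and
turns it into the Hill operator with parameter
l^2 + (m - 2) l - (m - 1) = (l - 1) (l + m - 1). *)
Lemma bend_op_fredholm l G : smooth G -> per G -> exists A A1,
  [/\ smooth A, per A, smooth A1, per A1 & (forall t, bend_op_mono l A1 t = 0) /\
   (forall t, bend_op_mono l A t + q t * A1 t = G t)].
Proof.
move=> sG pG.
have sG' : smooth (fun t => G t / E t) by apply: smoothM => //; exact: smoothV.
have pG' : per (fun t => G t / E t) by move=> t; rewrite pG pE.
have [B [B1 [sB pB sB1 pB1 [H1 H2]]]] := hill_fredholm sq pq q0 qpos (l ^+ 2 + (m - 2) * l - (m - 1)) sG' pG'.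
have F A t : smooth A -> bend_op_mono l (fun t => E t * A t) t =
   E t * (derive1 (derive1 A) t + hillQ q (l ^+ 2 + (m - 2) * l - (m - 1)) t * A t).
  move=> sA; have dA := smooth_is_der sA; have ddA := smooth_is_der (smooth_derive1 sA).
  rewrite /bend_op_mono (derEf (derM HdE dA)) (derE t (derD (derM HddE dA) (derM HdE ddA))) /frame2 /hillQ.
  by field.
exists (fun t => E t * B t), (fun t => E t * B1 t); split.
- exact: smoothM.
- exact: perM.
- exact: smoothM.
- exact: perM.
split=> t; first by rewrite F // H1 mulr0.
rewrite F // mulrCA -mulrDr H2 mulrC divfK //.
Qed.

(** The term y^p G is produced by y^p A + c y^(p+1) A1, up to terms of degree
less than p in y, to which induction applies.  The constant c exists because
2 l + m - 2 > 0. *)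
Lemma bend_op_solve_mono l p G : 0 < l -> smooth G -> per G ->
  exists2 w, cyl l w & forall y t, bend_op w y t = mono l p G y t.
Proof.
move=> l0; elim/ltn_ind: p G => p IH G sG pG.
have [A [A1 [sA pA sA1 pA1 [H1 H2]]]] := bend_op_fredholm l sG pG.
have d0 : 2 * l + m - 2 != 0 by rewrite gt_eqF //; have := m2; lra.
have p10 : p.+1%:R != 0 :> R by rewrite pnatr_eq0.
have [c cp] : exists c : R, c * (p.+1%:R * (2 * l + m - 2)) = 1.
  by exists (p.+1%:R * (2 * l + m - 2))^-1; rewrite mulVf // mulf_neq0.
have sc k (F : R -> R) : smooth F -> smooth (fun t => k * F t) by move=> sF; apply: smoothM => //; exact: smooth_cst.
have c1 : cyl l (mono l p A) by exact: cyl_mono.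
have scA1 : smooth (fun t => c * A1 t) by exact: sc.
have c2 : cyl l (mono l p.+1 (fun t => c * A1 t)) by apply: cyl_mono => // t; rewrite pA1.
have L1 t : bend_op_mono l (fun t => c * A1 t) t = 0.
  have dA := smooth_is_der sA1; have ddA := smooth_is_der (smooth_derive1 sA1).
  rewrite /bend_op_mono (derEf (derZ c dA)) (derE t (derZ c ddA)).
  by transitivity (c * bend_op_mono l A1 t); [rewrite /bend_op_mono; ring|rewrite H1 mulr0].
have K2 y t : bend_op (mono l p.+1 (fun t => c * A1 t)) y t =
  mono l p (fun t => q t * A1 t) y t + mono l p.-1 (fun t => p.+1%:R * p%:R * c * (q t * A1 t)) y t.
  rewrite bend_op_monoE //= /mono L1 mulr0 add0r.
  have -> : p.+1%:R * (2 * l + m - 2) * (q t * (c * A1 t)) = q t * A1 t.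
    by transitivity (c * (p.+1%:R * (2 * l + m - 2)) * (q t * A1 t)); [ring|rewrite cp mul1r].
  by ring.
case: p IH c1 c2 K2 {p10 cp} => [|p] IH c1 c2 K2.
  exists (fun y t => mono l 0 A y t + mono l 1 (fun t => c * A1 t) y t); first exact: cyl_add.
  move=> y t; rewrite (bend_op_add _ _ c1 c2) K2 bend_op_monoE // /mono -H2 /=; ring.
have sqA : smooth (fun t => q t * A t) by exact: smoothM.
have sqA1 : smooth (fun t => q t * A1 t) by exact: smoothM.
have [||w1 cw1 Hw1] := IH p (ltnSn p) (fun t => - (p.+1%:R * (2 * l + m - 2)) * (q t * A t) + - (p.+2%:R * p.+1%:R * c) * (q t * A1 t)).
- by apply: smoothD; exact: sc.
- by move=> t; rewrite pq pA pA1.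
have [||w2 cw2 Hw2] := IH p.-1 (leq_ltn_trans (leq_pred p) (ltnSn p)) (fun t => - (p.+1%:R * p%:R) * (q t * A t)).
- exact: sc.
- by move=> t; rewrite pq pA.
exists (fun y t => (mono l p.+1 A y t + mono l p.+2 (fun t => c * A1 t) y t) + (w1 y t + w2 y t)).
  by apply: cyl_add; exact: cyl_add.
move=> y t; rewrite (bend_op_add _ _ (cyl_add c1 c2) (cyl_add cw1 cw2)) (bend_op_add _ _ c1 c2) (bend_op_add _ _ cw1 cw2).
by rewrite K2 bend_op_monoE // Hw1 Hw2 /mono -H2 /=; ring.
Qed.

Lemma bend_op_solve nu F : 0 < nu -> cyl nu F -> exists2 w, cyl nu w & forall y t, bend_op w y t = F y t.
Proof.
move=> nu0; elim=> [k n G nk sG pG|f g _ [w1 c1 H1] _ [w2 c2 H2]].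
  have k0 : 0 < k by apply: lt_le_trans nk.
  have [w cw Hw] := bend_op_solve_mono n k0 sG pG.
  by exists w => //; exact: cylW cw.
exists (fun y t => w1 y t + w2 y t); first exact: cyl_add.
by move=> y t; rewrite (bend_op_add _ _ c1 c2) H1 H2.
Qed.

(** Given a periodic eigenvalue L, the exponent l is the positive root of
l^2 + (m - 2) l - (m - 1) = L, which is large with L. *)
Lemma bend_op_kernel (N : R) : 0 <= N -> exists l A, [/\ N <= l, smooth A, per A, exists t, A t != 0 &
  forall y t, bend_op (mono l 0 A) y t = 0].
Proof.
move=> N0.
have [L [B [bL sB pB [t0 Bt0] HB]]] := hill_eigen sq pq q0 qpos ((2 * N + m) ^+ 2).
pose s := Num.sqrt (m ^+ 2 + 4 * L).
have L0 : 0 <= L by apply: le_trans (ltW bL); exact: sqr_ge0.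
have a0 : 0 <= m ^+ 2 + 4 * L by apply: addr_ge0; [exact: sqr_ge0|exact: mulr_ge0].
have ss : s ^+ 2 = m ^+ 2 + 4 * L by rewrite sqr_sqrtr.
have sN : 2 * N + m <= s.
  have dgam0 : 0 <= 2 * N + m by have := m2; lra.
  rewrite -(@ler_pXn2r _ 2) ?nnegrE ?sqrtr_ge0 // ss.
  have := sqr_ge0 m; lra.
pose l := (2 - m + s) / 2.
have lL : l ^+ 2 + (m - 2) * l - (m - 1) = L.
  have -> : l ^+ 2 + (m - 2) * l - (m - 1) = (s ^+ 2 - m ^+ 2) / 4 by rewrite /l; field.
  by rewrite ss; field.
have dB := smooth_is_der sB; have ddB := smooth_is_der (smooth_derive1 sB).
exists l, (fun t => E t * B t); split.
- by rewrite /l; have := m2; lra.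
- exact: smoothM.
- exact: perM.
- by exists t0; rewrite mulf_neq0.
- move=> y t; rewrite bend_op_monoE; last exact: smoothM.
  have -> : mono l 0 (bend_op_mono l (fun t => E t * B t)) y t = 0.
    rewrite /mono; have -> : bend_op_mono l (fun t => E t * B t) t = 0; last by rewrite mulr0.
    rewrite /bend_op_mono (derEf (derM HdE dB)) (derE t (derD (derM HddE dB) (derM HdE ddB))) /frame2.
    transitivity (E t * (derive1 (derive1 B) t + hillQ q L t * B t)); last by rewrite HB mulr0.
    by rewrite /hillQ -lL; field.
  by rewrite /mono; ring.
Qed.

(** Components of gamma = E (cos, sin) and of its derivative. *)
Definition gam0 t := E t * cos t.
Definition gam1 t := E t * sin t.
Definition dgam0 t := dE t * cos t - E t * sin t.
Definition dgam1 t := dE t * sin t + E t * cos t.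

Lemma der_gam0 : der gam0 dgam0.
Proof. by apply: der_ext (derM HdE (@der_cos R)) _ => t; rewrite /dgam0; ring. Qed.
Lemma der_gam1 : der gam1 dgam1.
Proof. by apply: der_ext (derM HdE (@der_sin R)) _ => t; rewrite /dgam1; ring. Qed.
Lemma der_dgam0 : der dgam0 (fun t => frame1 t * gam0 t + frame2 t * dgam0 t).
Proof.
apply: der_ext (derB (derM HddE (@der_cos R)) (derM HdE (@der_sin R))) _ => t.
by rewrite /frame1 /frame2 /gam0 /dgam0; field.
Qed.
Lemma der_dgam1 : der dgam1 (fun t => frame1 t * gam1 t + frame2 t * dgam1 t).
Proof.
apply: der_ext (derD (derM HddE (@der_sin R)) (derM HdE (@der_cos R))) _ => t.
by rewrite /frame1 /frame2 /gam1 /dgam1; field.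
Qed.
Lemma det_gam t : gam0 t * dgam1 t - gam1 t * dgam0 t = E t ^+ 2.
Proof.
rewrite /gam0 /gam1 /dgam0 /dgam1 -[RHS]mulr1 -(cos2Dsin2 t); ring.
Qed.
Lemma gam0_smooth : smooth gam0. Proof. by apply: smoothM => //; exact: smooth_cos. Qed.
Lemma gam1_smooth : smooth gam1. Proof. by apply: smoothM => //; exact: smooth_sin. Qed.
Lemma dgam0_smooth : smooth dgam0. Proof. by move=> n; have [_] := gam0_smooth n.+1; rewrite (derEf der_gam0). Qed.
Lemma dgam1_smooth : smooth dgam1. Proof. by move=> n; have [_] := gam1_smooth n.+1; rewrite (derEf der_gam1). Qed.
Lemma gam0_per : per gam0. Proof. by move=> t; rewrite /gam0 pE per_cos. Qed.
Lemma gam1_per : per gam1. Proof. by move=> t; rewrite /gam1 pE per_sin. Qed.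
Lemma dgam0_per : per dgam0. Proof. by move=> t; rewrite /dgam0 pdE pE per_cos per_sin. Qed.
Lemma dgam1_per : per dgam1. Proof. by move=> t; rewrite /dgam1 pdE pE per_cos per_sin. Qed.

(** What the compatibility condition for a and c leaves of the right-hand
sides; the operator bend_op on w comes from the terms with w. *)
Definition bend_rhs (A C2 D : R -> R -> R) : R -> R -> R :=
  let a := fun y t => expR (- 1 * y) * A y t in
  let c := fun y t => expR (- 1 * y) * C2 y t in
  let d := fun y t => expR (- 1 * y) * D y t in
  fun y t => Dy (Dt c) y t - Dt (Dt a) y t - frame1 t * (Dy a y t - a y t)
   - frame2 t * (Dy c y t - Dt a y t) - (Dy (Dy d) y t - Dy d y t).

(** The scalar products of dR with dU in the directions of y and t: the
coefficients of dy^2, dy dt and dt^2, for R = (e^y gamma, e^(m y)). *)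
Definition bending_eqs (A C2 D u v w : R -> R -> R) := forall y t,
  [/\ expR y * (gam0 t * Dy u y t + gam1 t * Dy v y t) + m * expR (m * y) * Dy w y t = A y t,
      expR y * (gam0 t * Dt u y t + gam1 t * Dt v y t + (dgam0 t * Dy u y t + dgam1 t * Dy v y t))
        + m * expR (m * y) * Dt w y t = C2 y t
    & expR y * (dgam0 t * Dt u y t + dgam1 t * Dt v y t) = D y t].

(** Once w solves the scalar equation, a is a primitive in y of the first
equation and c solves c_y - c = G2 - a_t; the third equation holds by the
compatibility condition, and (u, v) is recovered from (a, c) by inverting the
frame (gamma, gamma'). *)
Lemma bend_from_w nu A C2 D w : 2 < nu -> cyl nu A -> cyl nu C2 -> cyl nu D -> cyl (nu - m) w ->
  (forall y t, m * (m - 1) * expR ((m - 1) * y) * bend_op w y t = bend_rhs A C2 D y t) ->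
  exists u v, [/\ cyl (nu - 1) u, cyl (nu - 1) v & bending_eqs A C2 D u v w].
Proof.
move=> nu2 cA cC cD cw Hw.
have sh k f (mu mu' : R) : mu' = k + mu -> cyl mu f -> cyl mu' (fun y t => expR (k * y) * f y t) by move=> e; exact: cylE.
pose e1 y t := expR (- 1 * y) * A y t; pose e2 y t := expR (- 1 * y) * C2 y t; pose e3 y t := expR (- 1 * y) * D y t.
have ce1 : cyl (nu - 1) e1 by apply: (sh _ _ _ _ _ cA); ring.
have ce2 : cyl (nu - 1) e2 by apply: (sh _ _ _ _ _ cC); ring.
have ce3 : cyl (nu - 1) e3 by apply: (sh _ _ _ _ _ cD); ring.
pose M (f : R -> R -> R) y t := m * (expR ((m - 1) * y) * f y t).
have cM f : cyl (nu - m) f -> cyl (nu - 1) (M f) by move=> cf; apply: cylC; apply: (sh _ _ _ _ _ cf); ring.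
have DyM f mu : cyl mu f -> hasDy (M f) (fun y t => (m - 1) * M f y t + M (Dy f) y t).
  move=> cf; apply: hasDy_ext (hasDyZ (fun=> m) (hasDyM (hasDy_exp (m - 1)) (cyl_dy cf))) _ => y t.
  by rewrite /M; ring.
have DtM f mu : cyl mu f -> hasDt (M f) (M (Dt f)).
  move=> cf y; apply: derZ; apply: derZ; exact: (cyl_dt cf).
pose G1 y t := e1 y t - M (Dy w) y t.
pose G2 y t := e2 y t - M (Dt w) y t.
have cwy := cylDy cw; have cwt := cylDt cw.
have cG1 : cyl (nu - 1) G1 by apply: cylB => //; exact: cM.
have cG2 : cyl (nu - 1) G2 by apply: cylB => //; exact: cM.
have [a ca Ha] : exists2 a, cyl (nu - 1) a & Dy a = G1 by apply: cyl_prim => //; lra.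
have cta := cylDt ca.
have cG2a : cyl (nu - 1) (fun y t => G2 y t - Dt a y t) by exact: cylB.
have [c0 cc0 Hc0] : exists2 c0, cyl (nu - 2) c0 & Dy c0 = (fun y t => expR (- 1 * y) * (G2 y t - Dt a y t)).
  by apply: cyl_prim; [lra|apply: (sh _ _ _ _ _ cG2a); ring].
pose c y t := expR (1 * y) * c0 y t.
have cc : cyl (nu - 1) c by apply: (sh _ _ _ _ _ cc0); ring.
have Hc : Dy c = fun y t => c y t + (G2 y t - Dt a y t).
  apply: hasDyE; apply: hasDy_ext (hasDyM (hasDy_exp 1) (cyl_dy cc0)) _ => y t.
  have e : expR (1 * y) * expR (- 1 * y) = 1 by rewrite mul1r mulN1r expRxMexpNx_1.
  by rewrite Hc0 /c [X in _ + X]mulrA e; ring.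
(* X collects what remains of the third equation once c_y is eliminated; its
   derivative in y is the scalar equation for w. *)
pose X y t := (Dt G2 y t - Dt (Dt a) y t) - (frame1 t * G1 y t + frame2 t * G2 y t)
   + (frame2 t * Dt a y t + frame1 t * a y t) - (Dy e3 y t - e3 y t).
have cX : cyl (nu - 1) X.
  apply: cylB; last by apply: cylB => //; exact: cylDy.
  apply: cyl_add; last by apply: cyl_add; apply: cylZ => //;
    [exact: frame2_smooth|exact: frame2_per|exact: frame1_smooth|exact: frame1_per].
  apply: cylB; first by apply: cylB; exact: cylDt.
  by apply: cyl_add; apply: cylZ => //; [exact: frame1_smooth|exact: frame1_per|exact: frame2_smooth|exact: frame2_per].
have HX : hasDy X (fun y t => (Dy (Dt G2) y t - Dy (Dt (Dt a)) y t)
   - (frame1 t * Dy G1 y t + frame2 t * Dy G2 y t)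
   + (frame2 t * Dy (Dt a) y t + frame1 t * Dy a y t) - (Dy (Dy e3) y t - Dy e3 y t)).
  apply: hasDyB; last by apply: hasDyB; apply: cyl_dy ; [exact: cylDy ce3|exact: ce3].
  apply: hasDyD; last by apply: hasDyD; apply: hasDyZ; [exact: cyl_dy cta|exact: cyl_dy ca].
  apply: hasDyB; first by apply: hasDyB; [exact: cyl_dy (cylDt cG2)|exact: cyl_dy (cylDt cta)].
  by apply: hasDyD; apply: hasDyZ; [exact: cyl_dy cG1|exact: cyl_dy cG2].
have cwyt := cylDt cwy; have cwtt := cylDt cwt.
have X0 : forall y t, X y t = 0.
  apply: (@cyl_inj0 R (nu - 1)) => //; first by lra.
  move=> y t; rewrite (hasDyE HX).
  rewrite (cyl_DyDt cta) (cyl_DyDt ca) Ha.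
  rewrite (hasDtE (hasDtB (cyl_dt ce2) (DtM _ _ cwt))).
  rewrite (hasDyE (hasDyB (cyl_dy (cylDt ce2)) (DyM _ _ cwtt))).
  rewrite (hasDtE (hasDtB (cyl_dt ce1) (DtM _ _ cwy))).
  rewrite (hasDtE (hasDtB (cyl_dt (cylDt ce1)) (DtM _ _ cwyt))).
  rewrite (hasDyE (hasDyB (cyl_dy ce1) (DyM _ _ cwy))).
  rewrite (hasDyE (hasDyB (cyl_dy ce2) (DyM _ _ cwt))).
  rewrite (cyl_DyDt cwt) (cyl_DyDt cw).
  pose S := Dy (Dt e2) y t - Dt (Dt e1) y t - frame1 t * (Dy e1 y t - e1 y t) -
    frame2 t * (Dy e2 y t - Dt e1 y t) - (Dy (Dy e3) y t - Dy e3 y t).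
  have HS : m * (m - 1) * expR ((m - 1) * y) * bend_op w y t = S := Hw y t.
  transitivity (S - m * (m - 1) * expR ((m - 1) * y) * bend_op w y t); last by rewrite HS subrr.
  by rewrite /S /bend_op /G1 /M /frame1; ring.
(* HH is the defect of the third equation.  It satisfies HH_y - HH = X = 0, so
   e^(-y) HH is constant in y, and it decays. *)
pose HH y t := Dt c y t - (frame1 t * a y t + frame2 t * c y t) - e3 y t.
have cHH : cyl (nu - 1) HH.
  apply: cylB => //; apply: cylB; first exact: cylDt.
  by apply: cyl_add; apply: cylZ => //; [exact: frame1_smooth|exact: frame1_per|exact: frame2_smooth|exact: frame2_per].
have DH : hasDy HH (fun y t => Dy (Dt c) y t - (frame1 t * Dy a y t + frame2 t * Dy c y t) - Dy e3 y t).
  apply: hasDyB; last exact: cyl_dy ce3.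
  apply: hasDyB; first exact: cyl_dy (cylDt cc).
  by apply: hasDyD; apply: hasDyZ; [exact: cyl_dy ca|exact: cyl_dy cc].
have DHX y t : Dy HH y t - HH y t = X y t.
  rewrite (hasDyE DH) (cyl_DyDt cc) Hc Ha.
  rewrite (hasDtE (hasDtD (cyl_dt cc) (hasDtB (cyl_dt cG2) (cyl_dt cta)))).
  by rewrite /HH /X; ring.
have H0 : forall y t, HH y t = 0.
  have ce : cyl (nu - 2) (fun y t => expR (- 1 * y) * HH y t) by apply: (sh _ _ _ _ _ cHH); ring.
  have Z : forall y t, expR (- 1 * y) * HH y t = 0.
    apply: (cyl_inj0 _ ce); first by lra.
    move=> y t; rewrite (hasDyE (hasDyM (hasDy_exp (- 1)) (cyl_dy cHH))).
    transitivity (expR (- 1 * y) * (Dy HH y t - HH y t)); first by ring.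
    by rewrite DHX X0 mulr0.
  by move=> y t; have /eqP := Z y t; rewrite mulf_eq0 expR_eq0 /= => /eqP.
(* E^2 is the determinant of the frame (gamma, gamma'). *)
pose iE t := (E t ^+ 2)^-1.
have siE : smooth iE.
  apply: smoothV; first by move=> t; rewrite expf_neq0.
  rewrite (_ : (fun t => _) = (fun t => E t * E t)); first exact: smoothM.
  by apply/funext => t; rewrite expr2.
have piE : per iE by move=> t; rewrite /iE pE.
pose u y t := (iE t * dgam1 t) * a y t - (iE t * gam1 t) * c y t.
pose v y t := (iE t * gam0 t) * c y t - (iE t * dgam0 t) * a y t.
have cu : cyl (nu - 1) u.
  apply: cylB; apply: cylZ => //; 
    [exact: smoothM siE dgam1_smooth|exact: perM piE dgam1_per|exact: smoothM siE gam1_smooth|exact: perM piE gam1_per].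
have cv : cyl (nu - 1) v.
  apply: cylB; apply: cylZ => //; 
    [exact: smoothM siE gam0_smooth|exact: perM piE gam0_per|exact: smoothM siE dgam0_smooth|exact: perM piE dgam0_per].
have iEE t : iE t * E t ^+ 2 = 1 by rewrite /iE mulVf // expf_neq0.
have au : a = fun y t => gam0 t * u y t + gam1 t * v y t.
  apply: fun2_ext => y t; rewrite /u /v -[LHS]mul1r -(iEE t) -det_gam; ring.
have cv' : c = fun y t => dgam0 t * u y t + dgam1 t * v y t.
  apply: fun2_ext => y t; rewrite /u /v -[LHS]mul1r -(iEE t) -det_gam; ring.
exists u, v; split => // y t.
have ay : Dy a y t = gam0 t * Dy u y t + gam1 t * Dy v y t.
  by rewrite {1}au (hasDyE (hasDyD (hasDyZ gam0 (cyl_dy cu)) (hasDyZ gam1 (cyl_dy cv)))).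
have cy : Dy c y t = dgam0 t * Dy u y t + dgam1 t * Dy v y t.
  by rewrite {1}cv' (hasDyE (hasDyD (hasDyZ dgam0 (cyl_dy cu)) (hasDyZ dgam1 (cyl_dy cv)))).
have at' : Dt a y t = c y t + (gam0 t * Dt u y t + gam1 t * Dt v y t).
  rewrite {1}au (hasDtE (hasDtD (hasDtZ der_gam0 (cyl_dt cu)) (hasDtZ der_gam1 (cyl_dt cv)))) cv'; ring.
have ct' : Dt c y t = frame1 t * a y t + frame2 t * c y t + (dgam0 t * Dt u y t + dgam1 t * Dt v y t).
  rewrite {1}cv' (hasDtE (hasDtD (hasDtZ der_dgam0 (cyl_dt cu)) (hasDtZ der_dgam1 (cyl_dt cv)))) au cv'; ring.
have xx : expR y * expR (- 1 * y) = 1 by rewrite mulN1r expRxMexpNx_1.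
have xm : expR y * expR ((m - 1) * y) = expR (m * y) by rewrite -expRD; congr expR; ring.
split.
- rewrite -ay Ha /G1 /M mulrBr /e1 !mulrA xx mul1r.
  by rewrite [expR y * m]mulrC -[m * expR y * _]mulrA xm subrK.
- have -> : gam0 t * Dt u y t + gam1 t * Dt v y t + (dgam0 t * Dy u y t + dgam1 t * Dy v y t) = G2 y t.
    rewrite -cy Hc at'; ring.
  rewrite /G2 /M mulrBr /e2 !mulrA xx mul1r.
  by rewrite [expR y * m]mulrC -[m * expR y * _]mulrA xm subrK.
- have -> : dgam0 t * Dt u y t + dgam1 t * Dt v y t = e3 y t.
    have := H0 y t; rewrite /HH ct'; lra.
  by rewrite /e3 mulrA xx mul1r.
Qed.

(** The right-hand sides are quadratic in fields of cyl N, hence in cyl (2 N).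
The scalar equation divides by e^(m y), and 2 N - m >= N. *)
Lemma bend_solve N A C2 D : m <= N -> 2 < N -> cyl (2 * N) A -> cyl (2 * N) C2 -> cyl (2 * N) D ->
  exists u v w, [/\ cyl N u, cyl N v, cyl N w & bending_eqs A C2 D u v w].
Proof.
move=> mN N2 cA cC cD.
pose F y t := (m * (m - 1))^-1 * (expR (- (m - 1) * y) * bend_rhs A C2 D y t).
have c1 f : cyl (2 * N) f -> cyl (2 * N - 1) (fun y t => expR (- 1 * y) * f y t).
  by move=> cf; apply: cylE cf; ring.
have cF : cyl (2 * N - m) F.
  apply: cylC; apply: (@cylE R (2 * N - 1)); first by ring.
  have a := c1 _ cA; have c := c1 _ cC; have d := c1 _ cD.
  have p1 : cyl (2 * N - 1) (fun y t => Dy (Dt (fun y t => expR (- 1 * y) * C2 y t)) y t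
      - Dt (Dt (fun y t => expR (- 1 * y) * A y t)) y t).
    by apply: cylB; [exact: cylDy (cylDt c)|exact: cylDt (cylDt a)].
  have p2 := cylZ frame1_smooth frame1_per (cylB (cylDy a) a).
  have p3 := cylZ frame2_smooth frame2_per (cylB (cylDy c) (cylDt a)).
  exact: cylB (cylB (cylB p1 p2) p3) (cylB (cylDy (cylDy d)) (cylDy d)).
have n0 : 0 < 2 * N - m by have := m2; lra.
have [w cw Hw] := bend_op_solve n0 cF.
have mm : m * (m - 1) != 0 by rewrite mulf_neq0 // gt_eqF //; have := m2; lra.
have nu2 : 2 < 2 * N by lra.
have [u [v [cu cv B]]] : exists u v, [/\ cyl (2 * N - 1) u, cyl (2 * N - 1) v & bending_eqs A C2 D u v w].
  apply: bend_from_w => // y t; rewrite Hw /F.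
  have e : expR ((m - 1) * y) * expR (- (m - 1) * y) = 1 by rewrite mulNr expRxMexpNx_1.
  have := mulfV mm; move: (m * (m - 1))^-1 => k kk.
  transitivity ((m * (m - 1) * k) * (expR ((m - 1) * y) * expR (- (m - 1) * y)) * bend_rhs A C2 D y t).
    by ring.
  by rewrite kk e !mul1r.
exists u, v, w; split => //; [apply: cylW cu|apply: cylW cv|apply: cylW cw]; have := m2; lra.
Qed.

(** A monomial in the kernel of bend_op, of exponent at least N. *)
Lemma bend_first N : m <= N -> 2 < N -> exists u v w, [/\ cyl N u, cyl N v, cyl N w,
  bending_eqs (fun _ _ => 0) (fun _ _ => 0) (fun _ _ => 0) u v w & exists y t, w y t != 0].
Proof.
move=> mN N2; have N0 : 0 <= N by lra.
have [l [A [Nl sA pA [t0 At0] HK]]] := bend_op_kernel N0.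
have cw : cyl l (mono l 0 A) by exact: cyl_mono.
have Z mu : cyl mu (fun _ _ : R => 0 : R) by exact: cyl0.
have nu2 : 2 < l + m by have := m2; lra.
have [u [v [cu cv B]]] : exists u v, [/\ cyl (l + m - 1) u, cyl (l + m - 1) v &
    bending_eqs (fun _ _ => 0) (fun _ _ => 0) (fun _ _ => 0) u v (mono l 0 A)].
  apply: (bend_from_w nu2 (Z _) (Z _) (Z _)); first by rewrite addrK.
  have D0 : Dy (fun _ _ : R => 0 : R) = fun _ _ => 0 by apply: hasDyE => t; exact: der_cst.
  have T0 : Dt (fun _ _ : R => 0 : R) = fun _ _ => 0 by apply: hasDtE => y; exact: der_cst.
  have e0 : (fun y _ : R => expR (- 1 * y) * 0 : R) = fun _ _ => 0 by apply: fun2_ext => y t; rewrite mulr0.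
  by move=> y t; rewrite HK mulr0 /bend_rhs e0 !(D0, T0); ring.
exists u, v, (mono l 0 A); split => //; [apply: cylW cu|apply: cylW cv|apply: cylW cw|]; have := m2; try lra.
by exists 0, t0; rewrite /mono expr0 mulr0 expR0 !mul1r.
Qed.

End Bend.

(** * Differentiability in the plane *)

Section Plane.
Variable R : realType.
Implicit Types (p v h x : 'rV[R]_2) (f : 'rV[R]_2 -> R).

Lemma vec2E0 (a b : R) : vec2 a b 0 0 = a. Proof. by rewrite /vec2 mxE. Qed.
Lemma vec2E1 (a b : R) : vec2 a b 0 1 = b. Proof. by rewrite /vec2 mxE. Qed.
Lemma rV2P p p' : p 0 0 = p' 0 0 -> p 0 1 = p' 0 1 -> p = p'.
Proof.
move=> e0 e1; apply/rowP => i; case: i => [[|[|//]] Hi].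
  by rewrite (_ : Ordinal Hi = 0) //; exact: val_inj.
by rewrite (_ : Ordinal Hi = 1) //; exact: val_inj.
Qed.
Lemma coord_le p i : `|p 0 i| <= `|p|.
Proof.
rewrite [leRHS]/Num.norm /= mx_normrE; apply: (@le_trans _ _ (`|p (0, i).1 (0, i).2|)) => //.
by apply: (le_bigmax _ (fun i : 'I_1 * 'I_2 => `|p i.1 i.2|)).
Qed.

Lemma norm2_le p (M : R) : 0 <= M -> `|p 0 0| <= M -> `|p 0 1| <= M -> `|p| <= M.
Proof.
move=> M0 h0 h1; rewrite [leLHS]/Num.norm /= mx_normrE; apply: bigmax_le => // -[i j] _ /=.
rewrite (ord1 i); case: j => [[|[|//]] Hi].
  by rewrite (_ : Ordinal Hi = 0) //; exact: val_inj.
by rewrite (_ : Ordinal Hi = 1) //; exact: val_inj.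
Qed.

Definition ebase (i : 'I_2) : 'rV[R]_2 := delta_mx 0 i.
Lemma ebaseE i j : ebase i 0 j = (j == i)%:R. Proof. by rewrite /ebase mxE eqxx. Qed.

Lemma ebase_norm i (c : R) : `|c *: ebase i| <= `|c|.
Proof.
apply: norm2_le => //; rewrite mxE ebaseE normrM; case: (_ == _);
  by rewrite ?normr1 ?mulr1 ?normr0 ?mulr0.
Qed.

Section Line.
Variables (V : normedModType R).
Implicit Types (g : V -> R) (u e : V).

(** Directional derivatives are one-variable derivatives along a line; this is
how every derivative on the plane is computed. *)
Lemma line_der g u e (s d : R) : is_derive (s *: e + u) e g d <->
  is_derive s 1 (fun k : R => g (k *: e + u)) d.
Proof.
have E : (fun k : R => k^-1 *: ((g \o shift (s *: e + u)) (k *: e) - g (s *: e + u))) =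
   (fun k : R => k^-1 *: (((fun k : R => g (k *: e + u)) \o shift s) (k *: (1 : R)) - g (s *: e + u))).
  by apply/funext => k /=; rewrite [k *: 1]mulr1 addrA -scalerDl.
split=> -[A B]; apply: DeriveDef.
- by rewrite /derivable -E.
- by rewrite -B /derive -E.
- by rewrite /derivable E.
- by rewrite -B /derive E.
Qed.

Lemma line_der0 g u e (d : R) : is_derive (0 : R) 1 (fun k : R => g (k *: e + u)) d ->
  is_derive u e g d.
Proof. by move/line_der; rewrite scale0r add0r. Qed.

Lemma mvt_line g u e (c : R) : (forall s : R, `|s| <= `|c| -> derivable g (s *: e + u) e) ->
  exists2 s : R, `|s| <= `|c| & g (c *: e + u) - g u = c * 'D_e g (s *: e + u).
Proof.
move=> H.
have D (s : R) : `|s| <= `|c| -> is_derive s 1 (fun k : R => g (k *: e + u)) ('D_e g (s *: e + u)).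
  by move=> hs; apply/line_der; apply: derivableP; exact: H.
have g0 : g u = g (0 *: e + u) by rewrite scale0r add0r.
case: (leP 0 c) => c0.
  have C : {within `[0, c], continuous (fun k : R => g (k *: e + u))}.
    apply: derivable_within_continuous => s; rewrite in_itv /= => /andP[s0 sc].
    by have [] := D s _; rewrite // !ger0_norm.
  have [|s] := @MVT_segment R _ (fun s => 'D_e g (s *: e + u)) 0 c c0 _ C.
    by move=> s; rewrite in_itv /= => /andP[s0 sc]; apply: D; rewrite !ger0_norm // ltW.
  rewrite in_itv /= => /andP[s0 sc] E; exists s; first by rewrite !ger0_norm.
  by rewrite g0 E subr0 mulrC.
have c0' := ltW c0.
have C : {within `[c, 0], continuous (fun k : R => g (k *: e + u))}.
  apply: derivable_within_continuous => s; rewrite in_itv /= => /andP[sc s0].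
  by have [] := D s _; rewrite // !ler0_norm // lerN2.
have [|s] := @MVT_segment R _ (fun s => 'D_e g (s *: e + u)) c 0 c0' _ C.
  by move=> s; rewrite in_itv /= => /andP[sc s0]; apply: D; rewrite !ler0_norm ?lerN2 // ltW.
rewrite in_itv /= => /andP[sc s0] E; exists s; first by rewrite !ler0_norm // lerN2.
by rewrite g0 -opprB E sub0r mulrN opprK mulrC.
Qed.

End Line.

Definition lin2 (a b : R) (v : 'rV[R]_2) : R := v 0 0 * a + v 0 1 * b.
Lemma lin2_is_linear a b : linear (lin2 a b).
Proof. by move=> k u v; rewrite /lin2 !mxE /GRing.scale /=; ring. Qed.
HB.instance Definition _ a b := GRing.isLinear.Build R 'rV[R]_2 R _ (lin2 a b) (lin2_is_linear a b).

Lemma lin2_cont a b : continuous (lin2 a b).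
Proof.
move=> v; rewrite (_ : lin2 a b = fun v => v 0 0 * a + v 0 1 * b) //.
have c i := @coord_continuous R 1 2 0 i v.
exact: (cvgD (cvgM (c 0) (cvg_cst a)) (cvgM (c 1) (cvg_cst b))).
Qed.

(** The mean value theorem is applied along the two sides of a rectangle, and
the continuity of the partial derivatives controls the error. *)
Lemma C1_diff f x : (\forall y \near x, forall i, derivable f y (ebase i)) ->
  (forall i, {for x, continuous ('D_(ebase i) f)}) ->
  differentiable f x /\ forall v, 'd f x v = lin2 ('D_(ebase 0) f x) ('D_(ebase 1) f x) v.
Proof.
move=> /nbhs_ballP[r0 /= r00 Hd] Hc.
pose L := lin2 ('D_(ebase 0) f x) ('D_(ebase 1) f x).
have main : f \o shift x = cst (f x) + (L : _ -> _) +o_ (0 : 'rV[R]_2) id.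
  apply/eqaddoP => eps eps0.
  have e20 : 0 < eps / 2 by rewrite divr_gt0.
  have /cvgrPdist_le/(_ _ e20)/nbhs_ballP[r1 /= r10 H1] := Hc 0.
  have /cvgrPdist_le/(_ _ e20)/nbhs_ballP[r2 /= r20 H2] := Hc 1.
  pose r := Num.min r0 (Num.min r1 r2).
  have rr : 0 < r by rewrite !lt_min r00 r10.
  apply/nbhs_ballP; exists r => //= h.
  rewrite mx_norm_ball /ball_ /= sub0r normrN => hr.
  have B y (r' : R) : r <= r' -> `|y - x| <= `|h| -> ball x r' y.
    by move=> rr' yx; rewrite mx_norm_ball /ball_ /= distrC; apply: le_lt_trans yx (lt_le_trans hr rr').
  have rle0 : r <= r0 by rewrite ge_min lexx.
  have rle1 : r <= r1 by rewrite !ge_min lexx orbT.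
  have rle2 : r <= r2 by rewrite !ge_min lexx !orbT.
  have eh : h = h 0 1 *: ebase 1 + h 0 0 *: ebase 0.
    by apply: rV2P; rewrite !mxE /= !(mulr1, mulr0, add0r, addr0).
  have N0 (s : R) : `|s| <= `|h 0 0| -> `|s *: ebase 0 + x - x| <= `|h|.
    by move=> sh; rewrite addrK; apply: le_trans (ebase_norm _ _) (le_trans sh (coord_le _ _)).
  have N1 (s : R) : `|s| <= `|h 0 1| -> `|s *: ebase 1 + (h 0 0 *: ebase 0 + x) - x| <= `|h|.
    move=> sh; rewrite addrA addrK; apply: norm2_le => //.
      by rewrite !mxE /= mulr0 add0r mulr1 coord_le.
    by rewrite !mxE /= mulr0 addr0 mulr1; apply: le_trans sh (coord_le _ _).
  have [s1 s1h E1] := @mvt_line _ f (h 0 0 *: ebase 0 + x) (ebase 1) (h 0 1) (fun s hs => Hd _ (B _ _ rle0 (N1 s hs)) 1).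
  have [s0 s0h E0] := @mvt_line _ f x (ebase 0) (h 0 0) (fun s hs => Hd _ (B _ _ rle0 (N0 s hs)) 0).
  have K1 := H2 _ (B _ _ rle2 (N1 _ s1h)).
  have K0 := H1 _ (B _ _ rle1 (N0 _ s0h)).
  set A0 := 'D_(ebase 0) f _ in E0; set A1 := 'D_(ebase 1) f _ in E1.
  have -> : (f \o shift x - (cst (f x) + (L : _ -> _))) h = h 0 1 * (A1 - 'D_(ebase 1) f x) + h 0 0 * (A0 - 'D_(ebase 0) f x).
    transitivity (f (h + x) - (f x + L h)); first by [].
    rewrite {1}eh -addrA /L /lin2.
    have -> : f (h 0 1 *: ebase 1 + (h 0 0 *: ebase 0 + x)) = h 0 1 * A1 + (h 0 0 * A0 + f x) by rewrite -E1 -E0; lra.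
    by ring.
  apply: le_trans (ler_normD _ _) _; rewrite !normrM.
  have -> : eps * `|h| = `|h| * (eps / 2) + `|h| * (eps / 2) by lra.
  apply: lerD; apply: ler_pM => //; rewrite ?coord_le // distrC //.
have E := diff_unique (@lin2_cont _ _) main.
split; last by move=> v; rewrite E.
by apply/diff_locallyP; rewrite E; split => //; exact: lin2_cont.
Qed.

End Plane.

(** * Functions of (y, t) as functions on the plane *)

Section Trig.
Variable R : realType.
Implicit Types (t y a b : R).

(** acos gives the angle up to sign, and the sign of b decides. *)
Lemma polar_surj a b : (a != 0) || (b != 0) -> exists2 t,
  a = Num.sqrt (a ^+ 2 + b ^+ 2) * cos t & b = Num.sqrt (a ^+ 2 + b ^+ 2) * sin t.
Proof.
move=> ab; set r := Num.sqrt _.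
have r2p : 0 < a ^+ 2 + b ^+ 2.
  have ha := sqr_ge0 a; have hb := sqr_ge0 b.
  by case/orP: ab => h; [rewrite ltr_pwDl|rewrite ltr_wpDl] => //; rewrite exprn_even_gt0.
have r0 : 0 < r by rewrite sqrtr_gt0.
have rr : r ^+ 2 = a ^+ 2 + b ^+ 2 by rewrite sqr_sqrtr // ltW.
have rn : r != 0 by rewrite gt_eqF.
have u1 : -1 <= a / r <= 1.
  rewrite ler_pdivlMr // ler_pdivrMr // mulN1r mul1r -ler_norml.
  rewrite -(@ler_pXn2r _ 2) ?nnegrE ?(ltW r0) // -normrX ger0_norm ?sqr_ge0 // rr lerDl; exact: sqr_ge0.
have ca : cos (acos (a / r)) = a / r by apply: acosK; rewrite in_itv.
have sa : sin (acos (a / r)) = `|b| / r.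
  rewrite sin_acos //.
  have -> : 1 - (a / r) ^+ 2 = (`|b| / r) ^+ 2.
    rewrite !expr_div_n -normrX (ger0_norm (sqr_ge0 b)).
    have -> : b ^+ 2 = r ^+ 2 - a ^+ 2 by rewrite rr; ring.
    by field.
  by rewrite sqrtr_sqr ger0_norm // divr_ge0 // ltW.
case: (leP 0 b) => b0.
  by exists (acos (a / r)); rewrite ?ca ?sa ?(ger0_norm b0) mulrC divfK.
exists (- acos (a / r)); first by rewrite cosN ca mulrC divfK.
by rewrite sinN sa (ltr0_norm b0) mulNr opprK mulrC divfK.
Qed.

Lemma trig_eq t t' : cos t = cos t' -> sin t = sin t' -> exists k : int, t' = t + 2 * pi * k%:~R.
Proof.
move=> ec es.
have [k [d [/andP[d0 d1] ed]]] := per_reduce (t' - t).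
exists k; suff dz : d = 0 by move: ed; rewrite dz add0r => <-; rewrite addrC subrK.
have c1 : cos d = 1.
  have : cos (t' - t) = 1 by rewrite cosB ec es -!expr2 cos2Dsin2.
  by rewrite ed per_int //; exact: per_cos.
apply/eqP; rewrite eq_le d0 andbT leNgt; apply/negP => dp.
have sp : 0 < sin (d / 2) by apply: sin_gt0_pi; apply/andP; split; lra.
have : cos d = cos (d / 2) ^+ 2 *+ 2 - 1.
  by rewrite -cos_mulr2n; congr cos; rewrite mulr2n; lra.
rewrite c1 cos2sin2 => h.
have : 0 < sin (d / 2) ^+ 2 by rewrite exprn_gt0.
move: h; rewrite mulr2n; lra.
Qed.

End Trig.

Section Realization.
Variable R : realType.
Variable E : R -> R.
Hypotheses (sE : smooth E) (pE : per E) (E0 : forall t, 0 < E t).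
Implicit Types (f : R -> R -> R) (y t nu : R) (p v : 'rV[R]_2).
Let En t : E t != 0. Proof. by rewrite gt_eqF. Qed.

Definition polar_pt y t : 'rV[R]_2 := vec2 (expR y * (E t * cos t)) (expR y * (E t * sin t)).

Lemma polar_pt0 y t : polar_pt y t 0 0 = expR y * E t * cos t. Proof. by rewrite vec2E0 mulrA. Qed.
Lemma polar_pt1 y t : polar_pt y t 0 1 = expR y * E t * sin t. Proof. by rewrite vec2E1 mulrA. Qed.

Lemma polar_pt_sq y t : polar_pt y t 0 0 ^+ 2 + polar_pt y t 0 1 ^+ 2 = (expR y * E t) ^+ 2.
Proof. by rewrite polar_pt0 polar_pt1 !(exprMn _ (_ * _)) -mulrDr cos2Dsin2 mulr1. Qed.

Lemma polar_radius_gt0 y t : 0 < expR y * E t. Proof. by rewrite mulr_gt0 // expR_gt0. Qed.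

Lemma polar_pt_neq0 y t : polar_pt y t != 0.
Proof.
apply/negP => /eqP e; have := polar_pt_sq y t; rewrite e !mxE !expr0n /= addr0 => /esym/eqP.
by rewrite sqrf_eq0 gt_eqF // polar_radius_gt0.
Qed.

Lemma polar_pt_surj p : p != 0 -> exists y t, p = polar_pt y t.
Proof.
move=> p0; have h : (p 0 0 != 0) || (p 0 1 != 0).
  rewrite -negb_and; apply: contra p0 => /andP[/eqP a /eqP b].
  by apply/eqP; apply: rV2P; rewrite mxE.
have [t e0 e1] := polar_surj h; set r := Num.sqrt _ in e0 e1.
have r0 : 0 < r.
  rewrite lt_neqAle sqrtr_ge0 andbT eq_sym; apply/negP => /eqP rz.
  by move: h; rewrite e0 e1 rz !mul0r eqxx.
exists (ln (r / E t)), t.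
have er : expR (ln (r / E t)) * E t = r by rewrite lnK ?posrE ?divr_gt0 // divfK.
by apply: rV2P; rewrite ?polar_pt0 ?polar_pt1 er.
Qed.

Lemma polar_pt_inj y t y' t' : polar_pt y t = polar_pt y' t' -> y = y' /\ exists k : int, t' = t + 2 * pi * k%:~R.
Proof.
move=> e.
have h : expR y * E t = expR y' * E t'.
  apply/eqP; rewrite -(@eqrXn2 _ 2) ?(ltW (polar_radius_gt0 _ _)) // -!polar_pt_sq e //.
have n0 : expR y' * E t' != 0 by rewrite gt_eqF // polar_radius_gt0.
have c : cos t = cos t'.
  by apply: (mulfI n0); rewrite -polar_pt0 -e polar_pt0 h.
have s : sin t = sin t'.
  by apply: (mulfI n0); rewrite -polar_pt1 -e polar_pt1 h.
have [k ek] := trig_eq c s; split; last by exists k.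
move: h; rewrite ek per_int // => /(mulIf (En t)); exact: expR_inj.
Qed.

(** The function of the point whose coordinates are (y, t), extended by 0 at the
origin; a periodic f makes the value independent of the choice of (y, t). *)
Definition on_plane f p : R := xget 0 [set w | exists y t, p = polar_pt y t /\ w = f y t].

Lemma on_planeE f y t : (forall y, per (f y)) -> on_plane f (polar_pt y t) = f y t.
Proof.
move=> pf; rewrite /on_plane; case: xgetP => [w _ [y' [t' [e ->]]]|H]; last by case: (H (f y t)); exists y, t.
by have [<- [k ->]] := polar_pt_inj e; rewrite per_int.
Qed.

Lemma on_plane0 f : on_plane f 0 = 0.
Proof.
rewrite /on_plane; case: xgetP => // w _ [y [t [e _]]].
by have := polar_pt_neq0 y t; rewrite -e eqxx.
Qed.

Section Chart.
Variable t0 : R.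
Definition cha p := p 0 0 * cos t0 + p 0 1 * sin t0.
Definition chb p := p 0 1 * cos t0 - p 0 0 * sin t0.
Definition chT (a b : R) := t0 + atan (b / a).
Definition chY (a b : R) := 2^-1 * ln (a ^+ 2 + b ^+ 2) - ln (E (chT a b)).

(** The half-plane around the direction t0, where atan inverts the
parametrisation. *)
Lemma chart p : 0 < cha p -> p = polar_pt (chY (cha p) (chb p)) (chT (cha p) (chb p)).
Proof.
set a := cha p; set b := chb p => a0.
have r2 : 0 < a ^+ 2 + b ^+ 2 by rewrite ltr_pwDl ?exprn_gt0 // sqr_ge0.
pose r := expR (2^-1 * ln (a ^+ 2 + b ^+ 2)).
have r0 : 0 < r := expR_gt0 _.
have rr : r ^+ 2 = a ^+ 2 + b ^+ 2.
  by rewrite -expRM_natl mulrA divff // mul1r lnK // posrE.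
have eY : expR (chY a b) * E (chT a b) = r.
  by rewrite /chY expRB lnK ?posrE // divfK.
have ba : 1 + (b / a) ^+ 2 = (r / a) ^+ 2.
  by rewrite !expr_div_n rr; field; rewrite gt_eqF.
have ca : cos (atan (b / a)) = a / r.
  by rewrite cos_atan ba sqrtr_sqr ger0_norm ?invf_div // divr_ge0 // ltW.
have cn : cos (atan (b / a)) != 0 by rewrite ca gt_eqF // divr_gt0.
have sa : sin (atan (b / a)) = b / r.
  have := atanK (b / a); rewrite /tan => h.
  rewrite -[LHS](divfK cn) h ca; field.
  by rewrite !gt_eqF.
have rn : r != 0 by rewrite gt_eqF.
apply: rV2P; rewrite ?polar_pt0 ?polar_pt1 eY /chT ?cosD ?sinD ca sa.
  rewrite (_ : r * _ = a * cos t0 - b * sin t0); last by field.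
  rewrite /a /b /cha /chb -[LHS]mulr1 -(cos2Dsin2 t0); ring.
rewrite (_ : r * _ = a * sin t0 + b * cos t0); last by field.
rewrite /a /b /cha /chb -[LHS]mulr1 -(cos2Dsin2 t0); ring.
Qed.

Lemma cha_polar_pt y : cha (polar_pt y t0) = expR y * E t0.
Proof. by rewrite /cha polar_pt0 polar_pt1 -[RHS]mulr1 -(cos2Dsin2 t0); ring. Qed.
Lemma chb_polar_pt y : chb (polar_pt y t0) = 0.
Proof. by rewrite /chb polar_pt0 polar_pt1; ring. Qed.
Lemma chT_polar_pt y : chT (expR y * E t0) 0 = t0.
Proof. by rewrite /chT mul0r atan0 addr0. Qed.
Lemma chY_polar_pt y : chY (expR y * E t0) 0 = y.
Proof.
rewrite /chY chT_polar_pt expr0n /= addr0 lnXn ?polar_radius_gt0 // -[ln _ *+ 2]mulr_natl mulrA mulVf // mul1r.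
by rewrite lnM ?posrE ?expR_gt0 // expRK addrK.
Qed.

Lemma lin_der (k1 k2 : R) v p : is_derive (0 : R) 1
   (fun k : R => (k *: v + p) 0 0 * k1 + (k *: v + p) 0 1 * k2) (v 0 0 * k1 + v 0 1 * k2).
Proof.
have D := derD (derZ (v 0 0 * k1 + v 0 1 * k2) (@der_id R)) (der_cst (p 0 0 * k1 + p 0 1 * k2)) 0.
rewrite mulr1 addr0 in D.
rewrite (_ : (fun k : R => _) = (fun k => (v 0 0 * k1 + v 0 1 * k2) * k + (p 0 0 * k1 + p 0 1 * k2))) //.
by apply/funext => k; rewrite !mxE; ring.
Qed.

Lemma chart_der (A B : R -> R) (a b r : R) : is_derive (0 : R) 1 A a -> is_derive (0 : R) 1 B b ->
  A 0 = r -> B 0 = 0 -> 0 < r ->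
  is_derive (0 : R) 1 (fun k => chT (A k) (B k)) (b / r) /\
  is_derive (0 : R) 1 (fun k => chY (A k) (B k)) (a / r - derive1 E t0 / E t0 * (b / r)).
Proof.
move=> dA dB A0 B0 r0.
have An : A 0 != 0 by rewrite A0 gt_eqF.
have dV := @is_deriveV R A 0 a 1 An dA.
have dQ := is_deriveM dB dV.
have dT : is_derive (0 : R) 1 (fun k => chT (A k) (B k)) (b / r).
  have D1 := @is_derive1_comp R atan (fun k => B k / A k) 0 _ _ (is_derive1_atan _) dQ.
  have D2 := is_deriveD (is_derive_cst t0 (0 : R) 1) D1.
  apply: (is_derive_eq D2); rewrite /GRing.scale /= A0 B0 mul0r expr0n /= addr0 invr1.
  by rewrite mul1r add0r mul0r add0r mulrC.
split => //.
have dS : is_derive (0 : R) 1 (fun k => A k ^+ 2 + B k ^+ 2) (2 * r * a).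
  have D := is_deriveD (is_deriveM dA dA) (is_deriveM dB dB).
  rewrite (_ : (fun k => _) = ((fun k => A k * A k) + (fun k => B k * B k))); last first.
    by apply/funext => k; rewrite !expr2.
  by apply: (is_derive_eq D); rewrite /GRing.scale /= A0 B0; ring.
have S0 : 0 < A 0 ^+ 2 + B 0 ^+ 2 by rewrite A0 B0 expr0n addr0 exprn_gt0.
have dL := @is_derive1_comp R (@ln R) _ 0 _ _ (is_derive1_ln S0) dS.
have dE := @is_derive1_comp R E _ 0 _ _ (smooth_is_der sE _) dT.
have T0 : chT (A 0) (B 0) = t0 by rewrite /chT B0 mul0r atan0 addr0.
have dLE := @is_derive1_comp R (@ln R) _ 0 _ _ (is_derive1_ln (E0 _)) dE.
have D := is_deriveB (is_deriveZ 2^-1 dL) dLE.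
apply: (is_derive_eq D); rewrite /GRing.scale /= T0 A0 B0 expr0n /= addr0.
by field; rewrite gt_eqF //= En.
Qed.

End Chart.

(** Radial and angular components of v at the angle t. *)
Definition rad_part v t := v 0 0 * cos t + v 0 1 * sin t.
Definition ang_part v t := v 0 1 * cos t - v 0 0 * sin t.
(** The derivative of f along v, by the chain rule through the coordinates
(y, t). *)
Definition dir_der v f : R -> R -> R := fun y t => expR (- 1 * y) *
  (((E t)^-1 * (rad_part v t - derive1 E t / E t * ang_part v t)) * Dy f y t + ((E t)^-1 * ang_part v t) * Dt f y t).

Lemma parts_smooth v : smooth (rad_part v) /\ smooth (ang_part v).
Proof.
split; first by apply: smoothD; apply: smoothM; (exact: smooth_cst || exact: smooth_cos || exact: smooth_sin).
by apply: smoothD; [|apply: smoothN]; apply: smoothM; (exact: smooth_cst || exact: smooth_cos || exact: smooth_sin).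
Qed.

(** One derivative on the plane costs one power of e^y, which is why cyl nu
consists of C^k functions for k < nu. *)
Lemma cyl_dir_der nu v f : cyl nu f -> cyl (nu - 1) (dir_der v f).
Proof.
move=> cf.
have [sal sbe] := parts_smooth v.
have pal : per (rad_part v) by move=> t; rewrite /rad_part per_sin per_cos.
have pbe : per (ang_part v) by move=> t; rewrite /ang_part per_sin per_cos.
have siE : smooth (fun t => (E t)^-1) by exact: smoothV.
have piE : per (fun t => (E t)^-1) by move=> t; rewrite pE.
have pdE : per (derive1 E) by apply: per_derive1 => //; exact: smooth_der1.
have sdE : smooth (fun t => derive1 E t / E t) by apply: smoothM => //; exact: smooth_derive1.
apply: (@cylE R nu); first by rewrite addrC.
apply: cyl_add; apply: cylZ; [| |exact: cylDy| | |exact: cylDt].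
- by apply: smoothM => //; apply: smoothD => //; apply: smoothN; exact: smoothM.
- by move=> t; rewrite pE pal pdE pbe.
- exact: smoothM.
- by move=> t; rewrite pE pbe.
Qed.

(** Along the line through the point, on_plane f is f composed with the chart,
whose derivative is explicit. *)
Lemma on_plane_der nu v f y t : cyl nu f -> is_derive (polar_pt y t) v (on_plane f) (dir_der v f y t).
Proof.
move=> cf; apply: line_der0.
pose A (k : R) := cha t (k *: v + polar_pt y t); pose B (k : R) := chb t (k *: v + polar_pt y t).
have dA : is_derive (0 : R) 1 A (rad_part v t) := lin_der (cos t) (sin t) v (polar_pt y t).
have dB : is_derive (0 : R) 1 B (ang_part v t).
  have := lin_der (- sin t) (cos t) v (polar_pt y t).
  rewrite (_ : (fun k : R => _) = B); last by apply/funext => k; rewrite /B /chb mulrN addrC.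
  by rewrite (_ : _ + _ = ang_part v t) //; rewrite /ang_part mulrN addrC.
have A0 : A 0 = expR y * E t by rewrite /A scale0r add0r cha_polar_pt.
have B0 : B 0 = 0 by rewrite /B scale0r add0r chb_polar_pt.
have [dT dY] := chart_der t dA dB A0 B0 (polar_radius_gt0 y t).
have := cyl_chain cf dY dT; rewrite A0 B0 chT_polar_pt chY_polar_pt => D.
have {D} : is_derive (0 : R) 1 (fun k => f (chY t (A k) (B k)) (chT t (A k) (B k))) (dir_der v f y t).
  apply: (is_derive_eq D); rewrite /dir_der mulN1r expRN.
  by field; rewrite En gt_eqF // expR_gt0.
apply: near_eq_is_derive.
have cA : {for (0 : R), continuous A} by exact: is_derive_cont dA.
have : \forall k \near (0 : R), 0 < A k.
  have /cvgrPdist_lt/(_ _ (polar_radius_gt0 y t)) := cA.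
  apply: filterS => k /=; rewrite A0 ltr_norml => /andP[_]; lra.
apply: filterS => k Ak; rewrite [in RHS](@chart t (k *: v + polar_pt y t)) // on_planeE // => z; exact: cyl_perf cf.
Qed.

Lemma on_plane_cont_neq0 nu f p : p != 0 -> cyl nu f -> {for p, continuous (on_plane f)}.
Proof.
move=> p0 cf; have [y [t e]] := polar_pt_surj p0.
have cc i : (x : 'rV[R]_2) 0 i @[x --> p] --> p 0 i by exact: (@coord_continuous R 1 2 0 i p).
have c0 : cha t x @[x --> p] --> expR y * E t.
  rewrite -(cha_polar_pt t y) -e /cha.
  exact: (cvgD (cvgM (cc 0) (cvg_cst _)) (cvgM (cc 1) (cvg_cst _))).
have c1 : chb t x @[x --> p] --> (0 : R).
  rewrite -(chb_polar_pt t y) -e /chb.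
  exact: (cvgB (cvgM (cc 1) (cvg_cst _)) (cvgM (cc 0) (cvg_cst _))).
have r0 := polar_radius_gt0 y t.
have cT : chT t (cha t x) (chb t x) @[x --> p] --> t.
  rewrite -[X in _ --> X](chT_polar_pt t y) /chT.
  have cq : chb t x / cha t x @[x --> p] --> 0 / (expR y * E t).
    have rn : expR y * E t != 0 by rewrite gt_eqF.
    exact: (cvgM c1 (cvgV rn c0)).
  exact: (cvgD (cvg_cst t) (cvg_comp _ _ cq (@continuous_atan R _))).
have cY : chY t (cha t x) (chb t x) @[x --> p] --> y.
  rewrite -[X in _ --> X](chY_polar_pt t y) /chY.
  have cs : cha t x ^+ 2 + chb t x ^+ 2 @[x --> p] --> (expR y * E t) ^+ 2 + 0 ^+ 2.
    exact: (cvgD (cvgM c0 c0) (cvgM c1 c1)).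
  have s0 : 0 < (expR y * E t) ^+ 2 + 0 ^+ 2 by rewrite expr0n /= addr0 exprn_gt0.
  have cEt : E (chT t (cha t x) (chb t x)) @[x --> p] --> E t.
    have cE : continuous E := smooth_cont sE.
    exact: (cvg_comp _ _ cT (cE t)).
  rewrite chT_polar_pt.
  exact: (cvgB (cvgM (cvg_cst _) (cvg_comp _ _ cs (continuous_ln s0))) (cvg_comp _ _ cEt (continuous_ln (E0 t)))).
have H := cyl_cvg (nbhs_filter p) cf cY cT.
rewrite /prop_for /continuous_at [in X in _ --> X]e on_planeE; last by move=> z; exact: cyl_perf cf.
apply: cvg_trans H; apply: (@near_eq_cvg _ _ _ (nbhs_filter p)).
have : \forall x \near p, 0 < cha t x.
  have /cvgrPdist_lt/(_ _ r0) := c0; apply: filterS => x /=; rewrite ltr_norml => /andP[_]; lra.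
apply: (@filterS _ _ (nbhs_filter p)) => x hx; rewrite [in RHS](@chart t x) // on_planeE // => z; exact: cyl_perf cf.
Qed.

Lemma E_lower : exists2 e, 0 < e & forall t, e <= E t.
Proof.
have siE : smooth (fun t => (E t)^-1) by exact: smoothV.
have piE : per (fun t => (E t)^-1) by move=> t; rewrite pE.
have [M M0 H] := per_bounded (smooth_cont siE) piE.
exists M^-1; first by rewrite invr_gt0.
move=> t; rewrite -[E t]invrK lef_pV2 ?posrE ?invr_gt0 //.
exact: le_trans (ler_norm _) (H t).
Qed.

(** Comparison of e^y with the norm, needed at the origin, where the
coordinates degenerate. *)
Lemma expy_le_norm : exists2 C, 0 < C & forall y t, expR y <= C * `|polar_pt y t|.
Proof.
have [e e0 He] := E_lower.
exists (2 / e); first by rewrite divr_gt0.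
move=> y t; rewrite mulrAC ler_pdivlMr //.
apply: (@le_trans _ _ (expR y * E t)); first by rewrite ler_wpM2l ?expR_ge0.
have n0 : 0 <= `|polar_pt y t| by exact: normr_ge0.
rewrite -(@ler_pXn2r _ 2) ?nnegrE ?(ltW (polar_radius_gt0 _ _)) ?mulr_ge0 // -polar_pt_sq.
have h0 : polar_pt y t 0 0 ^+ 2 <= `|polar_pt y t| ^+ 2.
  by rewrite -[_ ^+ 2]ger0_norm ?sqr_ge0 // normrX lerXn2r ?nnegrE // coord_le.
have h1 : polar_pt y t 0 1 ^+ 2 <= `|polar_pt y t| ^+ 2.
  by rewrite -[_ ^+ 2]ger0_norm ?sqr_ge0 // normrX lerXn2r ?nnegrE // coord_le.
have := sqr_ge0 `|polar_pt y t|; rewrite exprMn; lra.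
Qed.

Lemma on_plane_small nu f (eps : R) : 0 < nu -> cyl nu f -> 0 < eps ->
  exists2 d, 0 < d & forall p, `|p| < d -> `|on_plane f p| <= eps.
Proof.
move=> nu0 cf eps0.
have nu2 : nu / 2 < nu by lra.
have n2 : 0 < nu / 2 by lra.
have [C C0 HC] := cyl_decay nu2 cf.
have [D D0 HD] := expy_le_norm.
have Ce : 0 < eps / (C + 1) by rewrite divr_gt0 // ltr_wpDl.
pose y1 := Num.min 0 (ln (eps / (C + 1)) / (nu / 2)).
exists (expR y1 / D); first by rewrite divr_gt0 // expR_gt0.
move=> p hp; have [->|p0] := eqVneq p 0; first by rewrite on_plane0 normr0 ltW.
have [y [t e]] := polar_pt_surj p0; rewrite e on_planeE; last by move=> z; exact: cyl_perf cf.
have yy1 : y <= y1.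
  rewrite -ler_expR; apply: le_trans (HD y t) _; rewrite -e mulrC -ler_pdivlMr //; exact: ltW.
have y0 : y <= 0 by apply: le_trans yy1 _; rewrite ge_min lexx.
apply: le_trans (HC y t y0) _.
have : expR (nu / 2 * y) <= eps / (C + 1).
  rewrite -[leRHS]lnK ?posrE // ler_expR mulrC -ler_pdivlMr //.
  by apply: le_trans yy1 _; rewrite ge_min lexx orbT.
move=> /(ler_wpM2l C0) h; apply: le_trans h _.
rewrite mulrA ler_pdivrMr ?ltr_wpDl // mulrC ler_wpM2l ?(ltW eps0) // lerDl //.
Qed.

Lemma on_plane_cont nu f : 0 < nu -> cyl nu f -> continuous (on_plane f).
Proof.
move=> nu0 cf.
suff H0 : on_plane f x @[x --> nbhs (0 : 'rV[R]_2)] --> on_plane f 0.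
  by move=> p; have [->|p0] := eqVneq p 0; [exact: H0|exact: on_plane_cont_neq0 p0 cf].
apply/cvgrPdist_le => eps eps0; have [d d0 Hd] := on_plane_small nu0 cf eps0.
apply/nbhs_ballP; exists d => //= p'.
by rewrite mx_norm_ball /ball_ /= sub0r normrN on_plane0 sub0r normrN => /Hd.
Qed.

(** Functions of order greater than 1 at the origin are o(|p|), so that their
differential there is 0. *)
Lemma on_plane_littleo nu f (eps : R) : 1 < nu -> cyl nu f -> 0 < eps ->
  exists2 d, 0 < d & forall p, `|p| < d -> `|on_plane f p| <= eps * `|p|.
Proof.
move=> nu1 cf eps0.
have cg : cyl (nu - 1) (fun y t => expR (- 1 * y) * f y t) by apply: cylE cf; rewrite addrC.
have [D D0 HD] := expy_le_norm.
have n0 : 0 < nu - 1 by lra.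
have e0 : 0 < eps / D by rewrite divr_gt0.
have [d d0 Hd] := on_plane_small n0 cg e0.
exists d => // p /Hd; have [->|p0] := eqVneq p 0; first by move=> _; rewrite on_plane0 normr0 mulr_ge0 // ltW.
have [y [t e]] := polar_pt_surj p0; rewrite e !on_planeE; [|by move=> z; exact: cyl_perf cf|by move=> z; exact: cyl_perf cg].
rewrite normrM (ger0_norm (expR_ge0 _)) => h.
have ee : `|f y t| = expR y * (expR (- 1 * y) * `|f y t|) by rewrite mulN1r mulrA expRxMexpNx_1 mul1r.
rewrite ee; apply: (@le_trans _ _ ((D * `|polar_pt y t|) * (eps / D))).
  by apply: ler_pM => //; rewrite ?expR_ge0 // mulr_ge0 // expR_ge0.
rewrite (_ : _ * (eps / D) = eps * `|polar_pt y t|) //; field; rewrite gt_eqF //.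
Qed.

Lemma on_plane_der0 nu v f : 1 < nu -> cyl nu f -> is_derive (0 : 'rV[R]_2) v (on_plane f) 0.
Proof.
move=> nu1 cf.
suff C : (fun h : R => h^-1 *: ((on_plane f \o shift 0) (h *: v) - on_plane f 0)) @ 0^' --> (0 : R).
  by apply: DeriveDef; [exact: cvgP C|exact: (cvg_lim (@norm_hausdorff _ _) C)].
apply/cvgr0Pnorm_le => eps eps0.
have e0 : 0 < eps / (`|v| + 1) by rewrite divr_gt0 // ltr_wpDl.
have [d d0 Hd] := on_plane_littleo nu1 cf e0.
have v0 : 0 < `|v| + 1 by rewrite ltr_wpDl.
apply/nbhs_ballP; exists (d / (`|v| + 1)) => /=; first by rewrite divr_gt0.
move=> h; rewrite /ball /= sub0r normrN => hd hn.
have hn0 : 0 < `|h| by rewrite normr_gt0.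
have hv : `|h *: v| < d.
  rewrite normrZ; apply: (@le_lt_trans _ _ (`|h| * (`|v| + 1))).
    by rewrite ler_wpM2l // lerDl.
  by rewrite -ltr_pdivlMr.
rewrite addr0 on_plane0 subr0 [_ *: _]/(_ * _) normrM normfV mulrC ler_pdivrMr //.
apply: le_trans (Hd _ hv) _; rewrite normrZ.
rewrite mulrAC ler_pdivrMr // -mulrA ler_wpM2l ?(ltW eps0) // ler_wpM2l // lerDl //.
Qed.

Lemma on_plane_is_derive nu v f p : 1 < nu -> cyl nu f -> is_derive p v (on_plane f) (on_plane (dir_der v f) p).
Proof.
move=> nu1 cf; have [->|p0] := eqVneq p 0; first by rewrite on_plane0; exact: on_plane_der0 cf.
have [y [t ->]] := polar_pt_surj p0; rewrite on_planeE; first exact: on_plane_der cf.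
by move=> z; exact: cyl_perf (cyl_dir_der v cf).
Qed.

Lemma on_plane_D nu v f : 1 < nu -> cyl nu f -> 'D_v (on_plane f) = on_plane (dir_der v f).
Proof. by move=> nu1 cf; apply/funext => p; have [_ ->] := on_plane_is_derive v p nu1 cf. Qed.

(** Induction through on_plane_D: each directional derivative is again such a
function, with nu - 1 in place of nu. *)
Lemma on_plane_Ck k nu f : k%:R < nu -> cyl nu f -> Ck k setT (on_plane f).
Proof.
elim: k nu f => [|k IH] nu f knu cf.
  by split => // p _; exact: on_plane_cont cf p.
have k0 : 0 <= k%:R :> R by [].
have nu1 : 1 < nu by move: knu; rewrite -natr1; lra.
split; first by move=> p _; apply: on_plane_cont cf p; lra.
move=> i; split; first by move=> p _; have [] := on_plane_is_derive (delta_mx 0 i) p nu1 cf.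
rewrite /pder (on_plane_D _ nu1 cf); apply: (IH (nu - 1)); last exact: cyl_dir_der.
by move: knu; rewrite -natr1; lra.
Qed.

Lemma on_plane_diff nu f p : 1 < nu -> cyl nu f -> differentiable (on_plane f) p.
Proof.
move=> nu1 cf; suff [] : differentiable (on_plane f) p /\ forall v, 'd (on_plane f) p v =
    lin2 ('D_(ebase R 0) (on_plane f) p) ('D_(ebase R 1) (on_plane f) p) v by [].
apply: C1_diff.
  by near=> x => i; have [] := on_plane_is_derive (ebase R i) x nu1 cf.
move=> i; rewrite (on_plane_D _ nu1 cf); apply: (@on_plane_cont (nu - 1)); [lra|exact: cyl_dir_der].
Unshelve. all: by end_near.
Qed.

End Realization.

(** * The angular profile of the surface *)

Section Surface.
Variable R : realType.
Implicit Types (t x y : R) (p v : 'rV[R]_2).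

Lemma curve_der (f : 'rV[R]_2 -> R) (c0 c1 : R -> R) (x d0 d1 : R) :
  differentiable f (vec2 (c0 x) (c1 x)) -> is_derive x 1 c0 d0 -> is_derive x 1 c1 d1 ->
  is_derive x 1 (fun s => f (vec2 (c0 s) (c1 s))) ('d f (vec2 (c0 x) (c1 x)) (vec2 d0 d1)).
Proof.
move=> df D0 D1; pose c (s : R) := vec2 (c0 s) (c1 s).
have E0 : (fun s => c s 0 0) = c0 by apply/funext => s; rewrite vec2E0.
have E1 : (fun s => c s 0 1) = c1 by apply/funext => s; rewrite vec2E1.
have dc : derivable c x 1.
  apply/derivable_mxP => i j; rewrite (ord1 i); case: j => [[|[|//]] Hi].
    by rewrite (_ : Ordinal Hi = 0) ?E0; [case: D0|exact: val_inj].
  by rewrite (_ : Ordinal Hi = 1) ?E1; [case: D1|exact: val_inj].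
have dfc : differentiable c x by apply/derivable1_diffP.
have ev : 'D_1 c x = vec2 d0 d1.
  rewrite derive_mx //; apply: rV2P; rewrite !mxE /= ?E0 ?E1; [case: D0|case: D1] => _ <- //.
have dcomp : differentiable (f \o c) x by apply: differentiable_comp.
apply: DeriveDef; first exact: diff_derivable.
by rewrite -ev -/(f \o c) deriveE // diff_comp //= deriveE.
Qed.

(** Away from the origin C^1 in the sense of partial derivatives implies
differentiable, since the complement of the origin is open. *)
Lemma Ck_near k (f : 'rV[R]_2 -> R) p : Ck k.+1 [set p | p != 0] f -> p != 0 ->
  differentiable f p /\ forall v, 'd f p v = lin2 (pder 0 f p) (pder 1 f p) v.
Proof.
move=> [_ H] p0; apply: C1_diff.
  have op : \forall y \near p, y != 0.
    apply/nbhs_ballP; exists `|p| => /=; first by rewrite normr_gt0.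
    move=> y; rewrite mx_norm_ball /ball_ /=; apply: contraTneq => ->.
    by rewrite subr0 ltxx.
  by apply: (@filterS _ _ (nbhs_filter p)) op => y y0 i; have [d _] := H i; exact: d.
move=> i; have [_] := H i; case: k H => [|k] H [c _]; exact: c.
Qed.

Lemma polar_dir_neq0 x : polar_dir x != 0.
Proof.
apply/negP => /eqP e; have := cos2Dsin2 x.
have -> : cos x = 0 by rewrite -(vec2E0 (cos x) (sin x)) -/(polar_dir x) e mxE.
have -> : sin x = 0 by rewrite -(vec2E1 (cos x) (sin x)) -/(polar_dir x) e mxE.
by rewrite expr0n /= addr0 => /esym/eqP; rewrite oner_eq0.
Qed.

(** Along the unit circle the derivative of f is - sin times the first partial
derivative plus cos times the second, and induction applies to both. *)
Lemma Ck_polar_Cn k (f : 'rV[R]_2 -> R) : Ck k [set p | p != 0] f -> Cn k (fun x => f (polar_dir x)).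
Proof.
elim: k f => [|k IH] f Hf.
  move=> x; have [Hc _] := Hf.
  have cc : polar_dir s @[s --> x] --> polar_dir x.
    have dc : derivable (@polar_dir R) x 1.
      apply/derivable_mxP => i j; rewrite (ord1 i); case: j => [[|[|//]] Hi].
        rewrite (_ : Ordinal Hi = 0); last exact: val_inj.
        by rewrite (_ : (fun s => _) = cos) //; apply/funext => s; rewrite vec2E0.
      rewrite (_ : Ordinal Hi = 1); last exact: val_inj.
      by rewrite (_ : (fun s => _) = sin) //; apply/funext => s; rewrite vec2E1.
    by apply: differentiable_continuous; apply/derivable1_diffP.
  exact: (cvg_comp _ _ cc (Hc _ (polar_dir_neq0 x))).
have D : der (fun x => f (polar_dir x))
   (fun x => - sin x * pder 0 f (polar_dir x) + cos x * pder 1 f (polar_dir x)).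
  move=> x; have [df dv] := Ck_near Hf (polar_dir_neq0 x).
  have := curve_der df (is_derive_cos x) (is_derive_sin x).
  by move=> h; apply: (is_derive_eq h); rewrite dv /lin2 vec2E0 vec2E1.
apply: CnS D _; have [_ H] := Hf.
have [s c] := Cn_sincos R k.
apply: CnD; apply: CnM => //; try (apply: IH; exact: (H _).2).
rewrite (_ : (fun x => - sin x) = fun x => (-1) * sin x); last by apply/funext => x; rewrite mulN1r.
by apply: CnM => //; exact: Cn_cst.
Qed.

Lemma avoid_seq (s : seq R) x y : x < y -> exists2 r, x < r < y & r \notin s.
Proof.
elim: s x y => [|c s IH] x y xy.
  by exists ((x + y) / 2) => //; apply/andP; split; lra.
case: (boolP (x < c < y)) => [/andP[xc cy]|h].
  have [r /andP[xr rc] rs] := IH _ _ xc; exists r; first by rewrite xr (lt_trans rc).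
  by rewrite inE negb_or rs andbT lt_eqF.
have [r rxy rs] := IH _ _ xy; exists r => //.
by rewrite inE negb_or rs andbT; apply: contra h => /eqP <-.
Qed.

Variables (m : R) (z : 'rV[R]_2 -> R) (theta : seq R).
Hypotheses (m2 : 2 <= m) (z0 : forall p, 0 <= z p) (hz : homogeneous_of_order m z)
  (sz : Cinfty [set p | p != 0] z) (noasym : has_no_asymptotic_curve z).
Hypothesis pos : forall x : R, 0 <= x < 2 * pi -> x \notin theta ->
     0 < m ^+ 2 * P z x ^+ 2 + m * P z x * derive1n 2 (P z) x
         - (m - 1) * derive1 (P z) x ^+ 2.

Let m0 : 0 < m. Proof. by have := m2; lra. Qed.
Let mn : m != 0. Proof. by rewrite gt_eqF. Qed.

Lemma P_smooth : smooth (P z). Proof. by move=> n; apply: Ck_polar_Cn; exact: sz. Qed.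
Lemma P_per : per (P z).
Proof. by move=> t; rewrite /P /polar_dir mulr_natl cosD2pi sinD2pi. Qed.

Lemma z_at0 : z 0 = 0.
Proof.
have := hz 0 (a := 2); rewrite scaler0 => /(_ (ltr0Sn _ _)) h.
have e : 1 < (2 : R) `^ m.
  apply: (@lt_le_trans _ _ ((2 : R) `^ 1)); first by rewrite powRr1 // ltr1n.
  by apply: ler_powR; [rewrite ler1n|have := m2; lra].
have : (2 `^ m - 1) * z 0 = 0 by rewrite mulrBl -h mul1r subrr.
by move/eqP; rewrite mulf_eq0 subr_eq0 gt_eqF //= => /eqP.
Qed.

(** Homogeneity on the curve r = E(t). *)
Lemma z_polar_pt (E : R -> R) y t : 0 < E t -> z (polar_pt E y t) = (expR y * E t) `^ m * P z t.
Proof.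
move=> E0; have e0 : 0 < expR y * E t by rewrite mulr_gt0 // expR_gt0.
rewrite -hz //; congr z; apply: rV2P; rewrite ?polar_pt0 ?polar_pt1 !mxE /= //.
Qed.

Section Positivity.
Let one : R -> R := fun=> 1.
Let sone : smooth one := smooth_cst 1.
Let pone : per one. Proof. by []. Qed.
Let one0 t : 0 < one t. Proof. exact: ltr01. Qed.
Let done' : derive1 one = fun=> 0. Proof. by rewrite (derEf (der_cst 1)). Qed.

Let f := mono m 0 (P z).
Let cf : cyl m f. Proof. by apply: cyl_mono => //; [exact: P_smooth|exact: P_per]. Qed.
Let m1 : 1 < m. Proof. by have := m2; lra. Qed.

(** With E = 1 the second derivatives of z along the rays are given by dir_der. *)
Lemma z_on_unit_plane : z = on_plane one f.
Proof.
apply/funext => p; have [->|p0] := eqVneq p 0; first by rewrite on_plane0 // z_at0.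
have [y [t ->]] := polar_pt_surj one0 p0; rewrite on_planeE //; last by move=> u; exact: cyl_perf cf.
rewrite z_polar_pt // mulr1 -expRM /f /mono expr0 mulr1 [y * m]mulrC //.
Qed.

Lemma dir_der_mono k F v : smooth F -> dir_der one v (mono k 0 F) =
  mono (k - 1) 0 (fun t => k * rad_part v t * F t + ang_part v t * derive1 F t).
Proof.
move=> sF; rewrite /dir_der (hasDyE (mono_hasDy k 0 F)) (hasDtE (@mono_hasDt R k 0 F (smooth_der1 sF))).
apply: fun2_ext => y t; have e1 : (one t)^-1 = 1 by rewrite /one invr1.
rewrite e1 done' /mono !mul0r subr0 !mulr0 addr0.
have -> : expR ((k - 1) * y) = expR (- 1 * y) * expR (k * y) by rewrite -expRD; congr expR; ring.
by ring.
Qed.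

Lemma rad_part_der v : der (rad_part v) (ang_part v).
Proof.
by apply: der_ext (derD (derZ (v 0 0) (@der_cos R)) (derZ (v 0 1) (@der_sin R))) _ => t; rewrite /ang_part; ring.
Qed.
Lemma ang_part_der v : der (ang_part v) (fun t => - rad_part v t).
Proof.
by apply: der_ext (derB (derZ (v 0 1) (@der_cos R)) (derZ (v 0 0) (@der_sin R))) _ => t; rewrite /rad_part; ring.
Qed.

(** Where P and P' vanish only the angular part of the Hessian of z survives,
so it is zero on radial vectors. *)
Lemma second_at_zero u v y t0 : P z t0 = 0 -> derive1 (P z) t0 = 0 ->
  'D_u ('D_v z) (polar_pt one y t0) =
  expR ((m - 1 - 1) * y) * (ang_part u t0 * (ang_part v t0 * derive1 (derive1 (P z)) t0)).
Proof.
move=> P0 P1; rewrite {1}z_on_unit_plane (on_plane_D sone pone one0 v m1 cf).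
have [_ ->] := on_plane_der sone pone one0 u y t0 (cyl_dir_der sone pone one0 v cf).
rewrite /f dir_der_mono; last exact: P_smooth.
have [sa sb] := parts_smooth v.
have dP := smooth_is_der P_smooth; have ddP := smooth_is_der (smooth_derive1 P_smooth).
have dA := derD (derM (derZ m (rad_part_der v)) dP) (derM (ang_part_der v) ddP).
rewrite dir_der_mono; last first.
  apply: smoothD; apply: smoothM => //; [|exact: P_smooth|exact: (smooth_derive1 P_smooth)].
  by apply: smoothM => //; exact: smooth_cst.
by rewrite (derEf dA) /mono P0 P1; ring.
Qed.

(** A zero of P is a minimum, so P' vanishes as well, and by second_at_zero the
ray in that direction is an asymptotic curve. *)
Lemma P_gt0 t0 : 0 < P z t0.
Proof.
rewrite lt_neqAle z0 andbT eq_sym; apply/negP => /eqP Pz.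
apply: noasym.
have dP := smooth_is_der P_smooth.
have P'0 : derive1 (P z) t0 = 0.
  have H : is_derive t0 1 (P z) 0.
    apply: (@derive1_at_min _ _ (t0 - 1) (t0 + 1)) => //; first by lra.
    - by move=> t _; exact: der_derivable dP.
    - by rewrite in_itv /=; apply/andP; split; lra.
    - by move=> t _; rewrite Pz z0.
  by rewrite derive1E; case: H.
set e : 'rV[R]_2 := polar_dir t0.
have coord i j : (fun s : R => (s *: e) i j) = fun s => e i j * s.
  by apply/funext => s; rewrite mxE mulrC.
have dd (x : R) : derivable (fun s : R => s *: e) x 1.
  apply/derivable_mxP => i j; rewrite coord; exact: der_derivable (derZ (e i j) (@der_id R)).
have dv : derive1 (fun s : R => s *: e) = fun=> e.
  apply/funext => x; rewrite derive1E derive_mx //; apply/matrixP => i j.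
  rewrite mxE coord; have [_ ->] := derZ (e i j) (@der_id R) x; exact: mulr1.
have xpos x : x \in `]1, 2[%R -> 0 < x by rewrite in_itv /= => /andP[h _]; lra.
exists 1, 2, (fun x => x *: e); split.
- by rewrite ltr1n.
- by move=> x /xpos x0; rewrite scaler_eq0 negb_or gt_eqF //= polar_dir_neq0.
- by move=> x _; split; [exact: dd|rewrite dv; exact: cst_continuous].
- by move=> x _; rewrite dv polar_dir_neq0.
- move=> x /xpos x0; rewrite dv.
  have -> : x *: e = polar_pt one (ln x) t0.
    by apply: rV2P; rewrite ?polar_pt0 ?polar_pt1 lnK // mulr1 mxE /e /polar_dir ?vec2E0 ?vec2E1.
  rewrite /second_fundamental_form.
  set K := (X in X / _); have -> : K = 0; last by rewrite mul0r.
  rewrite /K /z_ss /z_st /z_tt /z_s /z_t /pder !second_at_zero //.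
  rewrite /ang_part /e /polar_dir !vec2E0 !vec2E1 !mxE /=.
  by ring.
Qed.

End Positivity.

Lemma P_neq0 t : P z t != 0. Proof. by rewrite gt_eqF // P_gt0. Qed.

Let P1 := derive1 (P z).
Let P2 := derive1 (derive1 (P z)).
Let HP1 : der (P z) P1. Proof. exact: smooth_is_der P_smooth. Qed.
Let HP2 : der P1 P2. Proof. exact: smooth_is_der (smooth_derive1 P_smooth). Qed.
Let sP1 : smooth P1. Proof. exact: smooth_derive1 P_smooth. Qed.
Let sP2 : smooth P2. Proof. exact: smooth_derive1 sP1. Qed.
Let pP1 : per P1. Proof. apply: per_derive1; [exact: smooth_der1 P_smooth|exact: P_per]. Qed.
Let pP2 : per P2. Proof. apply: per_derive1; [exact: smooth_der1 sP1|exact: pP1]. Qed.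

Definition qnum t := m ^+ 2 * P z t ^+ 2 + m * P z t * P2 t - (m - 1) * P1 t ^+ 2.
Definition qweight t := qnum t * (m ^+ 2 * (m - 1) * (P z t * P z t))^-1.
Definition radius t := expR (- m^-1 * ln (P z t)).

Let mm1 : 0 < m ^+ 2 * (m - 1).
Proof. by rewrite mulr_gt0 ?exprn_gt0 //; have := m2; lra. Qed.
Let den0 t : 0 < m ^+ 2 * (m - 1) * (P z t * P z t).
Proof. by apply: mulr_gt0; [exact: mm1|apply: mulr_gt0; exact: P_gt0]. Qed.

Lemma qnum_smooth : smooth qnum.
Proof.
rewrite (_ : qnum = fun t => (m ^+ 2 * (P z t * P z t) + (m * P z t) * P2 t) + - ((m - 1) * (P1 t * P1 t))); last first.
  by apply/funext => t; rewrite /qnum !expr2.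
apply: smoothD; last by apply: smoothN; apply: smoothM; [exact: smooth_cst|exact: smoothM].
apply: smoothD; first by apply: smoothM; [exact: smooth_cst|apply: smoothM; exact: P_smooth].
by apply: smoothM => //; apply: smoothM; [exact: smooth_cst|exact: P_smooth].
Qed.

(** Positive off a finite set of angles, hence nonnegative by continuity. *)
Lemma qnum_ge0 t : 0 <= qnum t.
Proof.
have pq : per qnum by move=> x; rewrite /qnum P_per pP1 pP2.
have [k [x [/andP[x0 x1] ->]]] := per_reduce t; rewrite per_int // leNgt; apply/negP => neg.
have cq := smooth_cont qnum_smooth.
have e0 : 0 < - qnum x by rewrite oppr_gt0.
have /cvgrPdist_lt/(_ _ e0)/nbhs_ballP := @cq x; move=> [r /= r0 Hr].
have xr : x < Num.min (x + r) (2 * pi) by rewrite lt_min ltrDl r0.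
have [s /andP[xs]] := avoid_seq theta xr; rewrite lt_min => /andP[s1 s2] sth.
have := Hr s; rewrite /ball /= => /(_ _) H.
have : `|qnum x - qnum s| < - qnum x by apply: H; rewrite ltr0_norm ?opprB; lra.
rewrite ltr_norml => /andP[h _].
have : 0 < qnum s by apply: pos => //; rewrite s2 andbT; lra.
move: h; lra.
Qed.

Lemma qweight_facts : [/\ smooth qweight, per qweight, forall t, 0 <= qweight t & exists2 t, 0 < t < 2 * pi & 0 < qweight t].
Proof.
split.
- apply: smoothM; first exact: qnum_smooth.
  apply: smoothV; first by move=> t; rewrite gt_eqF // den0.
  by apply: smoothM; [exact: smooth_cst|apply: smoothM; exact: P_smooth].
- by move=> t; rewrite /qweight /qnum P_per pP1 pP2.
- by move=> t; apply: mulr_ge0; [exact: qnum_ge0|rewrite invr_ge0 ltW].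
- have p0 : 0 < 2 * pi :> R by rewrite mulr_gt0 // pi_gt0.
  have [s /andP[s0 s1] sth] := avoid_seq theta p0.
  exists s; first by rewrite s0.
  apply: mulr_gt0; last by rewrite invr_gt0.
  by apply: pos => //; rewrite s1 ltW.
Qed.

Lemma lnP_der : der (fun t => ln (P z t)) (fun t => P1 t / P z t).
Proof.
move=> t; have h := @is_derive1_comp R (@ln R) (P z) t _ _ (is_derive1_ln (P_gt0 t)) (HP1 t).
by apply: (is_derive_eq h); rewrite mulrC.
Qed.

Lemma radius_der : der radius (fun t => - m^-1 * (P1 t / P z t) * radius t).
Proof. exact: der_comp (@der_expR R) (derZ (- m^-1) lnP_der). Qed.

(** The last identity expresses q through E, which is the form in which the
frame (gamma, gamma') knows the surface. *)
Lemma radius_facts : [/\ smooth radius, per radius, forall t, 0 < radius t &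
  forall t, derive1 (derive1 radius) t = (1 - (m - 1) * qweight t + 2 * (derive1 radius t / radius t) ^+ 2) * radius t].
Proof.
have E0 t : 0 < radius t by exact: expR_gt0.
split.
- apply: smooth_comp; first exact: smooth_expR.
  apply: smoothM; first exact: smooth_cst.
  apply: smooth_der lnP_der _; apply: smoothM => //; apply: smoothV; [exact: P_neq0|exact: P_smooth].
- by move=> t; rewrite /radius P_per.
- exact: E0.
- move=> t; have D1 := radius_der.
  have dV := derV P_neq0 HP1.
  have D2 := derM (derZ (- m^-1) (derM HP2 dV)) D1.
  rewrite (derEf D1) (derE t D2) /qweight /qnum -/P1 -/P2.
  have e0 : radius t != 0 by rewrite gt_eqF.
  have m10 : m - 1 != 0 by rewrite gt_eqF //; have := m2; lra.
  have p0 := P_neq0 t.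
  by field; rewrite e0 p0 mn m10.
Qed.

(** The curve r = E(t) is where z = 1. *)
Lemma z_on_plane : z = on_plane radius (mono m 0 (fun=> 1)).
Proof.
have [sE pE E0 _] := radius_facts.
have cf : cyl m (mono m 0 (fun=> 1)) by apply: cyl_mono => //; exact: smooth_cst.
apply/funext => p; have [->|p0] := eqVneq p 0; first by rewrite on_plane0 // z_at0.
have [y [t ->]] := polar_pt_surj E0 p0; rewrite (on_planeE pE E0); last by move=> u; exact: cyl_perf cf.
rewrite z_polar_pt ?E0 // /radius -expRD -expRM /mono expr0 !mulr1.
have -> : (y + - m^-1 * ln (P z t)) * m = m * y - ln (P z t) by field.
by rewrite expRB lnK ?posrE ?P_gt0 // divfK // P_neq0.
Qed.

End Surface.

(** * Fields with values in space *)

Section Space.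
Variable R : realType.
Implicit Types (p v : 'rV[R]_2).

Lemma vec3E0 (a b c : R) : vec3 a b c 0 0 = a. Proof. by rewrite mxE. Qed.
Lemma vec3E1 (a b c : R) : vec3 a b c 0 1 = b. Proof. by rewrite mxE. Qed.
Lemma vec3E2 (a b c : R) : vec3 a b c 0 2 = c. Proof. by rewrite mxE. Qed.

Lemma sum3 (f : 'I_3 -> R) : \sum_(c < 3) f c = f 0 + f 1 + f 2.
Proof.
rewrite !big_ord_recl big_ord0 addr0 addrA.
by congr (_ + f _ + f _); exact: val_inj.
Qed.

(** Reduces statements on maps into space to their components. *)
Lemma row_sum (F : 'I_3 -> 'rV[R]_2 -> R) :
  (fun p => \row_(c < 3) F c p) = \sum_(c < 3) (fun p => F c p *: delta_mx 0 c).
Proof.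
apply/funext => p; rewrite fct_sumE; apply/rowP => j; rewrite mxE summxE (bigD1 j) //= !mxE !eqxx mulr1.
by rewrite big1 ?addr0 // => i /negbTE ij; rewrite !mxE eqxx eq_sym ij mulr0.
Qed.

Lemma row_diff (F : 'I_3 -> 'rV[R]_2 -> R) p : (forall c, differentiable (F c) p) ->
  differentiable (fun p => \row_(c < 3) F c p) p.
Proof.
by move=> H; rewrite row_sum; apply: differentiable_sum => c; exact: differentiableZl.
Qed.

Lemma row_derive (F : 'I_3 -> 'rV[R]_2 -> R) p v : (forall c, derivable (F c) p v) ->
  derivable (fun p => \row_(c < 3) F c p) p v /\
  'D_v (fun p => \row_(c < 3) F c p) p = \row_(c < 3) 'D_v (F c) p.
Proof.
move=> H; have e i j : (fun p => (\row_(c < 3) F c p) i j) = F j.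
  by apply/funext => q; rewrite mxE.
have D : derivable (fun p => \row_(c < 3) F c p) p v.
  by apply/derivable_mxP => i j; rewrite e.
by split => //; rewrite derive_mx //; apply/matrixP => i j; rewrite !mxE e.
Qed.

Lemma row_diffE (F : 'I_3 -> 'rV[R]_2 -> R) p v : (forall c, differentiable (F c) p) ->
  'd (fun p => \row_(c < 3) F c p) p v = \row_(c < 3) 'd (F c) p v.
Proof.
move=> H; rewrite -deriveE; last exact: row_diff.
rewrite (row_derive _).2; last by move=> c; exact: diff_derivable.
by apply/rowP => c; rewrite !mxE deriveE.
Qed.

Lemma cont_scale (f : 'rV[R]_2 -> R) (a : 'rV[R]_3) p : {for p, continuous f} ->
  {for p, continuous (fun p => f p *: a)}.
Proof. move=> H; exact: (cvgZr_tmp H). Qed.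

Lemma row_cont (F : 'I_3 -> 'rV[R]_2 -> R) p : (forall c, {for p, continuous (F c)}) ->
  {for p, continuous (fun p => \row_(c < 3) F c p)}.
Proof.
move=> H; rewrite row_sum; move: (index_enum _) => r.
elim: r => [|c r IHr]; first by rewrite big_nil; exact: (@cst_continuous _ _ (0 : 'rV[R]_3) p).
by rewrite big_cons; apply: cvgD IHr; exact: cont_scale.
Qed.

Lemma row_Ck k (F : 'I_3 -> 'rV[R]_2 -> R) : (forall c, Ck k setT (F c)) ->
  Ck k setT (fun p => \row_(c < 3) F c p).
Proof.
elim: k F => [|k IH] F H; split.
- by move=> p _; apply: row_cont => c; exact: (H c).1 p I.
- by [].
- by move=> p _; apply: row_cont => c; exact: (H c).1 p I.
have H1 c i p : derivable (F c) p (delta_mx 0 i) := ((H c).2 i).1 p I.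
move=> i; split; first by move=> p _; exact: (row_derive (fun c => H1 c i p)).1.
have -> : pder i (fun p => \row_(c < 3) F c p) = fun p => \row_(c < 3) pder i (F c) p.
  by apply/funext => p; exact: (row_derive (fun c => H1 c i p)).2.
by apply: IH => c; exact: ((H c).2 i).2.
Qed.

Lemma sum_diff (V : nat -> 'rV[R]_2 -> 'rV[R]_3) n p : (forall j, differentiable (V j) p) ->
  differentiable (fun x => \sum_(1 <= j < n.+1) V j x) p.
Proof.
move=> dV; elim: n => [|n IH].
  rewrite (_ : (fun x => _) = cst (0 : 'rV[R]_3)); first exact: differentiable_cst.
  by apply/funext => x; rewrite big_geq.
have -> : (fun x => \sum_(1 <= j < n.+2) V j x) = (fun x => \sum_(1 <= j < n.+1) V j x) + V n.+1.
  by apply/funext => x; rewrite big_nat_recr.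
exact: differentiableD.
Qed.

Lemma sum_derive (V : nat -> 'rV[R]_2 -> 'rV[R]_3) (d : nat -> 'rV[R]_3) n p v :
  (forall j, is_derive p v (V j) (d j)) ->
  is_derive p v (fun x => \sum_(1 <= j < n.+1) V j x) (\sum_(1 <= j < n.+1) d j).
Proof.
move=> dV; elim: n => [|n IH].
  rewrite (_ : (fun x => _) = cst (0 : 'rV[R]_3)); first by rewrite big_geq //; exact: is_derive_cst.
  by apply/funext => x; rewrite big_geq.
have -> : (fun x => \sum_(1 <= j < n.+2) V j x) = (fun x => \sum_(1 <= j < n.+1) V j x) + V n.+1.
  by apply/funext => x; rewrite big_nat_recr.
by rewrite big_nat_recr //; exact: is_deriveD.
Qed.

(** The differential is computed through directional derivatives, one term of
the sum at a time. *)
Lemma deform_diff (X : 'rV[R]_2 -> 'rV[R]_3) (U : nat -> 'rV[R]_2 -> 'rV[R]_3) q (eps : R) p v :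
  differentiable X p -> (forall j, differentiable (U j) p) ->
  'd (deformation X q U eps) p v =
  'd X p v + 2 *: \sum_(1 <= j < q.+1) eps ^+ j *: 'd (U j) p v.
Proof.
move=> dX dU.
pose S : 'rV[R]_2 -> 'rV[R]_3 := fun p => \sum_(1 <= j < q.+1) (eps ^+ j *: U j) p.
have eS : deformation X q U eps = X + 2 *: S by [].
have dS : differentiable S p by apply: sum_diff => j; exact: differentiableZ.
have D (f : 'rV[R]_2 -> 'rV[R]_3) : differentiable f p -> is_derive p v f ('d f p v).
  by move=> df; rewrite -deriveE //; apply: derivableP; exact: diff_derivable.
have HS : is_derive p v S (\sum_(1 <= j < q.+1) eps ^+ j *: 'd (U j) p v).
  by apply: sum_derive => j; apply: is_deriveZ; exact: D.
have HR := is_deriveD (D _ dX) (is_deriveZ 2 HS).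
have dR : differentiable (X + 2 *: S) p by apply: differentiableD => //; exact: differentiableZ.
rewrite eS; transitivity ('D_v (X + 2 *: S) p); first exact: esym (deriveE v dR).
by case: HR.
Qed.

(** The difference of the two squared lengths is a polynomial in eps.  The
hypothesis kills its coefficients up to degree q, so it is eps^(q+1) times a
polynomial. *)
Lemma bending_expansion q (x : 'rV[R]_3) (u : nat -> 'rV[R]_3) :
  (forall n, (1 <= n <= q)%N -> dotp x (u n) = - \sum_(1 <= i < n) dotp (u i) (u (n - i)%N)) ->
  (fun eps : R => dotp (x + 2 *: \sum_(1 <= j < q.+1) eps ^+ j *: u j)
                       (x + 2 *: \sum_(1 <= j < q.+1) eps ^+ j *: u j) - dotp x x)
  =o_ (0 : R) (fun eps : R => eps ^+ q).
Proof.
move=> H.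
pose a (c : 'I_3) j := if j == 0%N then x 0 c else 2 * u j 0 c.
pose p c := \poly_(j < q.+1) a c j.
pose F := \sum_(c < 3) (p c * p c - (x 0 c * x 0 c)%:P).
have FE eps : dotp (x + 2 *: \sum_(1 <= j < q.+1) eps ^+ j *: u j)
                   (x + 2 *: \sum_(1 <= j < q.+1) eps ^+ j *: u j) - dotp x x = F.[eps].
  rewrite /dotp -sumrB horner_sum; apply: eq_bigr => c _.
  rewrite !hornerE; congr (_ * _ - _); rewrite /p horner_poly -(big_mkord xpredT (fun j => a c j * eps ^+ j));
  rewrite big_ltn // {1}/a eqxx expr0 mulr1 !mxE summxE mulr_sumr; congr (_ + _);
  by apply: eq_big_nat => j /andP[j1 _]; rewrite !mxE /a gtn_eqF //; ring.
have F0 n : (n <= q)%N -> F`_n = 0.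
  move=> nq; rewrite coef_sum.
  have pc c j : (j <= q)%N -> (p c)`_j = a c j by move=> jq; rewrite coef_poly ltnS jq.
  case: n nq => [|n] nq.
    by apply: big1 => c _; rewrite coefB coefC coefM big_ord1 subn0 !pc // /a eqxx subrr.
  have E c : (p c * p c - (x 0 c * x 0 c)%:P)`_n.+1 =
     4 * (x 0 c * u n.+1 0 c) + 4 * \sum_(1 <= i < n.+1) (u i 0 c * u (n.+1 - i)%N 0 c).
    rewrite coefB coefC subr0 coefM -(big_mkord xpredT (fun i => (p c)`_i * (p c)`_(n.+1 - i))).
    rewrite big_ltn // big_nat_recr //= subn0 subnn !pc // /a !eqxx.
    rewrite (eq_big_nat _ _ (F2 := fun i => 4 * (u i 0 c * u (n.+1 - i)%N 0 c))); last first.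
      move=> i /andP[i1 i2]; rewrite !pc; first by rewrite /a gtn_eqF // subn_eq0 leqNgt i2 /=; ring.
        by rewrite leq_subLR; apply: leq_trans nq _; exact: leq_addl.
      by apply: leq_trans nq; exact: ltnW.
    by rewrite -mulr_sumr /=; ring.
  rewrite (eq_bigr _ (fun c _ => E c)) big_split /= -!mulr_sumr exchange_big /=.
  by have := H n.+1; rewrite nq /dotp => /(_ erefl) ->; ring.
have FD : F = drop_poly q.+1 F * 'X^(q.+1).
  rewrite -[LHS](poly_take_drop q.+1) (_ : take_poly q.+1 F = 0) ?add0r //.
  by apply/polyP => i; rewrite coef_take_poly coef0; case: ifP => // iq; apply: F0.
set G := drop_poly _ _ in FD.
apply/eqoP => e e0.
have [C C0 HC] : exists2 C, 0 < C & \forall h \near (0 : R), `|G.[h]| <= C.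
  exists (`|G.[0]| + 1); first by rewrite ltr_wpDl.
  have /cvgrPdist_le/(_ _ ltr01) := @continuous_horner R G 0.
  apply: filterS => h hh; rewrite -lerBlDl; apply: le_trans hh.
  by rewrite distrC; exact: lerB_dist.
have d0 : 0 < e / C by rewrite divr_gt0.
near=> h.
rewrite FE FD hornerM hornerXn exprS !normrM mulrA ler_wpM2r //.
have h1 : `|G.[h]| <= C by near: h.
have h2 : `|h| <= e / C.
  near: h; apply/nbhs_ballP; exists (e / C) => //= h; rewrite /ball /= sub0r normrN; exact: ltW.
have -> : e = C * (e / C) by field; rewrite gt_eqF.
exact: ler_pM.
Unshelve. all: by end_near.
Qed.

End Space.

(** * Bendings of every order *)

Section Sequence.
Variable R : realType.
Variables (m N : R) (E q : R -> R).
Hypotheses (m2 : 2 <= m) (sE : smooth E) (pE : per E) (E0 : forall t, 0 < E t).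
Hypotheses (sq : smooth q) (pq : per q) (q0 : forall t, 0 <= q t).
Hypothesis qpos : exists2 t, 0 < t < 2 * pi & 0 < q t.
Hypothesis HE : forall t, derive1 (derive1 E) t =
  (1 - (m - 1) * q t + 2 * (derive1 E t / E t) ^+ 2) * E t.
Hypotheses (mN : m <= N) (N2 : 2 < N).

Lemma cyl_sum nu (I : Type) (r : seq I) (f : I -> R -> R -> R) : (forall i, cyl nu (f i)) ->
  cyl nu (fun y t => \sum_(i <- r) f i y t).
Proof.
move=> H; elim: r => [|i r IH].
  by apply: cyl_ext (cyl0 nu) => y t; rewrite big_nil.
by apply: cyl_ext (cyl_add (H i) IH) => y t; rewrite big_cons.
Qed.

Implicit Types F : nat -> 'I_3 -> R -> R -> R.

(** The sum over 1 <= i < j of the products of orders i and j - i that appears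
at order j. *)
Definition convol (b : 'I_3 -> nat -> nat -> R -> R -> R) (j : nat) : R -> R -> R := fun y t =>
  - \sum_(1 <= i < j) \sum_(c < 3) b c i (j - i)%N y t.

Definition convol_yy F := convol (fun c i j y t => Dy (F i c) y t * Dy (F j c) y t).
Definition convol_yt F := convol (fun c i j y t =>
  Dy (F i c) y t * Dt (F j c) y t + Dt (F i c) y t * Dy (F j c) y t).
Definition convol_tt F := convol (fun c i j y t => Dt (F i c) y t * Dt (F j c) y t).

Definition order_eqs F j := bending_eqs m E (convol_yy F j) (convol_yt F j) (convol_tt F j)
  (F j 0) (F j 1) (F j 2).

Lemma cyl_convol nu b j : (forall c i j, cyl nu (b c i j)) -> cyl nu (convol b j).
Proof. by move=> H; apply: cylN; apply: cyl_sum => i; apply: cyl_sum => c; exact: H. Qed.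

Lemma convol_ext b b' j : (forall c i, (0 < i < j)%N -> b c i (j - i)%N = b' c i (j - i)%N) ->
  convol b j = convol b' j.
Proof.
move=> H; apply: fun2_ext => y t; congr (- _); apply: eq_big_nat => i ij.
by apply: eq_bigr => c _; rewrite H.
Qed.

(** The equations of order j only involve the fields of order at most j. *)
Lemma order_eqs_ext F F' j : (forall i, (i <= j)%N -> F i = F' i) -> order_eqs F j -> order_eqs F' j.
Proof.
move=> H; rewrite /order_eqs -(H j) //.
have e i : (0 < i < j)%N -> F i = F' i /\ F (j - i)%N = F' (j - i)%N.
  by move=> /andP[i0 ij]; split; apply: H; [exact: ltnW|exact: leq_subr].
suff [-> -> ->] : [/\ convol_yy F j = convol_yy F' j, convol_yt F j = convol_yt F' j
   & convol_tt F j = convol_tt F' j] by [].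
by split; apply: convol_ext => c i /e[-> ->].
Qed.

(** Each order is solved in turn; earlier fields are not modified, so the
equations already satisfied persist. *)
Lemma bend_seq l : (0 < l)%N -> exists F, [/\ forall i c, cyl N (F i c),
  forall j, (0 < j <= l)%N -> order_eqs F j & exists y t, F 1%N 2 y t != 0].
Proof.
pose tri (u v w : R -> R -> R) (c : 'I_3) := if c == 0 then u else if c == 1 then v else w.
elim: l => // -[_ _|l IH _].
  have [u [v [w [cu cv cw H nz]]]] := bend_first m2 sE pE E0 sq pq q0 qpos HE mN N2.
  exists (fun _ => tri u v w); split=> //.
    by move=> _ c; rewrite /tri; case: ifP => // _; case: ifP.
  move=> j; rewrite andbC -ltnS ltnS => /andP[j1 j0]; have {j0 j1} -> : j = 1%N by apply/eqP; rewrite eqn_leq j1.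
  have e b : convol b 1 = fun _ _ => 0 by apply: fun2_ext => y t; rewrite /convol big_geq // oppr0.
  by rewrite /order_eqs /convol_yy /convol_yt /convol_tt !e.
have [F [cF HF nz]] := IH isT.
have c2 f g : cyl N f -> cyl N g -> cyl (2 * N) (fun y t => f y t * g y t).
  by move=> cf cg; rewrite mulr_natl mulr2n; exact: cylM.
have [||| u [v [w [cu cv cw H]]]] := bend_solve (A := convol_yy F l.+2) (C2 := convol_yt F l.+2)
   (D := convol_tt F l.+2) m2 sE pE E0 sq pq q0 qpos HE mN N2.
- by apply: cyl_convol => c i j; apply: c2; exact: cylDy.
- apply: cyl_convol => c i j; apply: cyl_add; apply: c2; do [exact: cylDy|exact: cylDt].
- by apply: cyl_convol => c i j; apply: c2; exact: cylDt.
pose F' i := if i == l.+2 then tri u v w else F i.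
have FF i : (i <= l.+1)%N -> F i = F' i by move=> il; rewrite /F' ltn_eqF.
exists F'; split; last by rewrite -FF.
- move=> i c; rewrite /F'; case: ifP => // _.
  by rewrite /tri; case: ifP => // _; case: ifP.
move=> j /andP[j0]; rewrite leq_eqVlt => /orP[/eqP ->|jl]; last first.
  by apply: (@order_eqs_ext F); [move=> i ij; apply: FF; exact: leq_trans ij jl|apply: HF; rewrite j0].
rewrite /order_eqs.
have sl i : (0 < i)%N -> (l.+2 - i <= l.+1)%N by move=> i0; rewrite leq_subLR -addn1 addnC leq_add2r.
have <- : convol_yy F l.+2 = convol_yy F' l.+2.
  by apply: convol_ext => c i /andP[i0 il]; rewrite -!FF // sl.
have <- : convol_yt F l.+2 = convol_yt F' l.+2.
  by apply: convol_ext => c i /andP[i0 il]; rewrite -!FF // sl.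
have <- : convol_tt F l.+2 = convol_tt F' l.+2.
  by apply: convol_ext => c i /andP[i0 il]; rewrite -!FF // sl.
by rewrite /F' eqxx.
Qed.

End Sequence.

Section Assembly.
Variable R : realType.
Variables (m N : R) (E : R -> R) (z : 'rV[R]_2 -> R).
Hypotheses (m1 : 1 < m) (N1 : 1 < N) (sE : smooth E) (pE : per E) (E0 : forall t, 0 < E t).
Hypothesis zE : z = on_plane E (mono m 0 (fun=> 1)).
Implicit Types (p v : 'rV[R]_2) (t y : R).

Let cz : cyl m (mono m 0 (fun=> (1 : R))).
Proof. by apply: cyl_mono => //; exact: smooth_cst. Qed.

Definition field_of (f : 'I_3 -> R -> R -> R) p : 'rV[R]_3 := \row_(c < 3) on_plane E (f c) p.

Lemma field_diff f p : (forall c, cyl N (f c)) -> differentiable (field_of f) p.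
Proof. by move=> cf; apply: row_diff => c; exact: on_plane_diff (cf c). Qed.

Lemma field_diffE f p v : (forall c, cyl N (f c)) ->
  'd (field_of f) p v = \row_(c < 3) on_plane E (dir_der E v (f c)) p.
Proof.
move=> cf; have D c : differentiable (on_plane E (f c)) p by exact: on_plane_diff (cf c).
rewrite row_diffE //; apply/rowP => c; rewrite !mxE -deriveE //.
by have [_ e] := on_plane_is_derive sE pE E0 v p N1 (cf c); exact: e.
Qed.

Lemma graphE : graph z = fun p => \row_(c < 3) [:: fun p => p 0 0; fun p => p 0 1; z]`_c p.
Proof. by apply/funext => p; apply/rowP => -[[|[|[|//]]] Hc]; rewrite !mxE. Qed.

Let coords_diff p (c : 'I_3) : differentiable (nth 0 [:: fun p => p 0 0; fun p => p 0 1; z] c) p.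
Proof.
case: c => [[|[|[|//]]] Hc] /=; [exact: differentiable_coord|exact: differentiable_coord|].
by rewrite zE; exact: on_plane_diff cz.
Qed.

Lemma graph_diff p : differentiable (graph z) p.
Proof. by rewrite graphE; apply: row_diff => c; exact: coords_diff. Qed.

Lemma coord_derive p v (i : 'I_2) : 'd (fun p : 'rV[R]_2 => p 0 i) p v = v 0 i.
Proof.
rewrite -deriveE; last exact: differentiable_coord.
suff D : is_derive p v (fun p : 'rV[R]_2 => p 0 i) (v 0 i) by case: D.
apply: line_der0.
have -> : (fun k : R => (k *: v + p) 0 i) = fun k => v 0 i * k + p 0 i.
  by apply/funext => k; rewrite !mxE mulrC.
by have := derD (derZ (v 0 i) (@der_id R)) (der_cst (p 0 i)) 0; rewrite mulr1 addr0.
Qed.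

Lemma graph_diffE p v : 'd (graph z) p v = vec3 (v 0 0) (v 0 1) (on_plane E (dir_der E v (mono m 0 (fun=> 1))) p).
Proof.
rewrite graphE row_diffE; last by move=> c; exact: coords_diff.
apply/rowP => -[[|[|[|//]]] Hc]; rewrite !mxE /= ?coord_derive //.
rewrite -deriveE; last by have := coords_diff p 2.
by rewrite zE; have [_ e] := on_plane_is_derive sE pE E0 v p m1 cz; exact: e.
Qed.

(** For v with components alpha and beta along the directions of y and t, both
sides are quadratic in (alpha, beta), and their coefficients are compared by
the three bending equations.  At the origin all differentials vanish. *)
Lemma field_bends F n : (forall i c, cyl N (F i c)) -> order_eqs m E F n -> forall p v,
  dotp ('d (graph z) p v) ('d (field_of (F n)) p v) =
  - \sum_(1 <= i < n) dotp ('d (field_of (F i)) p v) ('d (field_of (F (n - i)%N)) p v).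
Proof.
move=> cF H p v; have eF i := field_diffE p v (cF i).
pose D i : 'rV[R]_3 := \row_(c < 3) on_plane E (dir_der E v (F i c)) p.
pose G := vec3 (v 0 0) (v 0 1) (on_plane E (dir_der E v (mono m 0 (fun=> 1))) p).
suff main : dotp G (D n) = - \sum_(1 <= i < n) dotp (D i) (D (n - i)%N).
  transitivity (dotp G (D n)); first exact: (congr2 (@dotp R 3) (graph_diffE p v) (eF n)).
  rewrite main; congr (- _); apply: eq_bigr => i _.
  exact: esym (congr2 (@dotp R 3) (eF i) (eF (n - i)%N)).
rewrite /dotp sum3 /G vec3E0 vec3E1 vec3E2 /D {G D eF}.
have [->|p0] := eqVneq p 0.
  rewrite !mxE !on_plane0 // !mulr0 !addr0 big1 ?oppr0 // => i _.
  by apply: big1 => c _; rewrite !mxE !on_plane0 // mulr0.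
have [y [t ->]] := polar_pt_surj E0 p0.
have plF i c : on_plane E (dir_der E v (F i c)) (polar_pt E y t) = dir_der E v (F i c) y t.
  by apply: (on_planeE pE E0) => u; exact: cyl_perf (cyl_dir_der sE pE E0 v (cF i c)).
rewrite !mxE !plF (on_planeE pE E0); last by move=> u; exact: cyl_perf (cyl_dir_der sE pE E0 v cz).
have [] := H y t.
(* The components of v in the basis of the directions of y and t. *)
pose a := expR (-1 * y) * ((E t)^-1 * (rad_part v t - derive1 E t / E t * ang_part v t)).
pose b := expR (-1 * y) * ((E t)^-1 * ang_part v t).
have DvE f : dir_der E v f y t = a * Dy f y t + b * Dt f y t by rewrite /dir_der /a /b; ring.
have e1 : expR (-1 * y) * expR y = 1 by rewrite -expRD mulN1r addNr expR0.
have En : E t != 0 by rewrite gt_eqF.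
have v0E : v 0 0 = expR y * (a * gam0 E t + b * dgam0 E t).
  rewrite /a /b /gam0 /dgam0 /rad_part /ang_part.
  transitivity (expR (-1 * y) * expR y * (v 0 0 * (cos t ^+ 2 + sin t ^+ 2))); last by field.
  by rewrite e1 cos2Dsin2 mul1r mulr1.
have v1E : v 0 1 = expR y * (a * gam1 E t + b * dgam1 E t).
  rewrite /a /b /gam1 /dgam1 /rad_part /ang_part.
  transitivity (expR (-1 * y) * expR y * (v 0 1 * (cos t ^+ 2 + sin t ^+ 2))); last by field.
  by rewrite e1 cos2Dsin2 mul1r mulr1.
have zz : dir_der E v (mono m 0 (fun=> 1)) y t = a * (m * expR (m * y)).
  rewrite DvE (hasDyE (mono_hasDy m 0 (fun=> (1 : R)))).
  rewrite (hasDtE (@mono_hasDt R m 0 _ (smooth_der1 (smooth_cst 1)))) (derEf (der_cst 1)).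
  by rewrite /mono expr0; ring.
rewrite zz v0E v1E !DvE => H1 H2 H3.
transitivity (a ^+ 2 * convol_yy F n y t + a * b * convol_yt F n y t + b ^+ 2 * convol_tt F n y t).
  by rewrite -H1 -H2 -H3; ring.
rewrite /convol_yy /convol_yt /convol_tt /convol !mulrN -!opprD !mulr_sumr -!big_split /=.
congr (- _); apply: eq_bigr => i _; rewrite !mulr_sumr -!big_split /=.
by apply: eq_bigr => c _; rewrite !mxE !plF !DvE; ring.
Qed.

(** The vertical component of A x R + B is A0 p1 - A1 p0 + B2, whereas that of
the field has value and differential 0 at the origin; so the vertical component
would vanish everywhere. *)
Lemma field_nontrivial f : (forall c, cyl N (f c)) -> (exists y t, f 2 y t != 0) ->
  ~ trivial_field (graph z) (field_of f).
Proof.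
move=> cf [y [t nz]] [A [B H]].
have H2 p : on_plane E (f 2) p = A 0 0 * p 0 1 - A 0 1 * p 0 0 + B 0 2.
  by have /rowP/(_ 2) := H p; rewrite !mxE.
have B0 : B 0 2 = 0 by have := H2 0; rewrite on_plane0 // !mxE !mulr0 subr0 add0r.
have L v : A 0 0 * v 0 1 - A 0 1 * v 0 0 = 0.
  have [_ <-] := on_plane_der0 sE pE E0 v N1 (cf 2).
  suff D : is_derive (0 : 'rV[R]_2) v (on_plane E (f 2)) (A 0 0 * v 0 1 - A 0 1 * v 0 0) by case: D.
  apply: line_der0.
  have -> : (fun k : R => on_plane E (f 2) (k *: v + 0)) = fun k => (A 0 0 * v 0 1 - A 0 1 * v 0 0) * k.
    by apply/funext => k; rewrite H2 B0 !mxE; ring.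
  by have := derZ (A 0 0 * v 0 1 - A 0 1 * v 0 0) (@der_id R) 0; rewrite mulr1.
move: nz; rewrite -(on_planeE pE E0 (f := f 2)); last by move=> u; exact: cyl_perf (cf 2).
by rewrite H2 L B0 addr0 eqxx.
Qed.

End Assembly.

Theorem theorem4p3 (R : realType) (m : R) (z : 'rV[R]_2 -> R) (theta : seq R) :
  2 <= m ->
  (forall p, 0 <= z p) ->
  homogeneous_of_order m z ->
  Cinfty [set p | p != 0] z ->
  (forall p, p != 0 -> 0 <= gaussian_curvature z p) ->
  has_no_asymptotic_curve z ->
  (forall x : R, 0 <= x < 2 * pi -> x \notin theta ->
     0 < m ^+ 2 * P z x ^+ 2 + m * P z x * derive1n 2 (P z) x
         - (m - 1) * derive1 (P z) x ^+ 2) ->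
  lebesgue_measure.-integrable `[0, 2 * pi] (EFin \o c1 m z) ->
  lebesgue_measure.-integrable `[0, 2 * pi] (EFin \o c2 m z) ->
  NZ_span (b2 m z) (b1 m z) `&` NZ_span (m * b1 m z) pi = set0 ->
  forall k l : nat, (1 <= k)%N -> (1 <= l)%N ->
  exists U : nat -> 'rV[R]_2 -> 'rV[R]_3,
    [/\ forall j : nat, (1 <= j <= l)%N -> Ck k setT (U j),
        infinitesimal_bending (graph z) l U &
        ~ trivial_field (graph z) (U 1%N)].
Proof.
move=> m2 z0 hz sz _ noasym pos _ _ _ k l _ l1.
have [sE pE E0 HE] := radius_facts m2 z0 hz sz noasym.
have [sq pq q0 qpos] := qweight_facts m2 z0 hz sz noasym pos.
have zE := z_on_plane m2 z0 hz sz noasym.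
have k0 : 0 <= k%:R :> R by [].
(* Large enough for the class C^k, for the loss of m in bend_solve, and for the
   exponents to stay positive in bend_from_w. *)
pose N := m + k%:R + 1.
have mN : m <= N by rewrite /N; lra.
have N2 : 2 < N by rewrite /N; lra.
have N1 : 1 < N by lra.
have kN : k%:R < N by rewrite /N; lra.
have m1 : 1 < m by lra.
have [F [cF HF nz]] := bend_seq m2 sE pE E0 sq pq q0 qpos HE mN N2 l1.
exists (fun j => field_of (radius m z) (F j)); split.
- by move=> j _; apply: row_Ck => c; exact: on_plane_Ck kN (cF j c).
- move=> p v; rewrite /first_fundamental_form.
  have dg := graph_diff m1 sE pE E0 zE p.
  have dF j := field_diff N1 sE pE E0 p (cF j).
  have eD eps := deform_diff l eps v dg dF.
  rewrite (_ : (fun eps : R => _) = fun eps => let W := 'd (graph z) p v +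
     2 *: \sum_(1 <= j < l.+1) eps ^+ j *: 'd (field_of (radius m z) (F j)) p v in
     dotp W W - dotp ('d (graph z) p v) ('d (graph z) p v)); last first.
    apply/funext => eps.
    exact: (congr1 (fun W => dotp W W - dotp ('d (graph z) p v) ('d (graph z) p v)) (eD eps)).
  apply: bending_expansion => n nl.
  exact: (field_bends m1 N1 sE pE E0 zE cF (HF n nl) p v).
- exact: field_nontrivial (cF 1%N) nz.
Qed.
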